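(* Let $\Omega$ be a thick open subset of $\mathbb{R}^n$, and suppose that the shape function $h \in L^1(\mathbb{R}^n)$ satisfies: $h(x)\ge 0$ for all $x\in\mathbb{R}^n$; $h(Ox)=h(x)$ for all $x\in\mathbb{R}^n$ and all orthogonal matrices $O\in\mathbb{R}^{n\times n}$; $\|h\|_{L^1(\mathbb{R}^n)}=1$; and $h$ is radially decreasing, i.e. $h(y)\le h(x)$ whenever $\|x\|\le\|y\|$. Then there exists $\epsilon_0>0$ such that for every $p\in[1,\infty]$, $\{P_\epsilon\}_{0<\epsilon<\epsilon_0}$ is a (well-defined) uniformly bounded family of operators from $L^p(\Omega)$ to itself. If, in addition, $h$ satisfies the decay bound $|h(x)|\le C(1+\|x\|)^{-(n+\delta)}$ for all $x\in\mathbb{R}^n$ and some $C,\delta>0$, then the following hold. 1. For every $p\in(1,\infty]$ and $f\in L^p(\Omega)$, $P_\epsilon f$ converges to $f$ almost everywhere on $\Omega$ as $\epsilon\to0^+$. 2. For every $p\in(1,\infty)$ and $f\in L^p(\Omega)$, $P_\epsilon f$ converges to $f$ in $L^p(\Omega)$ norm as $\epsilon\to0^+$. 3. For every $p\in(1,\infty]$ with conjugate exponent $q$, $\frac1p+\frac1q=1$: if $h\in L^1(\mathbb{R}^n)\cap L^q(\mathbb{R}^n)$, then for every $f\in L^p(\Omega)$ and $\epsilon\in(0,\epsilon_0)$, $P_\epsilon f$ lies in $C_b(\Omega)$. 4. If $\Omega$ is bounded and $h\in L^1(\mathbb{R}^n)\cap H^r(\mathbb{R}^n)$ with $r\in\mathbb{N}_0$,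 then for every $f\in L^2(\Omega)$ and $\epsilon\in(0,\epsilon_0)$, $P_\epsilon f$ lies in $C^r(\Omega)$.
   Context: $\|\cdot\|$ is the Euclidean norm, $|\cdot|$ of a set is Lebesgue measure, and $B_\epsilon(x)$ is the open Euclidean ball of radius $\epsilon$ centered at $x$. All functions are real-valued. A Lebesgue-measurable set $\Omega\subseteq\mathbb{R}^n$ is thick if there exist $c,\epsilon_0>0$ such that $|B_\epsilon(x)\cap\Omega|>c\,|B_\epsilon(x)|$ for all $\epsilon\in(0,\epsilon_0)$ and all $x\in\Omega$. For $\epsilon>0$ set $h_\epsilon(x)=\epsilon^{-n}h(x/\epsilon)$, $k_\epsilon(x,y)=h_\epsilon(y-x)$, and $d_\epsilon(x)=(h_\epsilon*1_\Omega)(x)=\int_\Omega k_\epsilon(x,y)\,dy$. Whenever $d_\epsilon>0$ on $\Omega$, the Markov kernel is $p_\epsilon(x,y)=k_\epsilon(x,y)/d_\epsilon(x)$ for $x,y\in\Omega$, and $P_\epsilon f(x)=\int_\Omega p_\epsilon(x,y)f(y)\,dy$ for $x\in\Omega$; that is, $P_\epsilon f=(h_\epsilon*f)/(h_\epsilon*1_\Omega)$ on $\Omega$, with $f$ extended by zero outside $\Omega$. $C_b(\Omega)$ is the space of bounded continuous functions on $\Omega$; $C^r(\Omega)$ is the space of $r$-times continuously differentiable functions on $\Omega$; $H^r(\mathbb{R}^n)$ is the set of $h\in L^2(\mathbb{R}^n)$ whose Fourier transform $\hat h$ satisfies $\int_{\mathbb{R}^n}|\hat h(\omega)|^2(1+\|\omega\|^2)^r\,d\omega<\infty$.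 *)

(* Defs.v *)
From HB Require Import structures.
From mathcomp Require Import all_boot all_order all_algebra.
From mathcomp Require Import all_classical all_reals all_analysis.

Set Implicit Arguments.
Unset Strict Implicit.
Unset Printing Implicit Defensive.

Import Order.TTheory GRing.Theory Num.Theory.
Import numFieldNormedType.Exports.

Local Open Scope classical_set_scope.
Local Open Scope ring_scope.

Section euclidean.
Context {R : realType} {n : nat}.
Implicit Types x y : 'rV[R]_n.

(* The library norm on ['rV[R]_n] is the sup norm; it defines the usual
   topology, but lengths and balls here must be Euclidean. *)
Definition dotp x y : R := \sum_(i < n) x 0 i * y 0 i.
Definition enorm x : R := Num.sqrt (\sum_(i < n) x 0 i ^+ 2).
Definition eball x (e : R) : set 'rV[R]_n := [set y | enorm (y - x) < e].

End euclidean.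

(* Lebesgue measure on R^n, obtained by Caratheodory's construction from the
   outer measure given by countable covers by half-open boxes; the measurable
   sets are therefore all Lebesgue-measurable sets, not just the Borel ones.
   [None] denotes the empty box, so that finite covers are also allowed (this
   matters for n = 0, where every nonempty box has volume 1). *)
Section lebesgue.
Context {R : realType} {n : nat}.

Definition box (B : option ('rV[R]_n * 'rV[R]_n)) : set 'rV[R]_n :=
  if B is Some (a, b) then [set x | forall i, a 0 i < x 0 i <= b 0 i] else set0.

Definition box_vol (B : option ('rV[R]_n * 'rV[R]_n)) : R :=
  if B is Some (a, b) then \prod_(i < n) Num.max 0 (b 0 i - a 0 i) else 0.

Definition leb_outer (A : set 'rV[R]_n) : \bar R :=
  ereal_inf [set (\sum_(k <oo) (box_vol (B k))%:E)%E
            | B in [set B | A `<=` \bigcup_k box (B k)]].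

Local Open Scope ereal_scope.

Lemma box_vol_ge0 B : 0 <= (box_vol B)%:E.
Proof.
rewrite lee_fin; case: B => [[a b]|] //=.
by apply: prodr_ge0 => i _; rewrite le_max lexx.
Qed.

Lemma leb_outer_ge0 A : 0 <= leb_outer A.
Proof.
by apply: le_ereal_inf_tmp => x [B _ <-]; apply: nneseries_ge0 => k _ _;
  exact: box_vol_ge0.
Qed.

Lemma leb_outer0 : leb_outer set0 = 0.
Proof.
apply/eqP; rewrite eq_le leb_outer_ge0 andbT.
apply: ereal_inf_lbound; exists (fun=> None); first by [].
by rewrite eseries0.
Qed.

Lemma le_leb_outer : {homo leb_outer : A B / A `<=` B >-> A <= B}.
Proof.
move=> A B AB; apply: ereal_inf_le_tmp => x [C BC <-]; exists C => //.
exact: subset_trans BC.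
Qed.

Lemma leb_outer_sigma_subadditive : sigma_subadditive leb_outer.
Proof.
move=> A; have [[i ioo]|] := pselect (exists i, leb_outer (A i) = +oo).
  rewrite (eseries_pinfty _ _ ioo) ?leey// => m _.
  by rewrite -ltNye (lt_le_trans _ (leb_outer_ge0 _)).
rewrite -forallNE => Aoo.
suff add2e (e : {posnum R}) :
    leb_outer (\bigcup_m A m) <= \sum_(i <oo) leb_outer (A i) + e%:num%:E.
  by apply/lee_addgt0Pr => _/posnumP[].
rewrite (le_trans _ (epsilon_trick _ _ _))//; last first.
  by move=> m; exact: leb_outer_ge0.
pose P m (B : nat -> option ('rV[R]_n * 'rV[R]_n)) :=
  A m `<=` \bigcup_k box (B k) /\
  \sum_(k <oo) (box_vol (B k))%:E
    <= leb_outer (A m) + (e%:num / (2 ^ m.+1)%:R)%:E.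
have [G PG] : {G : nat -> nat -> option ('rV[R]_n * 'rV[R]_n) &
    forall m, P m (G m)}.
  apply: (@choice _ _ P) => m; rewrite /P /leb_outer.
  set S := (X in ereal_inf X); move infS : (ereal_inf S) => iS.
  case: iS infS => [r Sr|Soo|Soo].
  - have em : (0 < e%:num / (2 ^ m.+1)%:R)%R by [].
    have /(lb_ereal_inf_adherent em) : ereal_inf S \is a fin_num by rewrite Sr.
    move=> [x [B AB muBx] xS].
    by exists B; split => //; rewrite muBx -Sr; exact/ltW.
  - by have := Aoo m; rewrite /leb_outer Soo.
  - suff : lbound S 0 by move/le_ereal_inf_tmp; rewrite Soo.
    move=> /= _ [B AB <-]; apply: nneseries_ge0 => k _ _; exact: box_vol_ge0.
pose v (x : nat * nat) := (box_vol (uncurry G x))%:E.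
have v_ge0 x : 0 <= v x by exact: box_vol_ge0.
apply: (@le_trans _ _ (\esum_(i in setT) v i)).
  rewrite /leb_outer; apply: ereal_inf_lbound => /=.
  have /card_esym/ppcard_eqP[f] := card_nat2.
  exists (uncurry G \o f).
    apply: (@subset_trans _  (\bigcup_m \bigcup_k box (G m k))) => [t [i _]|].
      by move=> /((PG i).1) -[j _ ?]; exists i => //; exists j.
    move=> t [i _ [j _ Bijt]]; exists (f^-1%FUN (i, j)) => //=.
    by rewrite invK ?inE.
  rewrite -(esum_pred_image v _ xpredT) ?[fun=> _]set_true//.
  by rewrite image_eq.
rewrite (_ : esum _ _ = \sum_(i <oo) \sum_(j <oo) v (i, j)); last first.
  pose J : nat -> set (nat * nat) := fun i => [set (i, j) | j in setT].
  rewrite (_ : setT = \bigcup_k J k); last first.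
    by rewrite predeqE => -[a b]; split => // _; exists a => //; exists b.
  rewrite esum_bigcupT //=; last first.
    apply/trivIsetP => i j _ _ ij.
    rewrite predeqE => -[x y] /=; split => //= -[] [_] _ [<-{x} _].
    by move=> [y' _] [] /esym/eqP; rewrite (negbTE ij).
  rewrite -(image_id [set: nat]) -fun_true esum_pred_image//; last first.
    by move=> m _; exact: esum_ge0.
  apply: eq_eseriesr => /= j _.
  rewrite -(esum_pred_image v (pair j) predT)//=; last first.
    by move=> ? ? _ _; exact: (@can_inj _ _ _ snd).
  by congr esum; rewrite predeqE => -[a b]; split; move=> [i _ <-]; exists i.
apply: lee_lim.
- apply: is_cvg_nneseries => m *.
  by apply: nneseries_ge0 => k *; exact: (v_ge0 (m, k)).
- by apply: is_cvg_nneseries => m *; apply: adde_ge0 => //;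
    exact: leb_outer_ge0.
- by near=> m; apply: lee_sum => i _; exact: (PG i).2.
Unshelve. all: by end_near. Qed.

HB.instance Definition _ := isOuterMeasure.Build R 'rV[R]_n leb_outer
  leb_outer0 leb_outer_ge0 le_leb_outer leb_outer_sigma_subadditive.

End lebesgue.

(* ['rV[R]_n] equipped with the sigma-algebra of Lebesgue-measurable sets *)
Definition lebRn (R : realType) (n : nat) := caratheodory_type (@leb_outer R n).

Definition leb (R : realType) (n : nat) : set (lebRn R n) -> \bar R :=
  @leb_outer R n.

Arguments leb : clear implicits.

HB.instance Definition _ (R : realType) (n : nat) :=
  isMeasure.Build _ (lebRn R n) R (leb R n)
    (@caratheodory_measure0 R _ (@leb_outer R n))
    (@caratheodory_measure_ge0 R _ (@leb_outer R n))
    (@caratheodory_measure_sigma_additive R _ (@leb_outer R n)).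

Section function_spaces.
Context {R : realType} {n : nat}.
Implicit Types (Omega : set 'rV[R]_n) (f g : 'rV[R]_n -> R).

Definition thick Omega : Prop :=
  measurable (Omega : set (lebRn R n)) /\
  exists c e0 : R, [/\ 0 < c, 0 < e0 &
    forall (e : R) x, 0 < e < e0 -> Omega x ->
      (c%:E * leb R n (eball x e) < leb R n (eball x e `&` Omega))%E].

(* A function on Omega is given by a function on R^n, whose values outside
   Omega are ignored: [f \_ Omega] is its extension by zero. *)
Definition Lp Omega (p : \bar R) : set ('rV[R]_n -> R) :=
  [set f | (f \_ Omega : lebRn R n -> R) \in Lfun (leb R n) p].

Definition Lp_norm Omega (p : \bar R) f : \bar R :=
  'N[leb R n]_p[EFin \o (f \_ Omega)].

(* Lp is made of functions rather than of classes modulo a.e. equality, so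
   compatibility with a.e. equality is stated explicitly, and linearity is
   up to a.e. equality. *)
Definition Lp_operator Omega (p : \bar R)
    (T : ('rV[R]_n -> R) -> ('rV[R]_n -> R)) : Prop :=
  [/\ forall f, Lp Omega p f -> Lp Omega p (T f),
      forall f g, Lp Omega p f -> Lp Omega p g ->
        ae_eq (leb R n) Omega f g -> ae_eq (leb R n) Omega (T f) (T g) &
      forall (a : R) f g, Lp Omega p f -> Lp Omega p g ->
        ae_eq (leb R n) Omega (T (fun x => a * f x + g x))
                              (fun x => a * T f x + T g x)].

Definition Cb Omega : set ('rV[R]_n -> R) :=
  [set f | {within Omega, continuous f} /\ [bounded f x | x in Omega]].

(* For Omega open: all partial derivatives of order at most r exist and are
   continuous on Omega. *)
Fixpoint Cr Omega (r : nat) (f : 'rV[R]_n -> R) : Prop :=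
  if r is r'.+1 then
    (forall x, Omega x -> differentiable f x) /\
    forall i : 'I_n, Cr Omega r' (fun x => 'D_(delta_mx 0 i) f x)
  else {within Omega, continuous f}.

(* Real and imaginary parts of the Fourier transform
   \int f(x) exp(- i <x, w>) dx of a real-valued integrable f. *)
Definition fourier_re f (w : 'rV[R]_n) : R :=
  \int[leb R n]_(x in setT) (f x * cos (dotp x w)).
Definition fourier_im f (w : 'rV[R]_n) : R :=
  - \int[leb R n]_(x in setT) (f x * sin (dotp x w)).

(* [u + i v] is the Fourier (Plancherel) transform of the L^2 function f: it is
   the L^2 limit of the Fourier transforms of the truncations of f to balls,
   which are integrable. *)
Definition fourier_L2 f (u v : 'rV[R]_n -> R) : Prop :=
  let trunc (k : nat) := f \_ (eball 0 k%:R) in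
  [/\ Lp setT 2%:E u, Lp setT 2%:E v,
      Lp_norm setT 2%:E (fun w => fourier_re (trunc k) w - u w)
        @[k --> \oo] --> 0%E &
      Lp_norm setT 2%:E (fun w => fourier_im (trunc k) w - v w)
        @[k --> \oo] --> 0%E].

Definition Hr (r : nat) : set ('rV[R]_n -> R) :=
  [set f | Lp setT 2%:E f /\ exists u v, fourier_L2 f u v /\
    (\int[leb R n]_(w in setT)
       ((u w ^+ 2 + v w ^+ 2) * (1 + enorm w ^+ 2) ^+ r)%:E < +oo)%E].

End function_spaces.

Section markov.
Context {R : realType} {n : nat}.
Variables (Omega : set 'rV[R]_n) (h : 'rV[R]_n -> R) (e : R).
Implicit Types (x y : 'rV[R]_n) (f : 'rV[R]_n -> R).

Definition hscale x : R := e ^- n * h (e^-1 *: x).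
Definition kern x y : R := hscale (y - x).
Definition dens x : R := \int[leb R n]_(y in Omega) kern x y.
Definition markov_kern x y : R := kern x y / dens x.
Definition markov_op f x : R :=
  \int[leb R n]_(y in Omega) (markov_kern x y * f y).

(* [markov_op f x] is a total expression; this says that its integral is
   actually defined. *)
Definition markov_defined f x : Prop :=
  (leb R n).-integrable Omega (fun y => (markov_kern x y * f y)%:E).

End markov.

(* Main.v *)
Require Import Defs.
From HB Require Import structures.
From mathcomp Require Import all_boot all_order all_algebra.
From mathcomp Require Import all_classical all_reals all_analysis.
From mathcomp Require Import measurable_realfun ess_sup_inf lebesgue_integral_under.
From mathcomp Require Import ring lra.

(** After dividing by the normalization [dens], the operator averages [f]
    (extended by 0) against the probability kernel [kern h e x]. Thickness of
    [Omega] enters once, in [thick_dens_ge]: since [h] stays above a positive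
    level near the origin, [dens] is bounded below on [Omega] by a constant [d0]
    uniformly in small [e]. The kernel is symmetric, so averaging preserves
    integrals, and Jensen's inequality bounds the operator by [1 / d0] on every
    [L^p].

    Almost everywhere convergence is Lebesgue's differentiation theorem. Under
    the decay bound, [kern h e x] is dominated by a combination of normalized
    indicators of dyadic cubes centred at [x] with geometrically decreasing weights
    ([integral_poisson_le]), so the error at [x] is controlled by the means of
    [|f - f x|] over these cubes, and it tends to 0 at every Lebesgue point
    ([poisson_lebesgue_point]). Lebesgue points are obtained from a Vitali covering
    argument for cubes and the weak type (1,1) inequality. The only property of
    [L^p] used here is that its members are bounded up to an integrable excess
    ([L1Linf]).

    For convergence in norm, Jensen's inequality dominates [|P f - f| ^ p] by a
    multiple of the averages of [|f| ^ p] plus [|f| ^ p]. These majorants converge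
    almost everywhere by the previous part and have constant integral, so a variant
    of dominated convergence ([pratt_cvg0]) concludes.

    For continuity, [h] need not be continuous, but a radially decreasing integrable
    function is continuous almost everywhere ([radial_ae_continuous]): its
    oscillation at [z] is at most the difference of two dilates, whose integral is
    small. Dominated convergence then makes [h_e * f] continuous for every [f] that is
    bounded up to an integrable excess, and [P f] is the quotient of
    [h_e * f] by [h_e * 1_Omega].

    For smoothness, both factors of that quotient are treated by Fourier inversion.
    Gaussians are their own transforms ([integral_gauss_cos], by an ordinary
    differential equation along lines), so summing the inverse transform of [F] with
    a Gaussian cut-off amounts to convolving [F] with a Gaussian density
    ([gauss_mean]). This yields the inequality half of Plancherel's theorem
    ([plancherel_le]) and the inversion formula ([fourier_inversion]). The transform
    of [h_e * F] is the product of the transforms of [h_e] and [F]; the first is square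
    integrable with the weight [(1 + |w|^2) ^ r], the second is square
    integrable, so their product is integrable with the weight [(1 + |w|) ^ r], and an
    inverse transform of such a function can be differentiated [r] times under the
    integral sign ([trigint_Cr]). Complex exponentials are written as pairs of a
    cosine and a sine integral throughout. *)

Set Implicit Arguments.
Unset Strict Implicit.
Unset Printing Implicit Defensive.

Import Order.TTheory GRing.Theory Num.Theory.
Import numFieldNormedType.Exports.

Local Open Scope classical_set_scope.
Local Open Scope ring_scope.

(** * Lebesgue measure under dilations and translations *)

Section leb_affine.
Context {R : realType} {n : nat}.
Implicit Types (A : set 'rV[R]_n) (a : 'rV[R]_n) (s : R).

Definition affine s a (x : 'rV[R]_n) : 'rV[R]_n := s *: x + a.

Lemma affineK s a : s != 0 -> cancel (affine s a) (affine s^-1 (- (s^-1 *: a))).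
Proof.
by move=> s0 x; rewrite /affine scalerDr scalerA mulVf// scale1r addrK.
Qed.

Lemma affineKV s a : s != 0 -> cancel (affine s^-1 (- (s^-1 *: a))) (affine s a).
Proof.
move=> s0 x; rewrite /affine scalerBr !scalerA mulfV// !scale1r.
by rewrite subrK.
Qed.

(** Pulling a cover by boxes back along the map multiplies all its volumes by
    [s ^- n]; the reverse inequality comes from the inverse map. *)
Lemma leb_outer_affine_le s a A : 0 < s ->
  (leb_outer (affine s a @^-1` A) <= (s ^- n)%:E * leb_outer A)%E.
Proof.
move=> s0; rewrite -lee_pdivrMl ?invr_gt0 ?exprn_gt0// invrK.
apply: le_ereal_inf_tmp => _ [B AB <-].
pose g (C : option ('rV[R]_n * 'rV[R]_n)) := if C is Some (u, v)
  then Some (affine s^-1 (- (s^-1 *: a)) u, affine s^-1 (- (s^-1 *: a)) v)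
  else None.
have volg C : box_vol (g C) = s ^- n * box_vol C.
  case: C => [[u v]|] /=; last by rewrite mulr0.
  rewrite -[X in s ^- X]card_ord -exprVn -prodr_const -big_split /=.
  apply: eq_bigr => i _; rewrite maxr_pMr ?invr_ge0 ?(ltW s0)// mulr0.
  by rewrite /affine !mxE; congr Num.max; ring.
have -> : (\sum_(k <oo) (box_vol (B k))%:E = (s ^+ n)%:E * \sum_(k <oo) (box_vol (g (B k)))%:E)%E.
  rewrite -nneseriesZl; last by move=> i _; exact: box_vol_ge0.
  apply: eq_eseriesr => k _; rewrite volg -EFinM mulrA mulfV ?mul1r//.
  by rewrite expf_neq0// gt_eqF.
rewrite lee_wpmul2l// ?lee_fin ?exprn_ge0 ?(ltW s0)//.
apply: ereal_inf_lbound; exists (g \o B) => //= x /= /AB[k _ Bk].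
exists k => //=; case: (B k) Bk => [[u v]|] //= xuv i.
move: (xuv i) => /andP[ux xv]; rewrite /affine !mxE in ux xv *.
rewrite -!mulrBr ltr_pdivrMl// ler_pdivlMl//; apply/andP; split; lra.
Qed.

Lemma leb_outer_affine s a A : 0 < s ->
  leb_outer (affine s a @^-1` A) = ((s ^- n)%:E * leb_outer A)%E.
Proof.
move=> s0; apply/eqP; rewrite eq_le leb_outer_affine_le//=.
have si0 : 0 < s^-1 by rewrite invr_gt0.
rewrite -lee_pdivlMl ?invr_gt0 ?exprn_gt0// invrK.
have := leb_outer_affine_le (- (s^-1 *: a)) (affine s a @^-1` A) si0.
rewrite -comp_preimage (_ : affine s a \o _ = id) ?preimage_id; last first.
  by apply/funext => x /=; rewrite affineKV// gt_eqF.
by rewrite exprVn invrK.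
Qed.

Lemma leb_measurableE (A : set (lebRn R n)) :
  measurable A = (@leb_outer R n).-caratheodory A.
Proof. by []. Qed.

Lemma measurable_affine s a : 0 < s ->
  measurable_fun [set: lebRn R n] (affine s a : lebRn R n -> lebRn R n).
Proof.
move=> s0 _ A mA; rewrite setTI leb_measurableE => X.
rewrite leb_measurableE in mA.
have s0' : s != 0 by rewrite gt_eqF.
have [Y XE] : exists Y, X = affine s a @^-1` Y.
  exists (affine s^-1 (- (s^-1 *: a)) @^-1` X).
  by rewrite -comp_preimage; apply/seteqP; split => x /=; rewrite affineK.
transitivity (leb_outer (affine s a @^-1` (Y `&` A))
  + leb_outer (affine s a @^-1` (Y `&` ~` A)))%E; last by rewrite XE.
have YE : leb_outer Y = (leb_outer (Y `&` A) + leb_outer (Y `&` ~` A))%E.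
  exact: mA.
rewrite XE !leb_outer_affine// YE muleDr//.
by rewrite ge0_adde_def ?inE ?leb_outer_ge0.
Qed.

(** A half-space cuts each box of a cover into two boxes whose volumes add up,
    which is the Caratheodory condition. *)
Lemma measurable_halfspace (i : 'I_n) (c : R) :
  measurable [set x : lebRn R n | x 0 i <= c].
Proof.
rewrite leb_measurableE; apply: le_caratheodory_measurable => X.
set H := [set _ | _].
apply: le_ereal_inf_tmp => _ [B XB <-].
pose upd (b : 'rV[R]_n) (t : R) : 'rV[R]_n := \row_j (if j == i then t else b 0 j).
pose g1 (C : option ('rV[R]_n * 'rV[R]_n)) := if C is Some (u, v)
  then Some (u, upd v (Num.min c (v 0 i))) else None.
pose g2 (C : option ('rV[R]_n * 'rV[R]_n)) := if C is Some (u, v)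
  then Some (upd u (Num.max c (u 0 i)), v) else None.
have volg C : box_vol C = box_vol (g1 C) + box_vol (g2 C).
  case: C => [[u v]|] /=; last by rewrite addr0.
  rewrite (bigD1 i)//= [X in _ = X + _](bigD1 i)//= [X in _ = _ + X](bigD1 i)//=.
  have E1 : \prod_(j < n | j != i) Num.max 0 (upd v (Num.min c (v 0 i)) 0 j - u 0 j)
     = \prod_(j < n | j != i) Num.max 0 (v 0 j - u 0 j).
    by apply: eq_bigr => j ji; rewrite mxE (negbTE ji).
  have E2 : \prod_(j < n | j != i) Num.max 0 (v 0 j - upd u (Num.max c (u 0 i)) 0 j)
     = \prod_(j < n | j != i) Num.max 0 (v 0 j - u 0 j).
    by apply: eq_bigr => j ji; rewrite mxE (negbTE ji).
  rewrite E1 E2 -mulrDl; congr (_ * _); rewrite !mxE eqxx.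
  case: (leP c (v 0 i)) => ?; case: (leP c (u 0 i)) => ?;
  by do ! [case: leP => ? //]; lra.
have -> : (\sum_(k <oo) (box_vol (B k))%:E = \sum_(k <oo) (box_vol (g1 (B k)))%:E
    + \sum_(k <oo) (box_vol (g2 (B k)))%:E)%E.
  rewrite -nneseriesD; [|by move=> k _ _; exact: box_vol_ge0..].
  by apply: eq_eseriesr => k _; rewrite volg EFinD.
apply: leeD; apply: ereal_inf_lbound.
- exists (g1 \o B) => //= x [/XB[k _ Bk] Hx]; exists k => //=.
  case: (B k) Bk => [[u v]|] //= xuv j; rewrite mxE.
  case: eqP => [->|_]; last exact: xuv.
  by have := xuv i; rewrite le_min => /andP[-> ->]; rewrite andbT/=.
- exists (g2 \o B) => //= x [/XB[k _ Bk] /negP Hx]; exists k => //=.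
  case: (B k) Bk => [[u v]|] //= xuv j; rewrite mxE.
  case: eqP => [->|_]; last exact: xuv.
  by have := xuv i; rewrite gt_max => /andP[-> ->]; rewrite -ltNge in Hx; rewrite Hx.
Qed.

Lemma measurable_coord (i : 'I_n) :
  measurable_fun [set: lebRn R n] (fun x : lebRn R n => x 0 i).
Proof.
move=> mD; apply: (measurability _ (measurable_realfun.RGenOInfty.measurableE R)) => // _ [_ [c ->] <-].
rewrite setTI (_ : _ @^-1` _ = ~` [set x : lebRn R n | x 0 i <= c]).
  exact/measurableC/measurable_halfspace.
apply/seteqP; split=> x /=; rewrite in_itv/= andbT.
  by move=> cx; apply/negP; rewrite -ltNge.
by move/negP; rewrite -ltNge.
Qed.

End leb_affine.

(** * Cubes *)

Section leb_cubes.
Context {R : realType} {n : nat}.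
Implicit Types (A : set 'rV[R]_n) (a : 'rV[R]_n) (s : R).

(** Sup-norm balls; they need no case distinction on the dimension, unlike
    [ball], whose radius condition is empty in dimension 0. *)
Definition cube (x : 'rV[R]_n) (r : R) : set 'rV[R]_n :=
  [set y | forall i, `|y 0 i - x 0 i| < r].

Lemma measurable_cube x r : measurable (cube x r : set (lebRn R n)).
Proof.
rewrite (_ : cube x r = \bigcap_(i in [set: 'I_n])
    ((fun y : lebRn R n => y 0 i) @^-1` `]x 0 i - r, x 0 i + r[)); last first.
  apply/seteqP; split => y /= h.
    by move=> i _ /=; rewrite in_itv/= -ltr_distl.
  by move=> i; have := h i I; rewrite /= in_itv/= -ltr_distl.
apply: fin_bigcap_measurable => [|i _]; first exact: finite_finset.
rewrite -[X in measurable X]setTI; exact: measurable_coord.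
Qed.

Lemma cube_ball x r : 0 < r -> cube x r = ball x r.
Proof.
move=> r0; apply/seteqP; split => y; rewrite /cube /ball/= /mx_ball /=.
  by move=> h; split=> // i j; rewrite [i]ord1 /ball/= /ball_/= distrC.
by move=> [_ h] i; have := h 0 i; rewrite /ball/= /ball_/= distrC.
Qed.

Lemma cubeS x r s : r <= s -> cube x r `<=` cube x s.
Proof. by move=> rs y /= h i; rewrite (lt_le_trans (h i)). Qed.

Lemma cube_affine s a x r : 0 < s ->
  affine s a @^-1` cube (affine s a x) (s * r) = cube x r.
Proof.
move=> s0; have E y i : `|affine s a y 0 i - affine s a x 0 i| = s * `|y 0 i - x 0 i|.
  by rewrite !mxE -[s in RHS]gtr0_norm// -normrM; congr `|_|; ring.
by apply/seteqP; split => y h i; move: (h i); rewrite E ltr_pM2l.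
Qed.

Lemma leb_cube x r : 0 < r -> leb R n (cube x r) = ((r ^+ n)%:E * leb R n (cube 0 1))%E.
Proof.
move=> r0; have ri0 : 0 < r^-1 by rewrite invr_gt0.
have := @leb_outer_affine _ n r^-1 (- (r^-1 *: x)) (cube 0 1) ri0.
rewrite exprVn invrK => <-; congr leb_outer.
rewrite -(cube_affine (- (r^-1 *: x)) x r ri0).
by rewrite mulVf ?gt_eqF// /affine subrr.
Qed.

Lemma leb_cube_le x r : (0 <= r) -> (leb R n (cube x r) <= ((2 * r) ^+ n)%:E)%E.
Proof.
move=> r0; apply: ereal_inf_lbound.
pose B : option ('rV[R]_n * 'rV[R]_n) := Some (x - const_mx r, x + const_mx r).
exists (fun k => if k == 0%N then B else None).
  move=> y /= h; exists 0%N => //= i; rewrite !mxE.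
  by have := h i; rewrite ltr_distl => /andP[-> /ltW ->].
rewrite (@nneseriesD1 _ _ 0%N)//=; last by move=> k _; exact: box_vol_ge0.
rewrite eseries0 ?adde0; last by move=> [|i] _ //= ?.
congr EFin; rewrite -[in RHS](card_ord n) -prodr_const; apply: eq_bigr => i _.
by rewrite !mxE; rewrite max_r; nra.
Qed.

End leb_cubes.

(** * Open sets and sigma-finiteness *)

Section leb_borel.
Context {R : realType} {n : nat}.
Implicit Types (A U : set 'rV[R]_n) (x : 'rV[R]_n) (r s : R).

Definition ratcube (c : 'rV[rat]_n * rat) : set 'rV[R]_n :=
  cube (map_mx ratr c.1) (ratr c.2).

(** Rational cubes are countable, which turns uncountable families of cubes into
    sequences. *)
Lemma ratcube_approx x r d : 0 < d -> exists2 c : 'rV[rat]_n * rat,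
  cube x r `<=` ratcube c & ratcube c `<=` cube x (r + d) /\ r < ratr c.2 < r + d.
Proof.
move=> d0; have /rat_in_itvoo[s] : r + d / 3 < r + d / 3 * 2 by lra.
rewrite in_itv/= => /andP[rs sr].
have /choice[q qx] : forall i : 'I_n, exists q : rat, `|ratr q - x 0 i| < d / 3.
  move=> i; have /rat_in_itvoo[q] : x 0 i - d / 3 < x 0 i + d / 3 by lra.
  by rewrite in_itv/= => qx; exists q; rewrite ltr_distl.
exists (\row_i q i, s) => /=; [|split]; last by apply/andP; split; lra.
- move=> y /= yx i; rewrite !mxE.
  rewrite (le_lt_trans (ler_distD (x 0 i) _ _))//.
  by rewrite (distrC (x 0 i)); have := yx i; have := qx i; lra.
- move=> y yq i; have := yq i; rewrite /= !mxE => {}yq.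
  rewrite (le_lt_trans (ler_distD (ratr (q i)) _ _))//.
  by have := qx i; lra.
Qed.

Lemma open_cube U x : open U -> U x -> exists2 r, 0 < r & cube x r `<=` U.
Proof.
rewrite openE => /[apply]; rewrite /interior/= -nbhs_ballE => -[r /= r0 xU].
by exists r => //; rewrite cube_ball.
Qed.

Lemma open_cube_cover U : open U ->
  U = \bigcup_(c in [set c | ratcube c `<=` U]) ratcube c.
Proof.
move=> oU; apply/seteqP; split => x; last by case=> c /= + xc; apply.
move=> Ux; have [r r0 xrU] := open_cube oU Ux.
have [|c xc [cx _]] := @ratcube_approx x (r / 2) (r / 2); first lra.
exists c; first by apply: subset_trans xrU; apply: subset_trans cx _; apply: cubeS; lra.
by apply: xc => i; rewrite subrr normr0; lra.
Qed.

Lemma open_leb_measurable U : open U -> measurable (U : set (lebRn R n)).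
Proof.
move=> /open_cube_cover ->; rewrite bigcup_mkcond.
apply: countable_bigcupT_measurable => [|c]; first exact: countableP.
by case: ifP => _; [exact: measurable_cube|exact: measurable0].
Qed.

Lemma continuous_leb_measurable (f : 'rV[R]_n -> R) : continuous f ->
  measurable_fun setT (f : lebRn R n -> R).
Proof.
move=> /continuousP cf mD; apply: (measurability _ (measurable_realfun.RGenOpens.measurableE R)) => //.
move=> _ [_ [a [b ->] <-]]; rewrite setTI; apply: open_leb_measurable.
by apply: cf; exact: interval_open.
Qed.

Lemma cube0_bigcup : \bigcup_k cube (0 : 'rV[R]_n) k%:R = setT.
Proof.
apply/seteqP; split=> // x _.
have [k xk] : exists k, forall i : 'I_n, `|x 0 i| < k%:R.
  exists (\max_(i < n) (Num.truncn `|x 0%R i|%R).+1)%N => i.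
  have := truncnS_gt `|x 0 i|; move=> /lt_le_trans; apply.
  by rewrite ler_nat (bigop.bigmax_sup i).
by exists k => // i; rewrite mxE subr0.
Qed.

Lemma leb_cube_lty x r : (leb R n (cube x r) < +oo)%E.
Proof.
have [r0|r0] := leP 0 r; first by rewrite (le_lt_trans (leb_cube_le _ r0))// ltry.
rewrite (le_lt_trans (le_leb_outer (cubeS (ltW r0))))//.
by rewrite (le_lt_trans (leb_cube_le _ _))// ltry.
Qed.

Lemma leb_sigma_finite : sigma_finite setT (leb R n).
Proof.
exists (fun k => cube 0 k%:R); first by rewrite cube0_bigcup.
by move=> k; split; [exact: measurable_cube|exact: leb_cube_lty].
Qed.

HB.instance Definition _ := @Measure_isSigmaFinite.Build _ (lebRn R n) R (leb R n)
  leb_sigma_finite.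

End leb_borel.

(** * Change of variables and outer regularity *)

Section leb_integral.
Context {R : realType} {n : nat}.
Implicit Types (A U : set 'rV[R]_n) (x a : 'rV[R]_n) (r s : R).
Local Notation mu := (leb R n).

Lemma ge0_integral_affine s a (F : lebRn R n -> \bar R) : 0 < s ->
  measurable_fun setT F -> (forall x, 0 <= F x)%E ->
  (\int[mu]_x F (affine s a x) = (s ^- n)%:E * \int[mu]_x F x)%E.
Proof.
move=> s0 mF F0; have sn0 : 0 <= s ^- n by rewrite invr_ge0 exprn_ge0 ?(ltW s0).
have maff := measurable_affine a s0.
transitivity (\int[pushforward mu (affine s a : lebRn R n -> lebRn R n)]_x F x)%E.
  by rewrite ge0_integral_pushforward//.
rewrite -[s ^- n]/((NngNum sn0)%:num) -ge0_integral_mscale//.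
apply: eq_measure_integral => A mA _.
exact: leb_outer_affine.
Qed.

Lemma integrable_affine s a (F : lebRn R n -> \bar R) : 0 < s ->
  mu.-integrable setT F -> mu.-integrable setT (fun x => F (affine s a x)).
Proof.
move=> s0 /integrableP[mF Foo]; apply/integrableP; split.
  exact: (measurableT_comp mF (measurable_affine a s0)).
rewrite (ge0_integral_affine a s0 (F := fun x => `|F x|%E))//; last exact: measurableT_comp.
by rewrite lte_mul_pinfty// lee_fin invr_ge0 exprn_ge0 ?(ltW s0).
Qed.

Lemma integral_affine s a (F : lebRn R n -> \bar R) : 0 < s ->
  mu.-integrable setT F ->
  (\int[mu]_x F (affine s a x) = (s ^- n)%:E * \int[mu]_x F x)%E.
Proof.
move=> s0 iF; have /integrableP[mF Foo] := iF.
transitivity (\int[mu]_x F^\+ (affine s a x) - \int[mu]_x F^\- (affine s a x))%E.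
  by rewrite integralE; congr (_ - _)%E; apply: eq_integral => x _; rewrite ?funeposE ?funenegE.
rewrite [in RHS]integralE.
rewrite (ge0_integral_affine a s0 (F := (F^\+)%E))//; last exact: measurable_funepos.
rewrite (ge0_integral_affine a s0 (F := (F^\-)%E))//; last exact: measurable_funeneg.
rewrite [in RHS]muleBr//.
by rewrite fin_num_adde_defl// fin_numN integrable_neg_fin_num.
Qed.

Lemma Rintegral_affine s a (f : lebRn R n -> R) : 0 < s ->
  mu.-integrable setT (EFin \o f) ->
  \int[mu]_x f (affine s a x) = s ^- n * \int[mu]_x f x.
Proof.
move=> s0 fi; rewrite /Rintegral (integral_affine a s0 fi) fineM//.
exact: integrable_fin_num.
Qed.

(** The volume of a box is continuous in its upper corner. *)
Lemma open_box_enlarge (B : option ('rV[R]_n * 'rV[R]_n)) d : 0 < d ->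
  exists U, [/\ open U, box B `<=` U & (leb_outer U <= (box_vol B + d)%:E)%E].
Proof.
move=> d0; case: B => [[u v]|] /=; last first.
  exists set0; split; [exact: open0|by []|].
  by rewrite leb_outer0 lee_fin add0r ltW.
pose w (t : R) := \prod_(i < n) Num.max 0 (v 0 i + t - u 0 i).
have cw : w t @[t --> 0] --> w 0.
  apply: (cvg_big (@mul_continuous R)) => i _.
  apply: (@continuous_max _ _ (cst 0) (fun t => v 0 i + t - u 0 i)); first exact: cst_continuous.
  apply: continuousB; last exact: cst_continuous.
  by apply: continuousD => //; exact: cst_continuous.
have w0 : w 0 = \prod_(i < n) Num.max 0 (v 0 i - u 0 i).
  by apply: eq_bigr => i _; rewrite addr0.
have [t t0 wt] : exists2 t, 0 < t & w t <= w 0 + d.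
  move/cvgrPdist_le : cw => /(_ _ d0)[e /= e0 ew].
  exists (e / 2); first lra.
  have : `|w 0 - w (e / 2)| <= d by apply: ew; rewrite /= sub0r normrN gtr0_norm; lra.
  by rewrite ler_norml => /andP[? _]; lra.
exists [set x : 'rV[R]_n | forall i, u 0 i < x 0 i < v 0 i + t]; split.
- rewrite openE => x /= xuv; rewrite /interior/=.
  apply: (@filter_forall _ _ (fun i (y : 'rV[R]_n) => u 0 i < y 0 i < v 0 i + t) _ (nbhs_filter x)) => i.
  have : nbhs (x 0 i) `]u 0 i, v 0 i + t[%classic.
    by apply: open_nbhs_nbhs; split; [exact: interval_open|rewrite /= in_itv/= xuv].
  by move/(@coord_continuous R 1 n 0 i x); apply: (@filterS _ _ (nbhs_filter x)) => y /=; rewrite in_itv.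
- by move=> x xuv i; have /andP[-> xv] := xuv i; rewrite /= (le_lt_trans xv)// ltrDl.
- rewrite -w0; apply: le_trans (_ : ((w t)%:E <= _)%E); last by rewrite lee_fin.
  apply: ereal_inf_lbound.
  exists (fun k => if k == 0%N then Some (u, v + const_mx t) else None).
    move=> y /= h; exists 0%N => //= i; rewrite !mxE.
    by have /andP[-> /ltW ->] := h i.
  rewrite (@nneseriesD1 _ _ 0%N)//=; last by move=> k _; exact: box_vol_ge0.
  rewrite eseries0 ?adde0; last by move=> [|i] _ //= ?.
  by congr EFin; apply: eq_bigr => i _; rewrite !mxE.
Qed.

Lemma leb_outer_regular A d : 0 < d -> (leb_outer A < +oo)%E ->
  exists U, [/\ open U, A `<=` U & (leb_outer U <= leb_outer A + d%:E)%E].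
Proof.
move=> d0 Aoo; have d20 : 0 < d / 2 by lra.
have Afin : leb_outer A \is a fin_num by rewrite ge0_fin_numE ?leb_outer_ge0.
have [_ [B AB <-] BA] := lb_ereal_inf_adherent d20 Afin.
have H k : 0 < d / 2 / (2 ^ k.+1)%:R by rewrite divr_gt0// ltr0n expn_gt0.
have /choice[U UB] := fun k => open_box_enlarge (B k) (H k).
exists (\bigcup_k U k); split.
- by apply: bigcup_open => k _; have [] := UB k.
- by move=> x /AB[k _ Bk]; exists k => //; have [_ + _] := UB k; apply.
apply: le_trans (leb_outer_sigma_subadditive U) _.
have -> : (leb_outer A + d%:E = (leb_outer A + (d / 2)%:E) + (d / 2)%:E)%E.
  by rewrite -addeA -EFinD -splitr.
apply: le_trans (leeD2r _ (ltW BA)).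
apply: le_trans (epsilon_trick _ _ (ltW d20)); last by move=> k; exact: box_vol_ge0.
apply: lee_nneseries => k *; first exact: leb_outer_ge0.
by have [_ _] := UB k; rewrite EFinD.
Qed.

End leb_integral.

(** * A covering lemma and the weak type inequality *)

Section vitali.
Context {R : realType} {n : nat}.
Local Notation mu := (leb R n).
Implicit Types (c d : 'rV[R]_n * R) (g : lebRn R n -> \bar R).

(** Greedy selection by decreasing radius: a discarded cube meets a selected one
    that is at least as large, hence lies in its triple. *)
Lemma cube_vitali_cover (s : seq ('rV[R]_n * R)) : exists D : seq ('rV[R]_n * R),
  [/\ {subset D <= s},
      pairwise (fun c d => `[< cube c.1 c.2 `&` cube d.1 d.2 = set0 >]) D &
      forall c, c \in s ->
        exists2 d, d \in D & cube c.1 c.2 `<=` cube d.1 (3 * d.2)].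
Proof.
pose ge2 c d := d.2 <= c.2.
have ge2_total : total ge2 by move=> c d; exact: le_total.
have ge2_trans : transitive ge2 by move=> c d e /[swap]; exact: le_trans.
suff H k (t : seq ('rV[R]_n * R)) : (size t <= k)%N -> sorted ge2 t ->
    exists D : seq ('rV[R]_n * R), [/\ {subset D <= t},
      pairwise (fun c d => `[< cube c.1 c.2 `&` cube d.1 d.2 = set0 >]) D &
      forall c, c \in t ->
        exists2 d, d \in D & cube c.1 c.2 `<=` cube d.1 (3 * d.2)].
  have [D [Ds pD sD]] := H _ (sort ge2 s) (leqnn _) (sort_sorted ge2_total s).
  exists D; split => //; first by move=> c /Ds; rewrite mem_sort.
  by move=> c cs; apply: sD; rewrite mem_sort.
elim: k t => [|k IH] [|b t]; try by exists [::].
rewrite /= ltnS => tk bt.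
pose t' := [seq d <- t | `[< cube b.1 b.2 `&` cube d.1 d.2 = set0 >]].
have [|D [Dt' pD sD]] := IH t' _ (sorted_filter ge2_trans _ (path_sorted bt)).
  by rewrite size_filter (leq_trans (count_size _ _)).
exists (b :: D); split.
- move=> c; rewrite !inE => /orP[->//|/Dt']; rewrite mem_filter => /andP[_ ->].
  by rewrite orbT.
- by rewrite /= pD andbT; apply/allP => c /Dt'; rewrite mem_filter => /andP[].
move=> c; rewrite inE => /orP[/eqP ->|ct].
  exists b; first by rewrite mem_head.
  move=> y yb i; have := yb i; have := normr_ge0 (y 0 i - b.1 0 i); lra.
have [bc|bc] := pselect (cube b.1 b.2 `&` cube c.1 c.2 = set0).
  have [|d dD cd] := sD c; first by rewrite mem_filter ct andbT; apply/asboolP.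
  by exists d => //; rewrite inE dD orbT.
exists b; first by rewrite mem_head.
have [z [zb zc]] : (cube b.1 b.2 `&` cube c.1 c.2) !=set0.
  by apply/set0P; apply/eqP.
have cb : c.2 <= b.2 by have /allP := order_path_min ge2_trans bt; exact.
move=> y yc i; have := yc i; have := zb i; have := zc i.
have -> : y 0 i - b.1 0 i = (y 0 i - c.1 0 i) - (z 0 i - c.1 0 i) + (z 0 i - b.1 0 i).
  by ring.
move=> h1 h2 h3; rewrite (le_lt_trans (ler_normD _ _))//.
by have := ler_normB (y 0 i - c.1 0 i) (z 0 i - c.1 0 i); lra.
Qed.

Lemma integral_disjoint_cubes_le (D : seq ('rV[R]_n * R)) g :
  measurable_fun setT g -> (forall x, 0 <= g x)%E ->
  pairwise (fun c d => `[< cube c.1 c.2 `&` cube d.1 d.2 = set0 >]) D ->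
  (\sum_(d <- D) \int[mu]_(y in cube d.1 d.2) g y <= \int[mu]_y g y)%E.
Proof.
move=> mg g0 pD.
suff [A [mA -> _]] : exists A : set (lebRn R n), [/\ measurable A,
    (\sum_(d <- D) \int[mu]_(y in cube d.1 d.2) g y = \int[mu]_(y in A) g y)%E &
    A `<=` [set y | exists2 d, d \in D & cube d.1 d.2 y]].
  by apply: ge0_subset_integral.
elim: D pD => [_|d D IH /= /andP[/allP dD /IH[A [mA DA AD]]]].
  by exists set0; split => //; rewrite big_nil integral_set0.
exists (cube d.1 d.2 `|` A); split.
- by apply: measurableU => //; exact: measurable_cube.
- rewrite big_cons DA ge0_integral_setU//=.
  + exact: measurable_cube.
  + exact: measurable_funS mg.
  + apply/disj_setPS => y [yd /AD[e eD ye]].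
    by have /asboolP <- := dD _ eD.
- move=> y [yd|/AD[e eD ye]]; first by exists d; rewrite ?mem_head.
  by exists e => //; rewrite inE eD orbT.
Qed.

(** The constant is [2 ^ n] for the volume of a cube in terms of its radius times
    [3 ^ n] for the tripling in the covering lemma. *)
Lemma finite_cubes_weak_type (s : seq ('rV[R]_n * R)) g (t : R) : 0 < t ->
  measurable_fun setT g -> (forall x, 0 <= g x)%E ->
  (forall c, c \in s -> 0 < c.2 /\
     ((t * c.2 ^+ n)%:E <= \int[mu]_(y in cube c.1 c.2) g y)%E) ->
  (leb_outer [set y : 'rV[R]_n | exists2 c, c \in s & cube c.1 c.2 y]
     <= (6 ^+ n / t)%:E * \int[mu]_y g y)%E.
Proof.
move=> t0 mg g0 sg; have [D [Ds pD sD]] := cube_vitali_cover s.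
have := integral_disjoint_cubes_le mg g0 pD.
have c0 : (0 <= (6 ^+ n / t)%:E)%E by rewrite lee_fin divr_ge0 ?exprn_ge0// ltW.
move=> /(lee_wpmul2l c0); apply: le_trans.
apply: (@le_trans _ _ (\sum_(d <- D) leb_outer (cube d.1 (3 * d.2)))%E).
  pose U := fix U (l : seq ('rV[R]_n * R)) := if l is d :: l' then cube d.1 (3 * d.2) `|` U l' else set0.
  have UE l y : U l y <-> exists2 d, d \in l & cube d.1 (3 * d.2) y.
    elim: l => [|d l IHl] /=; first by split => // -[].
    split => [[yd|/IHl[e el ye]]|[e]].
    - by exists d; rewrite ?mem_head.
    - by exists e => //; rewrite inE el orbT.
    - by rewrite inE => /orP[/eqP ->|el ye]; [left|right; apply/IHl; exists e].
  apply: (@le_trans _ _ (leb_outer (U D))).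
    apply: le_leb_outer => y [c /sD[d dD cd] yc]; apply/UE; exists d => //.
    exact: cd.
  elim: (D) => [|d l IHl] /=; first by rewrite big_nil leb_outer0.
  by rewrite big_cons (le_trans (outer_measureU2 _ _ _))// leeD2l.
rewrite ge0_sume_distrr; last by move=> d _; apply: integral_ge0.
rewrite big_seq [in leRHS]big_seq; apply: lee_sum => d /Ds /sg[d0 dg].
apply: le_trans (leb_cube_le _ _) _; first by rewrite mulr_ge0// ltW.
apply: le_trans (lee_wpmul2l c0 dg); rewrite lee_fin.
rewrite (_ : 2 * _ = 6 * d.2); last by ring.
by rewrite exprMn mulrA divfK ?gt_eqF.
Qed.

End vitali.

Section lebesgue_points.
Context {R : realType} {n : nat}.
Local Notation mu := (leb R n).
Implicit Types (g : lebRn R n -> \bar R) (x : 'rV[R]_n).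

(** The Hardy-Littlewood weak type (1,1) inequality. Every cube of large average
    can be enlarged to a rational one, and an increasing union of finite
    families reduces to [finite_cubes_weak_type]. *)
Lemma weak_type g (t : R) : 0 < t ->
  measurable_fun setT g -> (forall x, 0 <= g x)%E ->
  (leb_outer [set x : 'rV[R]_n | exists2 r, (0 < r)%R &
       (t * r ^+ n)%:E < \int[mu]_(y in cube x r) g y]
     <= (6 ^+ n / t)%:E * \int[mu]_y g y)%E.
Proof.
move=> t0 mg g0; set E := mkset _.
pose good (c : 'rV[rat]_n * rat) := `[< (0 < ratr c.2 :> R)%R /\
  ((t * ratr c.2 ^+ n)%:E <= \int[mu]_(y in ratcube c) g y)%E >].
pose S k := [seq c <- pmap unpickle (iota 0 k) | good c].
pose F k : set (lebRn R n) := [set y | exists2 c, c \in S k & ratcube c y].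
have SE k : F k = [set y | exists2 c, c \in [seq (map_mx ratr c.1, ratr c.2) | c <- S k] &
    cube c.1 c.2 y].
  apply/seteqP; split => y [c cS yc].
    by exists (map_mx ratr c.1, ratr c.2) => //; apply: map_f.
  by case/mapP : cS => d dS cd; exists d => //; rewrite cd in yc.
have Fle k : (leb_outer (F k) <= (6 ^+ n / t)%:E * \int[mu]_y g y)%E.
  rewrite SE; apply: finite_cubes_weak_type => // c /mapP[d].
  by rewrite mem_filter => /andP[/asboolP[d0 dg] _] ->.
have mF k : measurable (F k).
  rewrite /F; elim: (S k) => [|c l IH].
    by rewrite (_ : mkset _ = set0)//; apply/seteqP; split => // y [].
  rewrite (_ : mkset _ = ratcube c `|` [set y | exists2 c, c \in l & ratcube c y]).
    by apply: measurableU => //; exact: measurable_cube.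
  apply/seteqP; split => y /=.
    by move=> [d]; rewrite inE => /orP[/eqP ->|dl yd]; [left|right; exists d].
  by move=> [yc|[d dl yd]]; [exists c; rewrite ?mem_head|exists d => //; rewrite inE dl orbT].
have ndF : nondecreasing_seq F.
  move=> k l kl; apply/subsetPset => y [c cS yc]; exists c => //.
  move: cS; rewrite !mem_filter => /andP[-> /=]; rewrite !mem_pmap => /mapP[i ik ->].
  apply/mapP; exists i => //; move: ik; rewrite !mem_iota/= !add0n => /leq_trans; exact.
have EF : E `<=` \bigcup_k F k.
  move=> x [r r0 xr].
  have [d d0 dr] : exists2 d, 0 < d & ((t * (r + d) ^+ n)%:E <= \int[mu]_(y in cube x r) g y)%E.
    move: xr; case: (\int[mu]_(y in cube x r) g y)%E => [I||//]; last first.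
      by exists 1; rewrite // leey.
    rewrite lte_fin => xr.
    have : (fun d => t * (r + d) ^+ n) d @[d --> 0] --> t * (r + 0) ^+ n.
      apply: cvgM; first exact: cvg_cst.
      apply: (@continuous_comp _ _ _ (fun d => r + d) (fun y : R => y ^+ n)); last exact: exprn_continuous.
      by apply: cvgD; [exact: cvg_cst|exact: cvg_id].
    rewrite addr0 => /cvgrPdist_lt/(_ (I - t * r ^+ n)).
    rewrite subr_gt0 => /(_ xr)[e /= e0 he]; exists (e / 2); first lra.
    have : `|t * r ^+ n - t * (r + e / 2) ^+ n| < I - t * r ^+ n.
      by apply: he; rewrite /= sub0r normrN gtr0_norm; lra.
    by rewrite lee_fin ltr_norml => /andP[? _]; lra.
  have [c xc [_ /andP[rc cr]]] := ratcube_approx x r d0.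
  exists (pickle c).+1 => //; exists c; last first.
    by apply: xc => i; rewrite subrr normr0.
  rewrite mem_filter mem_pmap; apply/andP; split; last first.
    by apply/mapP; exists (pickle c); rewrite ?mem_iota//= pickleK.
  apply/asboolP; split; first exact: lt_trans rc.
  apply: (@le_trans _ _ (\int[mu]_(y in cube x r) g y)%E); last first.
    by apply: ge0_subset_integral => //; [exact: measurable_cube..|exact: measurable_funS mg].
  by apply: le_trans dr; rewrite lee_fin ler_pM2l// lerXn2r ?nnegrE; lra.
apply: le_trans (le_leb_outer EF) _.
have cF := @nondecreasing_cvg_mu _ _ _ mu F mF (bigcupT_measurable _ mF) ndF.
rewrite -[leLHS](cvg_lim _ cF)//; apply: lime_le; last exact: nearW.
by apply/cvg_ex; eexists; exact: cF.
Qed.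

End lebesgue_points.

(** * Lebesgue points *)

Section lebesgue_points.
Context {R : realType} {n : nat}.
Local Notation mu := (leb R n).
Implicit Types (g : lebRn R n -> \bar R) (x : 'rV[R]_n).

(** Outer regularity makes [U `\` E] small, and integrals are absolutely
    continuous with respect to the measure of the domain. *)
Lemma open_superset_small_integral (g : lebRn R n -> R) (E : set (lebRn R n)) (d : R) :
  0 < d -> measurable E -> (mu E < +oo)%E -> mu.-integrable setT (EFin \o g) ->
  (forall x, 0 <= g x) -> (forall x, E x -> g x = 0) ->
  exists U : set 'rV[R]_n,
    [/\ open U, E `<=` U & (\int[mu]_(y in U) (g y)%:E < d%:E)%E].
Proof.
move=> d0 mE Eoo ig g0 gE; have [s [s0 sg]] := integral_normr_continuous ig d0.
have [U [oU EU UE]] := leb_outer_regular (divr_gt0 s0 (ltr0Sn _ 1)) Eoo.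
exists U; split => //; have mU : measurable (U : set (lebRn R n)) by exact: open_leb_measurable.
have mUE : measurable (U `\` E : set (lebRn R n)) by exact: measurableD.
have UEs : (mu (U `\` E) < s%:E)%E.
  rewrite measureD//; last by rewrite (le_lt_trans UE)// lte_add_pinfty// ltry.
  rewrite setIC setIidl// lteBlDl; last by rewrite ge0_fin_numE// measure_ge0.
  apply: (le_lt_trans UE); rewrite lteD2lE ?ge0_fin_numE ?leb_outer_ge0//.
  by rewrite lte_fin; lra.
have mg := measurable_int mu ig.
have UEE : (\int[mu]_(y in U) (g y)%:E = \int[mu]_(y in U `\` E) (g y)%:E)%E.
  rewrite -{1}(setDUK EU) ge0_integral_setU//=; last 3 first.
    exact: measurable_funS mg.
    by move=> x _; rewrite lee_fin.
    by apply/disj_setPS => x [Ex [_]].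
  by rewrite integral0_eq ?add0e// => x Ex; rewrite gE.
apply: (@le_lt_trans _ _ (\int[mu]_(y in U `\` E) (g y)%:E)%E); first by rewrite -UEE.
have {}ig : mu.-integrable (U `\` E) (EFin \o g) by apply: integrableS ig.
rewrite -(fineK (integrable_fin_num mUE ig)) lte_fin (le_lt_trans _ (sg _ mUE UEs))//.
rewrite le_eqVlt; apply/orP; left; apply/eqP; congr fine.
by apply: eq_integral => x _; rewrite ger0_norm.
Qed.

(** Restricting [g] to an open superset of [E] does not change small averages at
    points of [E], and makes the bound of [weak_type] arbitrarily small. *)
Lemma null_density (g : lebRn R n -> R) (E : set (lebRn R n)) (t : R) : 0 < t ->
  measurable E -> (mu E < +oo)%E -> mu.-integrable setT (EFin \o g) ->
  (forall x, 0 <= g x) -> (forall x, E x -> g x = 0) ->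
  leb_outer [set x : 'rV[R]_n | E x /\ forall s, (0 < s)%R ->
    exists r, [/\ (0 < r)%R, (r < s)%R & ((t * r ^+ n)%:E < \int[mu]_(y in cube x r) (g y)%:E)%E]] = 0%E.
Proof.
move=> t0 mE Eoo ig g0 gE; set N := mkset _.
have mg := measurable_int mu ig.
apply/eqP; rewrite eq_le leb_outer_ge0 andbT; apply/lee_addgt0Pr => e e0; rewrite add0e.
have c0 : 0 < 6 ^+ n / t by rewrite divr_gt0// exprn_gt0.
have ec0 : 0 < e / (6 ^+ n / t) by rewrite divr_gt0.
have [U [oU EU Ud]] := open_superset_small_integral ec0 mE Eoo ig g0 gE.
have mU : measurable (U : set (lebRn R n)) by exact: open_leb_measurable.
apply: (@le_trans _ _ ((6 ^+ n / t)%:E * \int[mu]_y ((EFin \o g) \_ U) y)%E); last first.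
  rewrite -integral_mkcond -lee_pdivlMl// (le_trans (ltW Ud))// -EFinM lee_fin mulrC//.
apply: le_trans (weak_type t0 _ _).
- apply: le_leb_outer => x [Ex Nx]; have [s s0 xsU] := open_cube oU (EU _ Ex).
  have [r [r0 rs tr]] := Nx _ s0; exists r => //.
  rewrite -integral_mkcondr (_ : cube x r `&` U = cube x r)//.
  by apply/setIidl; apply: subset_trans xsU; apply: cubeS; exact: ltW.
- by apply/(measurable_restrictT _ mU); exact: measurable_funS mg.
- by move=> x; rewrite /restrict; case: ifP => //=; rewrite lee_fin.
Qed.

End lebesgue_points.

Section lebesgue_points.
Context {R : realType} {n : nat}.
Local Notation mu := (leb R n).
Implicit Types (x : 'rV[R]_n).

Lemma leb_null_measurable (A : set (lebRn R n)) : leb_outer A = 0%E -> measurable A.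
Proof.
move=> A0; rewrite leb_measurableE; apply: le_caratheodory_measurable => X.
rewrite -[leRHS]add0e; apply: leeD; last exact: le_leb_outer.
by rewrite -A0; exact: le_leb_outer.
Qed.

Lemma leb_null_negligible (A : set (lebRn R n)) : leb_outer A = 0%E -> mu.-negligible A.
Proof. by move=> A0; exists A; split => //; exact: leb_null_measurable. Qed.

Lemma leb_measurable_restr (f : lebRn R n -> R) (A : set (lebRn R n)) :
  measurable A -> measurable_fun setT f -> measurable_fun setT (f \_ A).
Proof.
by move=> mA mf; apply/(measurable_restrictT _ mA); exact: measurable_funS mf.
Qed.

Lemma integrable_cst_cube x r (c : R) : mu.-integrable (cube x r) (EFin \o cst c).
Proof.
apply/integrableP; split; first exact/measurable_EFinP/measurable_cst.
rewrite (eq_integral (cst `|c|%:E))// integral_cst; last exact: measurable_cube.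
by rewrite lte_mul_pinfty ?lee_fin ?leb_cube_lty.
Qed.

(** Lebesgue's theorem is reduced to [null_density]. For a mesh [1 / (m + 1)], the
    point [x] lies in a level set of [f] of that width; on this set
    [f y - f x] is small, and off it [|f y - f x|] is at most
    [|f y| + c], a function that vanishes on the level set and hence has
    vanishing averages at almost all of its points. The exceptional sets
    are indexed by integers, so their union is null. *)
Lemma lebesgue_points (f : lebRn R n -> R) : measurable_fun setT f ->
  (forall k : nat, mu.-integrable (cube 0 k%:R) (EFin \o f)) ->
  {ae mu, forall x, forall t, (0 < t)%R -> exists2 s, (0 < s)%R & forall r, (0 < r < s)%R ->
     (\int[mu]_(y in cube x r) `|f y - f x|%:E <= (t * r ^+ n)%:E)%E}.
Proof.
move=> mf fi.
pose m1 (m : nat) : R := m.+1%:R^-1.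
have m10 m : 0 < m1 m by rewrite invr_gt0.
pose E' (m : nat) (q : int) : set (lebRn R n) :=
  f @^-1` `[q%:~R * m1 m, (q + 1)%:~R * m1 m[.
have mE' m q : measurable (E' m q) by rewrite -[X in measurable X]setTI; exact: mf.
pose E (k m : nat) (q : int) : set (lebRn R n) := E' m q `&` cube 0 k%:R.
have mE k m q : measurable (E k m q) by apply: measurableI => //; exact: measurable_cube.
pose D (k m : nat) (q : int) : set (lebRn R n) := cube 0 k.+1%:R `\` E' m q.
have mD k m q : measurable (D k m q) by apply: measurableD => //; exact: measurable_cube.
pose c (m : nat) (q : int) : R := (`|q%:~R| + 1) * m1 m.
have c0 m q : 0 <= c m q by rewrite mulr_ge0// ?addr_ge0// ltW.
pose g (k m : nat) (q : int) : lebRn R n -> R := (fun y => `|f y| + c m q) \_ (D k m q).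
have ig k m q : mu.-integrable setT (EFin \o g k m q).
  rewrite /g -restrict_EFin -integrable_mkcond//.
  apply: (@integrableS _ _ _ mu (cube 0 k.+1%:R)) => //; first exact: measurable_cube.
    by apply: subDsetl.
  rewrite (_ : _ \o _ = (EFin \o (fun y => `|f y|%R)) \+ (EFin \o cst (c m q)))%E//.
  apply: integrableD; first exact: measurable_cube.
    by apply: integrable_norm; exact: fi.
  exact: integrable_cst_cube.
pose N (k m : nat) (q : int) := [set x : 'rV[R]_n | E k m q x /\ forall s, (0 < s)%R ->
    exists r, [/\ (0 < r)%R, (r < s)%R &
     ((m1 m * r ^+ n)%:E < \int[mu]_(y in cube x r) (g k m q y)%:E)%E]].
have N0 k m q : leb_outer (N k m q) = 0%E.
  apply: null_density => //.
  - by apply: le_lt_trans (leb_cube_lty 0 k%:R); apply: le_leb_outer => x [].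
  - by move=> x; rewrite /g /restrict; case: ifP => // _; rewrite addr_ge0.
  - move=> x [E'x _]; rewrite /g /restrict ifF//; apply/negP => /set_mem[].
    by move=> _; exact.
pose M (j : nat) := if @unpickle (nat * nat * int)%type j is Some (k, m, q)
  then N k m q : set (lebRn R n) else set0.
apply: (@negligibleS _ _ _ mu (\bigcup_j M j)); last first.
  apply: negligible_bigcup => j; rewrite /M; case: unpickle => [[[k m] q]|].
    exact: leb_null_negligible.
  exact: negligible_set0.
move=> x /= nP; apply: contrapT => nM; apply: nP => t t0.
have {}nM k m q : ~ N k m q x.
  by move=> Nx; apply: nM; exists (pickle (k, m, q)) => //; rewrite /M pickleK.
have [k xk] : exists k : nat, cube 0 k%:R x.
  have : [set: 'rV[R]_n] x by [].
  by rewrite -cube0_bigcup => -[k _ xk]; exists k.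
have t20 : 0 < t / (2 ^+ n + 1) by rewrite divr_gt0// addr_gt0// exprn_gt0.
have [m mt] := ltr_add_invr t20; rewrite add0r ltr_pdivlMr ?addr_gt0 ?exprn_gt0// -/(m1 m) in mt.
pose q := Num.floor (f x * m.+1%:R).
have E'x : E' m q x.
  rewrite /E' /= in_itv/= ler_pdivrMr// ltr_pdivlMr//.
  by rewrite floor_le_tmp ?num_real//= floorD1_gt.
have [s s0 xs] : exists2 s, 0 < s & forall r, 0 < r < s ->
    (\int[mu]_(y in cube x r) (g k m q y)%:E <= (m1 m * r ^+ n)%:E)%E.
  apply: contrapT => h; apply: (nM k m q); split => // s s0.
  apply: contrapT => h'; apply: h; exists s => // r /andP[r0 rs].
  by rewrite leNgt; apply/negP => h; apply: h'; exists r.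
exists (Num.min s 1); first by rewrite lt_min s0 ltr01.
move=> r; rewrite lt_min => /and3P[r0 rs r1].
have xr1 : cube x r `<=` cube 0 k.+1%:R.
  move=> y yx i; have := yx i; have := xk i; rewrite !mxE !subr0 => h1 h2.
  by rewrite -natr1 -(subrK (x 0 i) (y 0 i)) (le_lt_trans (ler_normD _ _))//; lra.
apply: (@le_trans _ _ (\int[mu]_(y in cube x r) ((m1 m)%:E + (g k m q y)%:E))%E).
  apply: ge0_le_integral.
  - exact: measurable_cube.
  - by move=> y _; rewrite lee_fin.
  - apply/measurable_EFinP; apply: measurable_funTS.
    apply: measurableT_comp; first exact: normr_measurable.
    by apply: measurable_funB; [exact: mf|exact: measurable_cst].
  - apply: measurable_funTS; apply: emeasurable_funD; first exact: measurable_cst.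
    exact: measurable_int (ig k m q).
  - move=> y yx; rewrite -EFinD lee_fin /g /restrict; case: ifPn => [yD|/negP yD].
      have fxc : `|f x| <= c m q.
        move: E'x; rewrite /E' /= in_itv/= /c => /andP[h1 h2].
        have := ler_norm (q%:~R : R); have := ler_norm (- q%:~R : R).
        have := m10 m; rewrite normrN ler_norml intrD in h2 *.
        by nra.
      have := ler_normB (f y) (f x); have := m10 m; lra.
    have : E' m q y by apply: contrapT => yE; apply: yD; apply/mem_set; split => //; exact: xr1.
    move: E'x; rewrite /E' /= !in_itv/= => /andP[h1 h2] /andP[h3 h4].
    by rewrite addr0 ler_norml; rewrite intrD in h2 h4; apply/andP; split; lra.
rewrite ge0_integralD//; last 4 first.
- exact: measurable_cube.
- by move=> y _; rewrite lee_fin ltW.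
- by move=> y _; rewrite lee_fin /g /restrict; case: ifP => // _; rewrite addr_ge0.
- exact: measurable_funS (measurable_int mu (ig k m q)).
rewrite integral_cst; last exact: measurable_cube.
apply: le_trans (leeD (lee_wpmul2l _ (leb_cube_le x (ltW r0))) (xs r _)) _.
- by rewrite lee_fin ltW.
- by rewrite r0.
rewrite -EFinM -EFinD lee_fin.
rewrite (_ : _ + _ = m1 m * (2 ^+ n + 1) * r ^+ n); last by rewrite exprMn; ring.
by rewrite ler_pM2r ?exprn_gt0// ltW.
Qed.

End lebesgue_points.

(** * Radial functions and kernels with power decay *)

Section measurability.
Context {R : realType} {n : nat}.
Local Notation mu := (leb R n).
Implicit Types (x y : 'rV[R]_n).

Lemma enorm_ge0 x : 0 <= enorm x. Proof. exact: sqrtr_ge0. Qed.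

Lemma le_coord_enorm x i : `|x 0 i| <= enorm x.
Proof.
rewrite -sqrtr_sqr; apply: ler_wsqrtr; rewrite (bigD1 i)//= lerDl.
by apply: sumr_ge0 => j _; exact: sqr_ge0.
Qed.

Lemma enormZ s x : enorm (s *: x) = `|s| * enorm x.
Proof.
rewrite /enorm -sqrtr_sqr -sqrtrM ?sqr_ge0// mulr_sumr; congr Num.sqrt.
by apply: eq_bigr => i _; rewrite mxE exprMn.
Qed.

Lemma enormN x : enorm (- x) = enorm x.
Proof. by rewrite -scaleN1r enormZ normrN1 mul1r. Qed.

Lemma measurable_enorm_comp d (T : measurableType d) (v : T -> 'rV[R]_n) :
  (forall i, measurable_fun setT (fun t => v t 0 i)) ->
  measurable_fun setT (fun t => enorm (v t)).
Proof.
move=> mv; rewrite /enorm.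
apply: (measurableT_comp (f := @Num.sqrt R)).
  exact: (continuous_measurable_fun (@sqrt_continuous R)).
by apply: measurable_sum => i; apply: measurable_funX.
Qed.

Lemma measurable_coord_sub (i : 'I_n) :
  measurable_fun setT (fun z : lebRn R n * lebRn R n => (z.2 - z.1 : 'rV[R]_n) 0 i).
Proof.
under eq_fun do rewrite !mxE.
by apply: measurable_funB; apply: (measurableT_comp (measurable_coord i)).
Qed.

(** The superlevel sets of [h] are preimages of intervals under the norm. *)
Lemma measurable_radial (h : 'rV[R]_n -> R) d (T : measurableType d) (v : T -> 'rV[R]_n) :
  (forall x y, enorm x <= enorm y -> h y <= h x) ->
  (forall i, measurable_fun setT (fun t => v t 0 i)) ->
  measurable_fun setT (fun t => h (v t)).
Proof.
move=> hdecr mv mD; apply: (measurability _ (RGenOInfty.measurableE R)) => // _ [_ [c ->] <-].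
pose I : set R := [set s | exists2 u, s <= enorm u & c < h u].
rewrite setTI (_ : _ @^-1` _ = (fun t => enorm (v t)) @^-1` I).
  rewrite -[X in measurable X]setTI; apply: measurable_enorm_comp => //.
  apply: is_interval_measurable => s1 s2 _ [u u1 cu] s /andP[_ s2s].
  by exists u => //; exact: le_trans u1.
apply/seteqP; split => t /=; rewrite in_itv/= andbT; first by move=> ct; exists (v t).
by move=> [u vu cu]; exact: lt_le_trans (hdecr _ _ vu).
Qed.

End measurability.

Section shells.
Context {R : realType} {n : nat}.
Local Notation mu := (leb R n).
Implicit Types (x y z : 'rV[R]_n) (phi : lebRn R n -> \bar R).
Variable delta : R.
Hypothesis delta0 : 0 < delta.

(** The kernel of the decay bound, dilated to scale [e]; for [delta = 1] it has the
    size of the Poisson kernel of the upper half-space. *)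
Definition poisson (e : R) z : R := e ^- n * (1 + enorm (e^-1 *: z)) `^ (- (n%:R + delta)).

Lemma poisson_ge0 e z : 0 < e -> 0 <= poisson e z.
Proof. by move=> e0; rewrite mulr_ge0 ?powR_ge0// invr_ge0 exprn_ge0// ltW. Qed.

Lemma measurable_poisson (e : R) d (T : measurableType d) (v : T -> 'rV[R]_n) : 0 < e ->
  (forall i, measurable_fun setT (fun t => v t 0 i)) ->
  measurable_fun setT (fun t => poisson e (v t)).
Proof.
move=> e0 mv; apply: (measurable_radial (h := poisson e)) => // x y xy.
rewrite /poisson ler_pM2l ?invr_gt0 ?exprn_gt0// !powRN lef_pV2 ?posrE ?powR_gt0//.
- rewrite ge0_ler_powR ?nnegrE ?addr_ge0 ?enorm_ge0 ?(ltW delta0)//.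
  by rewrite lerD2l !enormZ ler_wpM2l.
- by rewrite ltr_pwDl// enorm_ge0.
- by rewrite ltr_pwDl// enorm_ge0.
Qed.

(* [a = b ^+ 2]: of the decay [a ^+ k] on the [k]-th dyadic shell, one factor
   [b ^+ k] is left to the hypothesis of [integral_poisson_le] and the other
   one sums. *)
Let a : R := 2 `^ (- delta).
Let b : R := 2 `^ (- (delta / 2)).

Let a0 : 0 < a. Proof. exact: powR_gt0. Qed.
Let b0 : 0 < b. Proof. exact: powR_gt0. Qed.
Let b1 : b < 1.
Proof.
rewrite /b powRN invf_lt1 ?powR_gt0//.
have := @gt0_ltr_powR R (delta / 2) (divr_gt0 delta0 (ltr0Sn _ 1)) 1 2.
by rewrite powR1; apply; rewrite ?nnegrE ?ltr1n.
Qed.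
Let bb : b * b = a.
Proof. by rewrite /a /b -powRD ?pnatr_eq0 ?implybT//; congr (_ `^ _); field. Qed.

(** Each point is charged to the first dyadic cube that contains it. *)
Lemma poisson_shell e z : 0 < e -> exists2 k : nat, cube 0 (2 ^+ k * e) z &
  poisson e z <= 2 ^+ n / a * (a ^+ k * (2 ^+ k * e) ^- n).
Proof.
move=> e0; have en0 : 0 < e ^- n by rewrite invr_gt0 exprn_gt0.
have w1 : (1 + enorm (e^-1 *: z)) `^ (- (n%:R + delta)) <= 1.
  rewrite powRN invf_le1 ?powR_gt0 ?ltr_pwDl ?enorm_ge0//.
  by rewrite -[leLHS](powRr0 (1 + enorm (e^-1 *: z))) ler_powR ?lerDl ?enorm_ge0 ?addr_ge0// ltW.
have exk : exists k, `[< cube 0 (2 ^+ k * e) z >].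
  have /(_ z) : [set: 'rV[R]_n] `<=` \bigcup_k cube (0 : 'rV[R]_n) k%:R by rewrite cube0_bigcup.
  move=> /(_ I)[j _ jz]; exists (Num.truncn (j%:R / e)).+1; apply/asboolP.
  apply: cubeS jz; rewrite -ler_pdivrMr//.
  apply: le_trans (ltW (truncnS_gt _)) _.
  by rewrite -natrX ler_nat ltnW// ltn_expl.
case: (ex_minnP exk) => -[|k] /asboolP zk kmin.
  exists 0%N => //; rewrite expr0 mul1r in zk *; rewrite expr0 mul1r.
  apply: (@le_trans _ _ (e ^- n)); first by rewrite /poisson ler_piMr// ltW.
  rewrite ler_peMl ?(ltW en0)// ler_pdivlMr// mul1r.
  apply: (@le_trans _ _ 1); first by rewrite -bb; have := b0; have := b1; nra.
  by rewrite exprn_ege1// ler1n.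
exists k.+1 => //.
have nzk : ~ cube 0 (2 ^+ k * e) z.
  by move=> /asboolP /kmin; rewrite ltnn.
have [i iz] : exists i : 'I_n, 2 ^+ k * e <= `|z 0 i|.
  apply: contrapT => h; apply: nzk => i; rewrite mxE subr0 ltNge.
  by apply/negP => iz; apply: h; exists i.
have kz : 2 ^+ k <= 1 + enorm (e^-1 *: z).
  rewrite enormZ gtr0_norm ?invr_gt0// -[leLHS]add0r lerD//.
  by rewrite ler_pdivlMl// mulrC (le_trans iz)// le_coord_enorm.
have k0 : 0 < 2 ^+ k :> R by rewrite exprn_gt0.
have step : (1 + enorm (e^-1 *: z)) `^ (- (n%:R + delta)) <= (2 ^+ k) ^- n * a ^+ k.
  apply: (@le_trans _ _ ((2 ^+ k) `^ (- (n%:R + delta)))).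
    rewrite !powRN lef_pV2 ?posrE ?powR_gt0 ?ltr_pwDl ?enorm_ge0//.
    by rewrite ge0_ler_powR ?nnegrE ?addr_ge0 ?enorm_ge0 ?(ltW delta0)// ltW.
  rewrite opprD powRD; last by rewrite (gt_eqF k0) implybT.
  rewrite powR_invn ?(ltW k0)// ler_pM2l ?invr_gt0 ?exprn_gt0//.
  by rewrite -[2 ^+ k]powR_mulrn// powRAC powR_mulrn ?powR_ge0.
rewrite /poisson (le_trans (ler_wpM2l (ltW en0) step))//.
rewrite le_eqVlt; apply/orP; left; apply/eqP.
rewrite !exprS !exprMn; field.
by rewrite !gt_eqF ?exprn_gt0.
Qed.

Lemma geometric_eseries_le (c q : R) : 0 <= c -> 0 <= q -> q < 1 ->
  (\sum_(k <oo) (c * q ^+ k)%:E <= (c / (1 - q))%:E)%E.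
Proof.
move=> c0 q0 q1; apply: lime_le.
  by apply: is_cvg_nneseries => k _ _; rewrite lee_fin mulr_ge0 ?exprn_ge0.
apply: nearW => N; rewrite sumEFin lee_fin ler_pdivlMr ?subr_gt0//.
have -> : (\sum_(0 <= k < N) c * q ^+ k) * (1 - q) = c * (1 - q ^+ N).
  elim: N => [|N IH]; first by rewrite big_nil mul0r expr0 subrr mulr0.
  by rewrite big_nat_recr//= mulrDl IH exprS; ring.
by rewrite ler_piMr// gerBl exprn_ge0.
Qed.

Definition shell_ratio : R := b.
Definition shell_const : R := 2 ^+ n / a / (1 - b).

Lemma shell_ratio_gt0 : 0 < shell_ratio. Proof. exact: b0. Qed.
Lemma shell_ratio_lt1 : shell_ratio < 1. Proof. exact: b1. Qed.
Lemma shell_const_gt0 : 0 < shell_const.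
Proof. by rewrite !divr_gt0 ?exprn_gt0 ?subr_gt0. Qed.

(** The kernel is dominated by a geometric combination of indicators of dyadic
    cubes divided by their volumes, so its averages are controlled by cube
    averages. *)
Lemma integral_poisson_le e x phi (t : R) : 0 < e -> 0 <= t ->
  measurable_fun setT phi -> (forall y, 0 <= phi y)%E ->
  (forall k, (shell_ratio ^+ k * (2 ^+ k * e) ^- n)%:E *
     \int[mu]_(y in cube x (2 ^+ k * e)) phi y <= t%:E)%E ->
  (\int[mu]_y ((poisson e (y - x))%:E * phi y) <= (shell_const * t)%:E)%E.
Proof.
move=> e0 t0 mphi phi0 Ht.
have Kn : 0 <= 2 ^+ n / a by rewrite divr_ge0 ?exprn_ge0// ltW.
pose c k := 2 ^+ n / a * (a ^+ k * (2 ^+ k * e) ^- n).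
have c0 k : 0 <= c k.
  by rewrite !mulr_ge0// ?invr_ge0 ?exprn_ge0// ?mulr_ge0 ?exprn_ge0// ltW.
pose F k (y : lebRn R n) : \bar R := ((c k)%:E * (phi \_ (cube x (2 ^+ k * e))) y)%E.
have F0 k y : (0 <= F k y)%E.
  by rewrite mule_ge0// ?lee_fin// /restrict; case: ifP.
have mF k : measurable_fun setT (F k).
  apply: emeasurable_funM; first exact: measurable_cst.
  apply/(measurable_restrictT _ (measurable_cube _ _)); exact: measurable_funS mphi.
apply: (@le_trans _ _ (\int[mu]_y (\sum_(k <oo) F k y))%E).
  apply: ge0_le_integral.
  - exact: measurableT.
  - by move=> y _; rewrite mule_ge0// lee_fin poisson_ge0.
  - apply: emeasurable_funM; last exact: mphi.
    apply/measurable_EFinP; apply: (measurable_poisson e0) => i.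
    under eq_fun do rewrite !mxE.
    by apply: measurable_funB; [exact: measurable_coord|exact: measurable_cst].
  - by apply: ge0_emeasurable_sum => [k y _ _|k _]; [exact: F0|exact: mF].
  - move=> y _; have [k yk le_k] := poisson_shell (y - x) e0.
    rewrite (@nneseriesD1 _ _ k)//=.
    rewrite -[leLHS]adde0 leeD//; last by apply: nneseries_ge0.
    rewrite /F /restrict mem_set; last by move=> i; have := yk i; rewrite !mxE subr0.
    by rewrite lee_wpmul2r// lee_fin.
rewrite integral_nneseries//.
apply: (@le_trans _ _ (\sum_(k <oo) (2 ^+ n / a * t * b ^+ k)%:E)%E); last first.
  rewrite (_ : shell_const * t = 2 ^+ n / a * t / (1 - b)); last by rewrite /shell_const; ring.
  by apply: geometric_eseries_le => //; [exact: mulr_ge0|exact: ltW].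
apply: lee_nneseries => k *; first exact: integral_ge0.
have mr : measurable_fun setT (phi \_ (cube x (2 ^+ k * e)) : lebRn R n -> \bar R).
  by apply/(measurable_restrictT _ (measurable_cube _ _)); exact: measurable_funS mphi.
have r0 y : (0 <= (phi \_ (cube x (2 ^+ k * e))) y)%E by rewrite /restrict; case: ifP.
rewrite ge0_integralZl//; last by rewrite lee_fin.
rewrite -integral_mkcond.
rewrite (_ : c k = 2 ^+ n / a * b ^+ k * (b ^+ k * (2 ^+ k * e) ^- n)); last first.
  by rewrite /c -bb exprMn; ring.
rewrite (_ : _ * t * _ = 2 ^+ n / a * b ^+ k * t); last by ring.
rewrite !(EFinM (2 ^+ n / a * b ^+ k)) -muleA.
apply: lee_wpmul2l; last exact: Ht.
by rewrite lee_fin mulr_ge0// exprn_ge0// ltW.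
Qed.

End shells.

(** * Radially decreasing densities *)

Section radial_kernel.
Context {R : realType} {n : nat}.
Local Notation mu := (leb R n).
Implicit Types (x y z : 'rV[R]_n).
Variable h : 'rV[R]_n -> R.
Hypothesis h_ge0 : forall x, 0 <= h x.
Hypothesis h_decr : forall x y, enorm x <= enorm y -> h y <= h x.
Hypothesis h_mass : (\int[mu]_x (h x)%:E = 1)%E.

Lemma radial_even z : h (- z) = h z.
Proof. by apply/eqP; rewrite eq_le !h_decr// enormN. Qed.

Lemma radial_le0 z : h z <= h 0.
Proof.
by apply: h_decr; rewrite -(scale0r (0 : 'rV[R]_n)) enormZ normr0 mul0r enorm_ge0.
Qed.

Lemma hscale_ge0 e z : 0 < e -> 0 <= hscale h e z.
Proof. by move=> e0; rewrite mulr_ge0// invr_ge0 exprn_ge0// ltW. Qed.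

Lemma kern_ge0 e x y : 0 < e -> 0 <= kern h e x y.
Proof. exact: hscale_ge0. Qed.

Lemma kern_sym e x y : kern h e x y = kern h e y x.
Proof. by rewrite /kern /hscale -(radial_even (_ *: (y - x))) -scalerN opprB. Qed.

Lemma hscale_decr e : 0 < e ->
  forall x y, enorm x <= enorm y -> hscale h e y <= hscale h e x.
Proof.
move=> e0 x y xy; rewrite ler_pM2l ?invr_gt0 ?exprn_gt0//; apply: h_decr.
by rewrite !enormZ ler_wpM2l.
Qed.

Lemma measurable_kern2 e : 0 < e ->
  measurable_fun setT (fun z : lebRn R n * lebRn R n => kern h e z.1 z.2).
Proof.
by move=> e0; apply: (measurable_radial (hscale_decr e0)) => i; exact: measurable_coord_sub.
Qed.

Lemma measurable_kern e x : 0 < e -> measurable_fun setT (kern h e x : lebRn R n -> R).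
Proof.
move=> e0; apply: (measurable_radial (hscale_decr e0)) => i.
by under eq_fun do rewrite !mxE; apply: measurable_funB => //; exact: measurable_coord.
Qed.

Lemma measurable_h : measurable_fun setT (h : lebRn R n -> R).
Proof. by apply: (measurable_radial h_decr) => i; exact: measurable_coord. Qed.

Lemma integral_kern e x : 0 < e -> (\int[mu]_y (kern h e x y)%:E = 1)%E.
Proof.
move=> e0; have ei0 : 0 < e^-1 by rewrite invr_gt0.
have en0 : 0 < e ^- n by rewrite invr_gt0 exprn_gt0.
have -> : (\int[mu]_y (kern h e x y)%:E =
    \int[mu]_y ((e ^- n)%:E * (h (affine e^-1 (- (e^-1 *: x)) y))%:E))%E.
  by apply: eq_integral => y _; rewrite -EFinM /kern /hscale scalerBr.
rewrite ge0_integralZl//; last 3 first.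
- apply/measurable_EFinP; apply: (measurableT_comp measurable_h).
  exact: measurable_affine.
- by move=> y _; rewrite lee_fin.
- by rewrite lee_fin ltW.
rewrite (ge0_integral_affine _ ei0 (F := fun x => (h x)%:E)); last 2 first.
- exact/measurable_EFinP/measurable_h.
- by move=> y; rewrite lee_fin.
by rewrite h_mass mule1 -EFinM exprVn invrK mulVf// gt_eqF// exprn_gt0.
Qed.

Lemma integrable_kern e x : 0 < e -> mu.-integrable setT (fun y => (kern h e x y)%:E).
Proof.
move=> e0; apply/integrableP; split; first exact/measurable_EFinP/measurable_kern.
under eq_integral do rewrite gee0_abs ?lee_fin ?kern_ge0//.
by rewrite integral_kern// ltry.
Qed.

(** Otherwise [h] would vanish off the origin and have integral 0; in dimension 0
    the origin is the whole space and [h 0] itself is positive. *)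
Lemma radial_lower_bound : exists r m, [/\ 0 < r, 0 < m & forall z, enorm z < r -> m <= h z].
Proof.
have [[z [z0 hz]]|nz] := pselect (exists z, 0 < enorm z /\ 0 < h z).
  by exists (enorm z), (h z); split => // y yz; apply: h_decr; exact: ltW.
have hz0 z : 0 < enorm z -> h z = 0.
  move=> z0; apply/eqP; rewrite eq_le h_ge0 andbT leNgt; apply/negP => hz.
  by apply: nz; exists z.
have h00 : 0 < h 0.
  rewrite lt_neqAle h_ge0 andbT; apply/eqP => h00.
  have : (\int[mu]_x (h x)%:E = 0)%E.
    apply: integral0_eq => z _; congr EFin; apply/eqP.
    by rewrite eq_le h_ge0 andbT [leRHS]h00 radial_le0.
  by rewrite h_mass => /eqP; rewrite onee_eq0.
case: (posnP n) => [n0|n0].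
  exists 1, (h 0); split => // z _; suff -> : z = 0 by [].
  by apply/rowP => i; have := ltn_ord i; rewrite [X in (_ < X)%N]n0.
exfalso.
pose r : R := (4 * (h 0 + 1))^-1.
have r0 : 0 < r by rewrite invr_gt0 mulr_gt0// addr_gt0.
have : (\int[mu]_x (h x)%:E <= \int[mu]_(x in cube 0 r) (h 0)%:E)%E.
  rewrite [leRHS]integral_mkcond; apply: ge0_le_integral => //.
  - by move=> x _; rewrite lee_fin.
  - exact/measurable_EFinP/measurable_h.
  - by apply/(measurable_restrictT _ (measurable_cube _ _)); exact: measurable_cst.
  - move=> x _; rewrite /restrict; case: ifPn => [_|/negP xr]; first by rewrite lee_fin radial_le0.
    rewrite lee_fin hz0// lt_neqAle enorm_ge0 andbT; apply/eqP => x0.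
    apply: xr; apply/mem_set => i; rewrite mxE subr0 (le_lt_trans (le_coord_enorm _ _))//.
    by rewrite -x0.
rewrite h_mass integral_cst; last exact: measurable_cube.
move=> /le_trans /(_ (lee_wpmul2l _ (leb_cube_le 0 (ltW r0)))).
rewrite lee_fin => /(_ (h_ge0 _)); rewrite -EFinM lee_fin leNgt => /negP; apply.
have r2 : 2 * r < 1 by rewrite /r; rewrite -ltr_pdivlMl// mulr1 ltf_pV2 ?posrE; lra.
apply: (@le_lt_trans _ _ (h 0 * (2 * r))).
  rewrite ler_pM2l// -[n]prednK// exprS ler_piMr ?mulr_ge0 ?(ltW r0)//.
  by apply: exprn_ile1; [rewrite mulr_ge0// ltW|exact: ltW].
rewrite /r invfM mulrA mulrA -[X in _ < X](mulfV (x := h 0 + 1)); last by rewrite gt_eqF// addr_gt0.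
by rewrite ltr_pM2r ?invr_gt0 ?addr_gt0//; lra.
Qed.

End radial_kernel.

(** * Inequalities for averages *)

Section integral_inequalities.
Context d (T : measurableType d) (R : realType) (m : {measure set T -> \bar R}).
Implicit Types (f w phi : T -> R).

Lemma abs_Rintegral_le f : measurable_fun setT f ->
  (`|\int[m]_x f x|%:E <= \int[m]_x `|f x|%:E)%E.
Proof.
move=> mf; apply: (@le_trans _ _ (`|\int[m]_x (f x)%:E|)%E).
  by rewrite /Rintegral; case: (integral _ _ _) => [r| |] /=; rewrite ?normr0 ?lee_fin ?leey.
by apply: (le_abse_integral m measurableT); exact/measurable_EFinP.
Qed.

(** Young's inequality [phi * J ^ (p - 1) <= phi ^ p / p + J ^ p / q], integrated
    against [w] with [J] the average of [phi]. *)
Lemma jensen_powR w phi (p : R) : 1 <= p ->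
  measurable_fun setT w -> measurable_fun setT phi ->
  (forall x, 0 <= w x) -> (forall x, 0 <= phi x) ->
  (\int[m]_x (w x)%:E = 1)%E ->
  ((\int[m]_x (w x * phi x)%:E) `^ p <= \int[m]_x (w x * phi x `^ p)%:E)%E.
Proof.
move=> p1 mw mphi w0 phi0 w1.
have p0 : 0 < p by rewrite (lt_le_trans ltr01).
have mphip : measurable_fun setT (fun x => phi x `^ p).
  exact: measurableT_comp (measurable_powR p) mphi.
have [Ioo|Ifin] := eqVneq (\int[m]_x (w x * phi x `^ p)%:E)%E +oo%E.
  by rewrite Ioo leey.
have I0 : (0 <= \int[m]_x (w x * phi x `^ p)%:E)%E.
  by apply: integral_ge0 => x _; rewrite lee_fin mulr_ge0// powR_ge0.
have {Ifin}Ifin : (\int[m]_x (w x * phi x `^ p)%:E)%E \is a fin_num.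
  by rewrite ge0_fin_numE// lt_neqAle Ifin leey.
have J0 : (0 <= \int[m]_x (w x * phi x)%:E)%E.
  by apply: integral_ge0 => x _; rewrite lee_fin mulr_ge0.
have JI : (\int[m]_x (w x * phi x)%:E <= 1 + \int[m]_x (w x * phi x `^ p)%:E)%E.
  rewrite -w1 -ge0_integralD//.
  - apply: ge0_le_integral => //.
    + by move=> x _; rewrite lee_fin mulr_ge0.
    + exact/measurable_EFinP/measurable_funM.
    + by apply: emeasurable_funD; apply/measurable_EFinP => //; exact: measurable_funM.
    + move=> x _; rewrite -EFinD lee_fin -[X in _ <= X + _]mulr1 -mulrDr ler_wpM2l//.
      have [x1|x1] := leP (phi x) 1; first by rewrite (le_trans x1)// lerDl powR_ge0.
      by rewrite (le_trans (le1r_powR (ltW x1) p1))// lerDr.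
  - by move=> x _; rewrite lee_fin.
  - exact/measurable_EFinP.
  - by move=> x _; rewrite lee_fin mulr_ge0// powR_ge0.
  - exact/measurable_EFinP/measurable_funM.
have Jfin : (\int[m]_x (w x * phi x)%:E)%E \is a fin_num.
  rewrite ge0_fin_numE// (le_lt_trans JI)// lte_add_pinfty ?ltry//.
  by rewrite -ge0_fin_numE.
have [->|p_neq1] := eqVneq p 1.
  rewrite poweRe1//.
  by under eq_integral do rewrite -[phi _]powRr1//.
have {p_neq1}p1' : 1 < p by rewrite lt_neqAle eq_sym p_neq1.
rewrite -(fineK Jfin) -(fineK Ifin) poweR_EFin lee_fin.
set J := fine _; set I := fine _.
have JE : (\int[m]_x (w x * phi x)%:E = J%:E)%E by rewrite fineK.
have IE : (\int[m]_x (w x * phi x `^ p)%:E = I%:E)%E by rewrite fineK.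
have J0' : 0 <= J by rewrite /J fine_ge0.
pose q := p / (p - 1).
have q0 : 0 < q by rewrite divr_gt0// subr_gt0.
have pq : p^-1 + q^-1 = 1 by rewrite /q invf_div; field; rewrite gt_eqF.
have pI x : phi x * J `^ (p - 1) <= phi x `^ p / p + J `^ p / q.
  have -> : J `^ p = (J `^ (p - 1)) `^ q.
    by rewrite -powRrM; congr (_ `^ _); rewrite /q mulrC divfK// subr_eq0 gt_eqF.
  by apply: conjugate_powR => //; exact: powR_ge0.
have : ((J `^ (p - 1))%:E * \int[m]_x (w x * phi x)%:E <=
   (p^-1)%:E * \int[m]_x (w x * phi x `^ p)%:E + (J `^ p / q)%:E * \int[m]_x (w x)%:E)%E.
  have mwp : measurable_fun setT (fun x => (w x * phi x)%:E).
    exact/measurable_EFinP/measurable_funM.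
  have mwpp : measurable_fun setT (fun x => (w x * phi x `^ p)%:E).
    exact/measurable_EFinP/measurable_funM.
  have mwE : measurable_fun setT (fun x => (w x)%:E) by exact/measurable_EFinP.
  have wp0 x : setT x -> (0 <= (w x * phi x)%:E)%E by rewrite lee_fin mulr_ge0.
  have wpp0 x : setT x -> (0 <= (w x * phi x `^ p)%:E)%E.
    by rewrite lee_fin mulr_ge0// powR_ge0.
  have wE0 x : setT x -> (0 <= (w x)%:E)%E by rewrite lee_fin.
  have c1 : (0 <= (p^-1)%:E)%E by rewrite lee_fin invr_ge0 ltW.
  have c2 : (0 <= (J `^ p / q)%:E)%E by rewrite lee_fin divr_ge0 ?powR_ge0// ltW.
  have c3 : (0 <= (J `^ (p - 1))%:E)%E by rewrite lee_fin powR_ge0.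
  rewrite -!ge0_integralZl// -ge0_integralD//; last 4 first.
  - by move=> x _; apply: mule_ge0 => //; exact: wpp0.
  - exact: emeasurable_funM.
  - by move=> x _; apply: mule_ge0 => //; exact: wE0.
  - exact: emeasurable_funM.
  apply: ge0_le_integral => //.
  - by move=> x _; rewrite -EFinM lee_fin !mulr_ge0// powR_ge0.
  - by apply/measurable_EFinP; do 2 apply: measurable_funM => //.
  - by apply: emeasurable_funD; apply/measurable_EFinP; do 2?apply: measurable_funM => //.
  - move=> x _; rewrite -!EFinM -EFinD lee_fin.
    rewrite [leLHS](_ : _ = w x * (phi x * J `^ (p - 1))); last by ring.
    rewrite [leRHS](_ : _ = w x * (phi x `^ p / p + J `^ p / q)); last by ring.
    by rewrite ler_wpM2l.
rewrite JE IE w1 mule1 -!EFinM -EFinD lee_fin mulrC mulr_powRB1//.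
have -> : q^-1 = 1 - p^-1 by have := pq; lra.
rewrite mulrBr mulr1 => H.
have : J `^ p / p <= p^-1 * I by lra.
by rewrite mulrC ler_pM2l// invr_gt0.
Qed.

End integral_inequalities.

Section parameter_integral.
Context d1 d2 (T1 : measurableType d1) (T2 : measurableType d2) (R : realType).
Variable m : {sigma_finite_measure set T2 -> \bar R}.

Lemma measurable_Rintegral_param (G : T1 * T2 -> R) : measurable_fun setT G ->
  measurable_fun setT (fun x => \int[m]_y G (x, y)).
Proof.
move=> mG; have mG' : measurable_fun setT (EFin \o G) by exact/measurable_EFinP.
apply: (measurableT_comp (f := fine)); first exact: fine_measurable.
rewrite [X in measurable_fun _ X](_ : _ = (fubini_F m ((EFin \o G)^\+) \- fubini_F m ((EFin \o G)^\-))%E).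
  apply: emeasurable_funB; apply: measurable_fun_fubini_tonelli_F => //.
    exact: measurable_funepos.
  exact: measurable_funeneg.
apply/funext => x; rewrite integralE; congr (_ - _)%E; apply: eq_integral => y _.
  by rewrite !funeposE.
by rewrite !funenegE.
Qed.

End parameter_integral.

(** * The Markov operator *)

Lemma leb_tonelli (R : realType) (n : nat) (F : lebRn R n * lebRn R n -> \bar R) :
  measurable_fun setT F -> (forall z, 0 <= F z)%E ->
  (\int[leb R n]_x \int[leb R n]_y F (x, y) = \int[leb R n]_y \int[leb R n]_x F (x, y))%E.
Proof. by move=> mF F0; exact: (fubini_tonelli _ mF F0). Qed.

Section markov_operator.
Context {R : realType} {n : nat}.
Local Notation mu := (leb R n).
Implicit Types (x y z : 'rV[R]_n) (f : 'rV[R]_n -> R).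
Variables (Omega : set 'rV[R]_n) (h : 'rV[R]_n -> R).
Hypothesis mOmega : measurable (Omega : set (lebRn R n)).
Hypothesis h_ge0 : forall x, 0 <= h x.
Hypothesis h_decr : forall x y, enorm x <= enorm y -> h y <= h x.
Hypothesis h_mass : (\int[mu]_x (h x)%:E = 1)%E.

Lemma LpP p f : Lp Omega p f <->
  measurable_fun setT (f \_ Omega : lebRn R n -> R) /\ (Lp_norm Omega p f < +oo)%E.
Proof.
rewrite /Lp /= inE; split => [/andP[]|[mf nf]]; first by rewrite !inE /= => mf nf.
by apply/andP; split; rewrite inE.
Qed.

Variables (e d0 : R).
Hypothesis e0 : 0 < e.
Hypothesis d00 : 0 < d0.
Hypothesis d0_le : forall x, Omega x -> d0 <= dens Omega h e x.

Lemma markov_kernE x y : markov_kern Omega h e x y = kern h e x y / dens Omega h e x.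
Proof. by []. Qed.

Lemma densE x : dens Omega h e x = \int[mu]_(y in Omega) kern h e x y.
Proof. by []. Qed.

Local Opaque kern dens markov_kern.

Lemma restrict_mul (k : 'rV[R]_n -> R) f : (fun y => k y * f y) \_ Omega = (fun y => k y * (f \_ Omega) y).
Proof. by apply/funext => y; rewrite /restrict; case: ifP => // _; rewrite mulr0. Qed.

Lemma markov_opE f x : markov_op Omega h e f x =
  \int[mu]_y (markov_kern Omega h e x y * (f \_ Omega) y).
Proof. by rewrite /markov_op Rintegral_mkcond restrict_mul. Qed.

Lemma measurable_dens : measurable_fun setT (dens Omega h e : lebRn R n -> R).
Proof.
rewrite (_ : dens _ _ _ = fun x => \int[mu]_y (kern h e x y * \1_(Omega : set (lebRn R n)) y)).
  have mG : measurable_fun setT (fun z : lebRn R n * lebRn R n =>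
      kern h e z.1 z.2 * \1_(Omega : set (lebRn R n)) z.2).
    apply: measurable_funM; first exact: measurable_kern2.
    have mi : measurable_fun setT (\1_(Omega : set (lebRn R n)) : lebRn R n -> R).
      exact: measurable_indic.
    exact: (measurableT_comp mi).
  exact: (measurable_Rintegral_param mu mG).
apply/funext => x; rewrite densE Rintegral_mkcond; congr Rintegral.
apply/funext => y; rewrite /restrict indicE.
by case: ifP => _; rewrite ?mulr1 ?mulr0.
Qed.

Lemma dens_ge0 x : 0 <= dens Omega h e x.
Proof. by rewrite densE; apply: Rintegral_ge0 => y _; exact: kern_ge0. Qed.

Lemma measurable_dens_inv :
  measurable_fun setT ((fun x => (dens Omega h e x)^-1) : lebRn R n -> R).
Proof.
rewrite (_ : (fun x => _) = (fun x => dens Omega h e x `^ (- 1))); last first.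
  by apply/funext => x; rewrite powR_inv1// dens_ge0.
exact: (measurableT_comp (measurable_powR (- 1)) measurable_dens).
Qed.

Lemma measurable_markov_op f : measurable_fun setT (f \_ Omega : lebRn R n -> R) ->
  measurable_fun setT (markov_op Omega h e f : lebRn R n -> R).
Proof.
move=> mf; rewrite (funext (markov_opE f)).
have mG : measurable_fun setT (fun z : lebRn R n * lebRn R n =>
    markov_kern Omega h e z.1 z.2 * (f \_ Omega) z.2).
  apply: measurable_funM; last exact: (measurableT_comp mf).
  apply: measurable_funM; first exact: measurable_kern2.
  exact: (measurableT_comp measurable_dens_inv).
exact: (measurable_Rintegral_param mu mG).
Qed.

(** Extended-real averages against the probability density [kern h e x], so that
    Tonelli's theorem applies before any integrability is known. *)
Definition kavg (phi : 'rV[R]_n -> \bar R) x : \bar R :=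
  (\int[mu]_y ((kern h e x y)%:E * phi y))%E.

Lemma kavg_ge0 phi x : (forall y, 0 <= phi y)%E -> (0 <= kavg phi x)%E.
Proof. by move=> p0; apply: integral_ge0 => y _; rewrite mule_ge0// lee_fin kern_ge0. Qed.

Lemma markov_integral_abs (F : lebRn R n -> R) x : Omega x -> measurable_fun setT F ->
  (\int[mu]_y `|markov_kern Omega h e x y * F y|%:E <=
     (d0^-1)%:E * kavg (fun y => `|F y|%:E) x)%E.
Proof.
move=> Ox mF; have mk := measurable_kern h_decr x e0.
have mnF : measurable_fun setT (fun y : lebRn R n => `|F y|) by exact: measurableT_comp.
have dx := d0_le Ox; have dx0 : 0 < dens Omega h e x by exact: lt_le_trans dx.
have mkF : measurable_fun setT (fun y : lebRn R n => (kern h e x y)%:E * `|F y|%:E)%E.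
  by apply: emeasurable_funM; apply/measurable_EFinP.
have kF0 (y : lebRn R n) : setT y -> (0 <= (kern h e x y)%:E * `|F y|%:E)%E.
  by rewrite mule_ge0// lee_fin ?kern_ge0.
have di0 : (0 <= (d0^-1)%:E)%E by rewrite lee_fin invr_ge0 ltW.
rewrite /kavg -(ge0_integralZl mu measurableT mkF kF0 di0).
apply: ge0_le_integral.
- exact: measurableT.
- by move=> y _; rewrite lee_fin.
- apply/measurable_EFinP; apply: measurableT_comp; first exact: normr_measurable.
  apply: measurable_funM; last exact: mF.
  by apply: measurable_funM; [exact: mk|exact: measurable_cst].
- by apply: emeasurable_funM; [exact: measurable_cst|exact: mkF].
- move=> y _; rewrite -!EFinM lee_fin normrM mulrA ler_wpM2r//.
  rewrite markov_kernE normrM (ger0_norm (kern_ge0 _ _ _ _))// mulrC ler_wpM2r ?kern_ge0//.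
  by rewrite gtr0_norm ?invr_gt0// lef_pV2.
Qed.

(** Bounding the normalization by [d0] reduces the operator to averages
    against a symmetric probability kernel. *)
Lemma abs_markov_op_le f x : Omega x -> measurable_fun setT (f \_ Omega : lebRn R n -> R) ->
  (`|markov_op Omega h e f x|%:E <=
     (d0^-1)%:E * kavg (fun y => `|(f \_ Omega) y|%:E) x)%E.
Proof.
move=> Ox mf; apply: le_trans (markov_integral_abs Ox mf).
rewrite markov_opE; apply: abs_Rintegral_le; apply: measurable_funM; last exact: mf.
by apply: measurable_funM; [exact: measurable_kern|exact: measurable_cst].
Qed.

Lemma markov_definedP f x : Omega x -> measurable_fun setT (f \_ Omega : lebRn R n -> R) ->
  (kavg (fun y => `|(f \_ Omega) y|%:E) x < +oo)%E ->
  markov_defined Omega h e f x.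
Proof.
move=> Ox mf foo; rewrite /markov_defined integrable_mkcond//.
rewrite (_ : _ \_ _ = EFin \o (fun y => markov_kern Omega h e x y * (f \_ Omega) y)); last first.
  by rewrite -restrict_mul -restrict_EFin.
apply/integrableP; split.
  apply/measurable_EFinP; apply: measurable_funM; last exact: mf.
  by apply: measurable_funM; [exact: measurable_kern|exact: measurable_cst].
apply: (@le_lt_trans _ _ _ _ _ (markov_integral_abs Ox mf)).
by rewrite lte_mul_pinfty// lee_fin invr_ge0 ltW.
Qed.

(** Tonelli: the kernel is symmetric, so its mass in the first variable is
    1 as well, and averaging preserves integrals. *)
Lemma integral_kavg (phi : 'rV[R]_n -> \bar R) :
  measurable_fun setT (phi : lebRn R n -> \bar R) -> (forall y, 0 <= phi y)%E ->
  (\int[mu]_x kavg phi x = \int[mu]_y phi y)%E.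
Proof.
move=> mphi phi0; rewrite /kavg.
have mk : measurable_fun setT (fun z : lebRn R n * lebRn R n => (kern h e z.1 z.2)%:E * phi z.2)%E.
  apply: emeasurable_funM; first by apply/measurable_EFinP; exact: measurable_kern2.
  exact: (measurableT_comp mphi).
have k0 (z : lebRn R n * lebRn R n) : (0 <= (kern h e z.1 z.2)%:E * phi z.2)%E.
  by rewrite mule_ge0// lee_fin kern_ge0.
transitivity (\int[mu]_y \int[mu]_x ((kern h e x y)%:E * phi y))%E.
  exact: (leb_tonelli mk k0).
apply: eq_integral => y _ /=.
transitivity ((\int[mu]_x (kern h e y x)%:E) * phi y)%E; last first.
  by rewrite integral_kern// mul1e.
rewrite -(ge0_integralZr mu measurableT _ _ (phi0 y)).
- by apply: eq_integral => x _; rewrite (kern_sym h_decr).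
- by apply/measurable_EFinP; exact: measurable_kern.
- by move=> x _; rewrite lee_fin kern_ge0.
Qed.

Lemma measurable_kavg (phi : 'rV[R]_n -> \bar R) :
  measurable_fun setT (phi : lebRn R n -> \bar R) -> (forall y, 0 <= phi y)%E ->
  measurable_fun setT (kavg phi : lebRn R n -> \bar R).
Proof.
move=> mphi phi0.
apply: (@measurable_fun_fubini_tonelli_F _ _ _ _ _ mu
  (fun z : lebRn R n * lebRn R n => (kern h e z.1 z.2)%:E * phi z.2)%E) => //.
  apply: emeasurable_funM; first by apply/measurable_EFinP; exact: measurable_kern2.
  exact: (measurableT_comp mphi).
by move=> z; rewrite mule_ge0// lee_fin kern_ge0.
Qed.

Lemma Lp_normE (p : R) f : 0 < p ->
  Lp_norm Omega p%:E f = ((\int[mu]_x (`|(f \_ Omega) x| `^ p)%:E) `^ p^-1)%E.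
Proof. by move=> p0; rewrite /Lp_norm unlock. Qed.

Lemma abs_markov_op_powR_le (p : R) f x : 1 <= p -> Omega x ->
  measurable_fun setT (f \_ Omega : lebRn R n -> R) ->
  ((`|markov_op Omega h e f x| `^ p)%:E <=
     (d0^-1 `^ p)%:E * kavg (fun y => (`|(f \_ Omega) y| `^ p)%:E) x)%E.
Proof.
move=> p1 Ox mf; have p0 : 0 < p by exact: lt_le_trans p1.
have di0 : 0 <= d0^-1 by rewrite invr_ge0 ltW.
rewrite -poweR_EFin.
apply: (@le_trans _ _ (((d0^-1)%:E * kavg (fun y => `|(f \_ Omega) y|%:E) x) `^ p)%E).
  apply: gt0_ler_poweR; [exact: ltW| | |exact: abs_markov_op_le].
  - by rewrite in_itv/= leey andbT lee_fin.
  - by rewrite in_itv/= leey andbT mule_ge0// kavg_ge0.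
rewrite poweRM ?lee_fin ?kavg_ge0// poweR_EFin lee_wpmul2l ?lee_fin ?powR_ge0//.
have := @jensen_powR _ _ _ mu (kern h e x) (fun y => `|(f \_ Omega) y|) p p1
  (measurable_kern h_decr x e0) (measurableT_comp (@normr_measurable R setT) mf) (fun y => kern_ge0 h_ge0 x y e0)
  (fun y => normr_ge0 _) (integral_kern h_ge0 h_decr h_mass x e0).
by [].
Qed.

(** Jensen's inequality moves the power inside the average, and averages
    preserve integrals by [integral_kavg]. *)
Lemma Lp_norm_markov_op (p : R) f : 1 <= p ->
  measurable_fun setT (f \_ Omega : lebRn R n -> R) ->
  (Lp_norm Omega p%:E (markov_op Omega h e f) <= (d0^-1)%:E * Lp_norm Omega p%:E f)%E.
Proof.
move=> p1 mf; have p0 : 0 < p by exact: lt_le_trans p1.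
have mfp : measurable_fun setT (fun x : lebRn R n => (`|(f \_ Omega) x| `^ p)%:E).
  apply/measurable_EFinP; apply: (measurableT_comp (measurable_powR p)).
  exact: measurableT_comp.
have fp0 x : (0 <= (`|(f \_ Omega) x| `^ p)%:E)%E by rewrite lee_fin powR_ge0.
have di0 : 0 <= d0^-1 by rewrite invr_ge0 ltW.
have mPf : measurable_fun setT (markov_op Omega h e f \_ Omega : lebRn R n -> R).
  by apply: leb_measurable_restr; [exact: mOmega|exact: measurable_markov_op].
have mka := measurable_kavg mfp fp0.
suff H : (\int[mu]_x (`|(markov_op Omega h e f \_ Omega) x| `^ p)%:E <=
    (d0^-1 `^ p)%:E * \int[mu]_x (`|(f \_ Omega) x| `^ p)%:E)%E.
  rewrite !Lp_normE//.
  apply: (@le_trans _ _ (((d0^-1 `^ p)%:E * \int[mu]_x (`|(f \_ Omega) x| `^ p)%:E) `^ p^-1)%E).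
    apply: gt0_ler_poweR => //.
    - by rewrite invr_ge0 ltW.
    - by rewrite in_itv/= leey andbT integral_ge0// => x _; rewrite lee_fin powR_ge0.
    - by rewrite in_itv/= leey andbT mule_ge0// ?lee_fin ?powR_ge0// integral_ge0.
  rewrite poweRM ?lee_fin ?powR_ge0 ?integral_ge0//.
  by rewrite poweR_EFin -powRrM mulfV ?gt_eqF// powRr1.
rewrite -(integral_kavg mfp fp0).
have ka0 x : setT x -> (0 <= kavg (fun y => (`|(f \_ Omega) y| `^ p)%:E) x)%E.
  by move=> _; exact: kavg_ge0.
have dp0 : (0 <= (d0^-1 `^ p)%:E)%E by rewrite lee_fin powR_ge0.
rewrite -(ge0_integralZl mu measurableT mka ka0 dp0).
apply: ge0_le_integral.
- exact: measurableT.
- by move=> x _; rewrite lee_fin powR_ge0.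
- apply/measurable_EFinP; apply: (measurableT_comp (measurable_powR p)).
  by apply: measurableT_comp; [exact: normr_measurable|exact: mPf].
- by apply: emeasurable_funM; [exact: measurable_cst|exact: mka].
move=> x _; rewrite {1}/restrict; case: ifPn => [/set_mem Ox|_]; last first.
  rewrite normr0 powR0 ?gt_eqF//.
  by rewrite mule_ge0 ?lee_fin ?powR_ge0// kavg_ge0.
exact: abs_markov_op_powR_le.
Qed.

End markov_operator.

(** * Functions that are bounded up to an integrable excess *)

Section L1_plus_Linf.
Context {R : realType} {n : nat}.
Local Notation mu := (leb R n).
Implicit Types (x y z : 'rV[R]_n) (f : 'rV[R]_n -> R).

Lemma leb_aeS (P Q : 'rV[R]_n -> Prop) : (forall x, P x -> Q x) ->
  {ae mu, forall x, P x} -> {ae mu, forall x, Q x}.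
Proof. by move=> PQ; apply: negligibleS => x /= nQ Px; apply: nQ; exact: PQ. Qed.

Lemma leb_aeI (P Q : 'rV[R]_n -> Prop) :
  {ae mu, forall x, P x} -> {ae mu, forall x, Q x} -> {ae mu, forall x, P x /\ Q x}.
Proof.
move=> nP nQ; apply: negligibleS (negligibleU nP nQ) => x /= /not_andP[]; by [left|right].
Qed.

(** Members of every [Lp] are sums of a bounded and an integrable function;
    this is all that the pointwise results need. *)
Definition excess (M : R) (F : 'rV[R]_n -> R) : lebRn R n -> R :=
  fun y => Num.max (`|F y| - M) 0.

Definition L1Linf (F : 'rV[R]_n -> R) : Prop :=
  measurable_fun setT (F : lebRn R n -> R) /\
  exists2 M, 0 <= M & mu.-integrable setT (EFin \o excess M F).

Lemma excess_ge0 M F y : 0 <= excess M F y.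
Proof. by rewrite /excess le_max lexx orbT. Qed.

Lemma le_excess M F y : `|F y| <= M + excess M F y.
Proof. by rewrite /excess addr_maxr addrC subrK le_max lexx. Qed.

Lemma measurable_excess M F : measurable_fun setT (F : lebRn R n -> R) ->
  measurable_fun setT (excess M F).
Proof.
move=> mF; apply: measurable_maxr; last exact: measurable_cst.
apply: measurable_funB; last exact: measurable_cst.
by apply: measurableT_comp; [exact: normr_measurable|exact: mF].
Qed.

Lemma integrable_ae0 (g : lebRn R n -> R) : measurable_fun setT g ->
  {ae mu, forall x, g x = 0} -> mu.-integrable setT (EFin \o g).
Proof.
move=> mg g0; apply/integrableP; split; first exact/measurable_EFinP.
apply: (@le_lt_trans _ _ (\int[mu]_x cst 0%E x)%E); last by rewrite integral0 ltry.
rewrite le_eqVlt; apply/orP; left; apply/eqP.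
apply: ge0_ae_eq_integral; first exact: measurableT.
- by apply: measurableT_comp; [exact: abse_measurable|exact/measurable_EFinP].
- exact: measurable_cst.
- by move=> x _; exact: abse_ge0.
- by [].
by apply: leb_aeS g0 => x gx _; rewrite /= gx normr0.
Qed.

(** For finite [p] the level 1 works, since [t <= t ^ p] for [1 <= t]; for infinite
    [p] take the essential supremum, beyond which the excess vanishes almost
    everywhere. *)
Lemma Lp_L1Linf (Omega : set 'rV[R]_n) p f : (1 <= p)%E -> Lp Omega p f -> L1Linf (f \_ Omega).
Proof.
move=> p1 /LpP[mf nf]; split => //.
case: p p1 nf => [p| |] // p1 nf; last first.
  move: nf; rewrite /Lp_norm unlock; case: ifPn => [m0|m0 _]; last first.
    exists 0 => //; apply: integrable_ae0; first exact: measurable_excess.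
    exists setT; split => //; apply/eqP; rewrite eq_le measure_ge0 andbT leNgt.
    exact: m0.
  set S := ess_sup _ _ => Soo.
  exists (fine (maxe 0%E S)); first by rewrite fine_ge0// le_max lexx.
  apply: integrable_ae0; first exact: measurable_excess.
  apply: leb_aeS (ess_sup_ge mu (abse \o (EFin \o f \_ Omega))) => x xS.
  rewrite /excess; apply/max_idPr; rewrite subr_le0 -lee_fin fineK; last first.
    by rewrite ge0_fin_numE ?le_max ?lexx// gt_max ltry Soo.
  by apply: (le_trans xS); rewrite le_max lexx orbT.
rewrite lee_fin in p1; have p0 : 0 < p by exact: lt_le_trans p1.
exists 1 => //; apply/integrableP; split; first exact/measurable_EFinP/measurable_excess.
move: nf; rewrite Lp_normE// => /(lty_poweRy _)-/(_ _); rewrite invr_eq0 gt_eqF// => /(_ isT).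
apply: le_lt_trans; apply: ge0_le_integral; first exact: measurableT.
- by move=> x _; exact: abse_ge0.
- by apply: measurableT_comp; [exact: abse_measurable|exact/measurable_EFinP/measurable_excess].
- apply/measurable_EFinP; apply: (measurableT_comp (measurable_powR p)).
  by apply: measurableT_comp; [exact: normr_measurable|exact: mf].
move=> x _; rewrite lee_fin ger0_norm ?excess_ge0//.
rewrite ge_max powR_ge0 andbT.
have [x1|x1] := leP (`|(f \_ Omega) x|) 1.
  by rewrite (@le_trans _ _ 0)// ?powR_ge0// subr_le0.
by rewrite (@le_trans _ _ `|(f \_ Omega) x|)// ?gerBl// le1r_powR// ltW.
Qed.

Variable h : 'rV[R]_n -> R.
Hypothesis h_ge0 : forall x, 0 <= h x.
Hypothesis h_decr : forall x y, enorm x <= enorm y -> h y <= h x.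
Hypothesis h_mass : (\int[mu]_x (h x)%:E = 1)%E.
Variable e : R.
Hypothesis e0 : 0 < e.

Lemma kavg_L1Linf (F : 'rV[R]_n -> R) : L1Linf F ->
  {ae mu, forall x, (kavg h e (fun y => `|F y|%:E) x < +oo)%E}.
Proof.
move=> [mF [M M0 iF]].
have mex := measurable_excess M mF.
have ex0 y : (0 <= (excess M F y)%:E)%E by rewrite lee_fin excess_ge0.
have mexE : measurable_fun setT (fun y : lebRn R n => (excess M F y)%:E).
  exact/measurable_EFinP.
have ik : mu.-integrable setT (kavg h e (fun y => (excess M F y)%:E) : lebRn R n -> \bar R).
  apply/integrableP; split; first exact: measurable_kavg.
  rewrite (eq_integral (kavg h e (fun y => (excess M F y)%:E) : lebRn R n -> \bar R)); last first.
    by move=> x _; rewrite gee0_abs//; exact: kavg_ge0.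
  rewrite (integral_kavg h_ge0 h_decr h_mass e0 mexE ex0).
  move/integrableP : iF => [_]; congr (_ < _)%E.
  by apply: eq_integral => y _; rewrite /= ger0_norm// excess_ge0.
have := integrable_ae measurableT ik.
apply: leb_aeS => x /(_ I) kfin.
have mk := measurable_kern h_decr x e0.
apply: (@le_lt_trans _ _ (M%:E * \int[mu]_y (kern h e x y)%:E + kavg h e (fun y => (excess M F y)%:E) x)%E).
  have mkE : measurable_fun setT (fun y : lebRn R n => (kern h e x y)%:E).
    exact/measurable_EFinP.
  have k0 (y : lebRn R n) : setT y -> (0 <= (kern h e x y)%:E)%E by rewrite lee_fin kern_ge0.
  have M0' : (0 <= M%:E)%E by rewrite lee_fin.
  rewrite -(ge0_integralZl mu measurableT mkE k0 M0') -ge0_integralD; first last.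
  - by apply: emeasurable_funM; [exact: mkE|exact: mexE].
  - by move=> y _; rewrite -EFinM lee_fin mulr_ge0 ?kern_ge0 ?excess_ge0.
  - by apply: emeasurable_funM; [exact: measurable_cst|exact: mkE].
  - by move=> y _; rewrite -EFinM lee_fin mulr_ge0 ?kern_ge0.
  - exact: measurableT.
  apply: ge0_le_integral; first exact: measurableT.
  - by move=> y _; rewrite -EFinM lee_fin mulr_ge0 ?kern_ge0.
  - apply: emeasurable_funM; apply/measurable_EFinP; first exact: mk.
    by apply: measurableT_comp; [exact: normr_measurable|exact: mF].
  - apply: emeasurable_funD; apply: emeasurable_funM.
    + exact: measurable_cst.
    + exact: mkE.
    + exact: mkE.
    + exact: mexE.
  - move=> y _; rewrite -!EFinM -EFinD lee_fin [X in _ <= X + _]mulrC -mulrDr.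
    by rewrite ler_wpM2l ?kern_ge0// le_excess.
by rewrite integral_kern// mule1 lte_add_pinfty ?ltry// -ge0_fin_numE// kavg_ge0.
Qed.

End L1_plus_Linf.

(** * Uniform bounds on a thick domain *)

Section operator_on_Lp.
Context {R : realType} {n : nat}.
Local Notation mu := (leb R n).
Implicit Types (x y z : 'rV[R]_n) (f : 'rV[R]_n -> R).
Variables (Omega : set 'rV[R]_n) (h : 'rV[R]_n -> R).
Hypothesis mOmega : measurable (Omega : set (lebRn R n)).
Hypothesis h_ge0 : forall x, 0 <= h x.
Hypothesis h_decr : forall x y, enorm x <= enorm y -> h y <= h x.
Hypothesis h_mass : (\int[mu]_x (h x)%:E = 1)%E.

Lemma eball_affine (s : R) (a x : 'rV[R]_n) (r : R) : 0 < s ->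
  affine s a @^-1` eball (affine s a x) (s * r) = eball x r.
Proof.
move=> s0; apply/seteqP; split => y; rewrite /eball /= /affine opprD addrACA subrr addr0;
  by rewrite -scalerBr enormZ gtr0_norm// ltr_pM2l.
Qed.

Lemma leb_eball x r : 0 < r -> leb_outer (eball x r) = ((r ^+ n)%:E * leb_outer (eball (0 : 'rV[R]_n) 1))%E.
Proof.
move=> r0; have ri0 : 0 < r^-1 by rewrite invr_gt0.
have := @leb_outer_affine _ n r^-1 (- (r^-1 *: x)) (eball 0 1) ri0.
rewrite exprVn invrK => <-; congr leb_outer.
rewrite -(eball_affine (- (r^-1 *: x)) x r ri0).
by rewrite mulVf ?gt_eqF// /affine subrr.
Qed.

Lemma measurable_eball x r : measurable (eball x r : set (lebRn R n)).
Proof.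
rewrite (_ : eball x r = (fun y : lebRn R n => enorm (y - x)) @^-1` `]-oo, r[); last first.
  by apply/seteqP; split => y; rewrite /= in_itv.
rewrite -[X in measurable X]setTI; apply: measurable_enorm_comp; last by [].
  move=> i; under eq_fun do rewrite !mxE.
  by apply: measurable_funB; [exact: measurable_coord|exact: measurable_cst].
exact: measurableT.
Qed.

Lemma eball_cube x r : eball x r `<=` cube x r.
Proof.
move=> y yx i; apply: le_lt_trans yx.
by have := le_coord_enorm (y - x) i; rewrite !mxE.
Qed.

Lemma integrable_kern_on e x : 0 < e ->
  mu.-integrable Omega (EFin \o (kern h e x : lebRn R n -> R)).
Proof.
move=> e0; apply: (@integrableS _ _ _ mu setT) => //.
exact: integrable_kern.
Qed.

(** Thickness bounds the normalizing density from below: near its centre the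
    kernel exceeds a multiple of the indicator of a ball, and [Omega] fills a
    fixed proportion of every small ball centred in it. *)
Lemma thick_dens_ge : thick Omega -> exists eps0 d0, [/\ 0 < eps0, 0 < d0 &
  forall e x, 0 < e < eps0 -> Omega x -> d0 <= dens Omega h e x].
Proof.
move=> [_ [c [r0 [c0 r00 thk]]]].
have [r [m [rp mp hm]]] := radial_lower_bound h_ge0 h_decr h_mass.
have eps00 : 0 < r0 / r by rewrite divr_gt0.
have [[x0 Ox0]|Oempty] := pselect (Omega !=set0); last first.
  by exists (r0 / r), 1; split => // e x _ Ox; exfalso; apply: Oempty; exists x.
pose V := leb_outer (eball (0 : 'rV[R]_n) 1).
have Vfin : V \is a fin_num.
  rewrite ge0_fin_numE ?leb_outer_ge0//; apply: le_lt_trans (leb_cube_lty 0 1).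
  by apply: le_leb_outer; exact: eball_cube.
have V0 : 0 < fine V.
  rewrite lt_neqAle fine_ge0 ?leb_outer_ge0// andbT; apply/eqP => V00.
  have r02 : 0 < r0 / 2 < r0 by apply/andP; split; lra.
  have /andP[r02p _] := r02.
  have E0 : leb_outer (eball x0 (r0 / 2)) = 0%E.
    by rewrite leb_eball// -/V -(fineK Vfin) -V00 mule0.
  have := thk _ x0 r02 Ox0.
  rewrite [leb _ _ (eball _ _)]E0 mule0 ltNge -[X in (_ <= X)%E]E0 => /negP; apply.
  by apply: le_leb_outer => y [].
exists (r0 / r), (m * c * r ^+ n * fine V); split => //.
  by rewrite !mulr_gt0// exprn_gt0.
move=> e x /andP[e0 er] Ox.
rewrite ltr_pdivlMr// in er.
have er0 : 0 < e * r by rewrite mulr_gt0.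
have := thk (e * r) x; rewrite er0 er => /(_ isT Ox).
rewrite [leb _ _ (eball x _)]leb_eball// -/V -(fineK Vfin) => thk'.
rewrite densE -lee_fin (fineK (integrable_fin_num mOmega (integrable_kern_on x e0))).
have mB : measurable (eball x (e * r) `&` Omega : set (lebRn R n)).
  by apply: measurableI => //; exact: measurable_eball.
apply: (@le_trans _ _ (\int[mu]_(y in eball x (e * r) `&` Omega) (e ^- n * m)%:E)%E).
  rewrite integral_cst//.
  apply: (@le_trans _ _ ((e ^- n * m)%:E * (c%:E * ((e * r) ^+ n * fine V)%:E))%E).
    rewrite -!EFinM lee_fin exprMn le_eqVlt; apply/orP; left; apply/eqP.
    by field; rewrite gt_eqF// exprn_gt0.
  rewrite lee_wpmul2l ?lee_fin ?mulr_ge0 ?invr_ge0 ?exprn_ge0 ?(ltW e0) ?(ltW mp)//.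
  exact: ltW.
apply: (@le_trans _ _ (\int[mu]_(y in eball x (e * r) `&` Omega) (kern h e x y)%:E)%E).
  apply: ge0_le_integral.
  - exact: mB.
  - by move=> y _; rewrite lee_fin mulr_ge0 ?invr_ge0 ?exprn_ge0 ?(ltW e0) ?(ltW mp).
  - exact: measurable_cst.
  - apply/measurable_EFinP; apply: measurable_funTS; exact: measurable_kern.
  - move=> y [yx _]; rewrite lee_fin ler_wpM2l ?invr_ge0 ?exprn_ge0 ?(ltW e0)//.
    by apply: hm; rewrite enormZ gtr0_norm ?invr_gt0// ltr_pdivrMl.
apply: ge0_subset_integral.
- exact: mB.
- exact: mOmega.
- apply/measurable_EFinP; apply: measurable_funTS; exact: measurable_kern.
- by move=> y _; rewrite lee_fin kern_ge0.
- by move=> y [].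
Qed.

Lemma measurable_of_restrict f : measurable_fun setT (f \_ Omega : lebRn R n -> R) ->
  measurable_fun (Omega : set (lebRn R n)) (f : lebRn R n -> R).
Proof. by move/(measurable_restrictT _ mOmega). Qed.

Variables (e d0 : R).
Hypothesis e0 : 0 < e.
Hypothesis d00 : 0 < d0.
Hypothesis d0_le : forall x, Omega x -> d0 <= dens Omega h e x.

Lemma Lp_norm_markov_op_infty f :
  measurable_fun setT (f \_ Omega : lebRn R n -> R) ->
  (Lp_norm Omega +oo%E (markov_op Omega h e f) <= (d0^-1)%:E * Lp_norm Omega +oo%E f)%E.
Proof.
move=> mf; rewrite /Lp_norm unlock; case: ifPn => [m0|_]; last by rewrite mule0.
set S := ess_sup mu (abse \o (EFin \o f \_ Omega)).
have di0 : 0 < d0^-1 by rewrite invr_gt0.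
have S0 : (0 <= S)%E by apply: (ess_sup_gee m0); apply: aeW => x; exact: abse_ge0.
apply/ess_supP; apply: aeW => x /=; rewrite {1}/restrict; case: ifPn => [/set_mem Ox|_]; last first.
  by rewrite normr0 mule_ge0// lee_fin ltW.
apply: le_trans (abs_markov_op_le h_ge0 h_decr e0 d00 d0_le Ox mf) _.
rewrite lee_wpmul2l ?lee_fin ?(ltW di0)//.
have mk : measurable_fun setT (fun y : lebRn R n => (kern h e x y)%:E).
  by apply/measurable_EFinP; exact: measurable_kern.
have k0 (y : lebRn R n) : setT y -> (0 <= (kern h e x y)%:E)%E by rewrite lee_fin kern_ge0.
rewrite -[leRHS]mul1e -(integral_kern h_ge0 h_decr h_mass x e0).
rewrite -(ge0_integralZr mu measurableT mk k0 S0).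
apply: ae_ge0_le_integral.
- exact: measurableT.
- by move=> y _; rewrite mule_ge0// lee_fin kern_ge0.
- apply: emeasurable_funM; first exact: mk.
  apply/measurable_EFinP; apply: measurableT_comp; [exact: normr_measurable|exact: mf].
- by move=> y _; rewrite mule_ge0// lee_fin kern_ge0.
- by apply: emeasurable_funM; [exact: mk|exact: measurable_cst].
apply: leb_aeS (ess_sup_ge mu (abse \o (EFin \o f \_ Omega))) => y yS _.
by rewrite lee_wpmul2l// lee_fin kern_ge0.
Qed.

Lemma Lp_norm_markov_op_le p f : (1 <= p)%E -> Lp Omega p f ->
  (Lp_norm Omega p (markov_op Omega h e f) <= (d0^-1)%:E * Lp_norm Omega p f)%E.
Proof.
move=> p1 /LpP[mf _]; case: p p1 => [p p1| _|//].
  by apply: (Lp_norm_markov_op mOmega h_ge0 h_decr h_mass e0 d00 d0_le) => //; rewrite -lee_fin.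
exact: Lp_norm_markov_op_infty.
Qed.

Lemma measurable_markov_integrand f x : measurable_fun setT (f \_ Omega : lebRn R n -> R) ->
  measurable_fun (Omega : set (lebRn R n))
    (fun y : lebRn R n => (markov_kern Omega h e x y * f y)%:E).
Proof.
move=> mf; apply/measurable_EFinP; apply: measurable_funM; last exact: measurable_of_restrict.
apply: measurable_funTS; apply: measurable_funM; first exact: measurable_kern.
exact: measurable_cst.
Qed.

Lemma ae_markov_defined p f : (1 <= p)%E -> Lp Omega p f ->
  {ae mu, forall x, Omega x -> markov_defined Omega h e f x}.
Proof.
move=> p1 Lf; have LL := Lp_L1Linf p1 Lf; have [mf _] := LL.
apply: leb_aeS (kavg_L1Linf h_ge0 h_decr h_mass e0 LL) => x xoo Ox.
exact: (markov_definedP mOmega h_ge0 h_decr e0 d00 d0_le Ox mf).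
Qed.

Lemma markov_op_Lp p : (1 <= p)%E -> Lp_operator Omega p (markov_op Omega h e).
Proof.
move=> p1; split.
- move=> f Lf; apply/LpP; split.
    apply: leb_measurable_restr; first exact: mOmega.
    by apply: measurable_markov_op => //; case/LpP : Lf.
  apply: le_lt_trans (Lp_norm_markov_op_le p1 Lf) _.
  by rewrite lte_mul_pinfty ?lee_fin ?invr_ge0 ?(ltW d00)//; case/LpP : Lf.
- move=> f g /LpP[mf _] /LpP[mg _] fg; apply: aeW => x Ox.
  rewrite /markov_op /Rintegral; congr fine; apply: ae_eq_integral.
  + exact: mOmega.
  + exact: measurable_markov_integrand.
  + exact: measurable_markov_integrand.
  + by apply: leb_aeS fg => y fgy Oy; rewrite fgy.
- move=> a f g Lf Lg.
  have := leb_aeI (ae_markov_defined p1 Lf) (ae_markov_defined p1 Lg).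
  apply: leb_aeS => x [df dg] Ox.
  rewrite /markov_op -RintegralZl//; last exact: df.
  rewrite -RintegralD//; last 2 first.
  + rewrite (_ : _ \o _ = (fun y => a%:E * (markov_kern Omega h e x y * f y)%:E)%E); last first.
      by apply/funext => y; rewrite /= EFinM.
    by apply: integrableZl; [exact: mOmega|exact: df].
  + exact: dg.
  by apply: eq_Rintegral => y _; rewrite mulrDr mulrCA.
Qed.

End operator_on_Lp.

(** * Almost everywhere convergence *)

Section pointwise_convergence.
Context {R : realType} {n : nat}.
Local Notation mu := (leb R n).
Implicit Types (x y z : 'rV[R]_n) (f F : 'rV[R]_n -> R).
Variable delta : R.
Hypothesis delta0 : 0 < delta.
Local Notation b := (shell_ratio delta).

Lemma measurable_norm F : measurable_fun setT (F : lebRn R n -> R) ->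
  measurable_fun setT (fun y : lebRn R n => `|F y|%:E).
Proof.
move=> mF; apply/measurable_EFinP; apply: measurableT_comp; first exact: normr_measurable.
exact: mF.
Qed.

(** The bounded part contributes at most a constant to any average, the
    integrable part at most its integral divided by [s ^ n]. *)
Lemma L1Linf_avg_le F (s : R) : L1Linf F -> 0 < s -> exists2 B, 0 <= B &
  forall x r, s <= r -> ((r ^- n)%:E * \int[mu]_(y in cube x r) `|F y|%:E <= B%:E)%E.
Proof.
move=> [mF [M M0 iF]] s0; pose I := fine (\int[mu]_y (excess M F y)%:E)%E.
have I0 : 0 <= I by rewrite fine_ge0// integral_ge0// => y _; rewrite lee_fin excess_ge0.
have mex := measurable_excess M mF.
exists (2 ^+ n * M + s ^- n * I).
  by rewrite addr_ge0// mulr_ge0 ?exprn_ge0 ?invr_ge0 ?exprn_ge0// ltW.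
move=> x r sr; have r0 : 0 < r by exact: lt_le_trans sr.
have rn0 : 0 < r ^+ n by rewrite exprn_gt0.
rewrite -lee_pdivlMl ?invr_gt0// invrK -EFinM.
apply: (@le_trans _ _ (\int[mu]_(y in cube x r) (M%:E + (excess M F y)%:E))%E).
  apply: ge0_le_integral.
  - exact: measurable_cube.
  - by move=> y _; rewrite lee_fin.
  - by apply: measurable_funTS; exact: measurable_norm.
  - apply: measurable_funTS; apply: emeasurable_funD; first exact: measurable_cst.
    exact/measurable_EFinP.
  - by move=> y _; rewrite -EFinD lee_fin le_excess.
rewrite ge0_integralD; first last.
- by apply: measurable_funTS; exact/measurable_EFinP.
- by move=> y _; rewrite lee_fin excess_ge0.
- exact: measurable_cst.
- by move=> y _; rewrite lee_fin.
- exact: measurable_cube.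
rewrite integral_cst; last exact: measurable_cube.
have H1 : (M%:E * leb R n (cube x r) <= (M * (2 * r) ^+ n)%:E)%E.
  by rewrite EFinM lee_wpmul2l ?lee_fin// leb_cube_le// ltW.
have H2 : (\int[mu]_(y in cube x r) (excess M F y)%:E <= I%:E)%E.
  rewrite fineK; last exact: integrable_fin_num iF.
  apply: ge0_subset_integral.
  - exact: measurable_cube.
  - exact: measurableT.
  - exact/measurable_EFinP.
  - by move=> y _; rewrite lee_fin excess_ge0.
  - by [].
apply: le_trans (leeD H1 H2) _; rewrite -EFinD lee_fin exprMn mulrDr lerD//.
  by rewrite le_eqVlt; apply/orP; left; apply/eqP; ring.
rewrite mulrA ler_peMl// ler_pdivlMr ?exprn_gt0// mul1r.
by apply: lerXn2r; rewrite ?nnegrE// ltW.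
Qed.

Lemma L1Linf_subr F (c : R) : L1Linf F -> L1Linf (fun y => F y - c).
Proof.
move=> [mF [M M0 iF]].
have mFc : measurable_fun setT ((fun y => F y - c) : lebRn R n -> R).
  by apply: measurable_funB; [exact: mF|exact: measurable_cst].
split; first exact: mFc.
exists (M + `|c|); first by rewrite addr_ge0.
apply: le_integrable iF; [exact: measurableT|exact/measurable_EFinP/measurable_excess|].
move=> y _ /=; rewrite lee_fin !(ger0_norm (excess_ge0 _ _ _)) /excess.
have := ler_normB (F y) c.
rewrite ge_max !le_max lexx orbT andbT => h; apply/orP; left; lra.
Qed.

Lemma integral_poisson_bounded F (e : R) : L1Linf F -> 0 < e -> exists2 B, 0 <= B &
  forall x, (\int[mu]_y ((poisson delta e (y - x))%:E * `|F y|%:E) <= B%:E)%E.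
Proof.
move=> LF e0; have [B B0 HB] := L1Linf_avg_le LF e0.
exists (shell_const delta (n := n) * B).
  by rewrite mulr_ge0// ltW// shell_const_gt0.
have [mF _] := LF.
move=> x; apply: integral_poisson_le;
  [exact: delta0|exact: e0|exact: B0|exact: measurable_norm|by move=> y; rewrite lee_fin|].
move=> k; rewrite EFinM -muleA.
apply: (@le_trans _ _ (1%:E * B%:E)%E); last by rewrite mul1e.
apply: lee_pmul; first by rewrite lee_fin exprn_ge0// ltW// shell_ratio_gt0.
- rewrite mule_ge0 ?lee_fin ?invr_ge0 ?exprn_ge0 ?mulr_ge0 ?exprn_ge0 ?(ltW e0)//.
  by apply: integral_ge0 => y _; rewrite lee_fin.
- by rewrite lee_fin exprn_ile1// ltW ?shell_ratio_gt0 ?shell_ratio_lt1.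
- by apply: HB; rewrite ler_peMl ?(ltW e0)// exprn_ege1// ler1n.
Qed.

(** At a Lebesgue point the averages over small cubes are small, those over
    large cubes are bounded, and the geometric weights make the latter
    negligible once the scale is small. *)
Lemma poisson_lebesgue_point F x : L1Linf F ->
  (forall t, (0 < t)%R -> exists2 s, (0 < s)%R & forall r, (0 < r < s)%R ->
     (\int[mu]_(y in cube x r) `|F y - F x|%:E <= (t * r ^+ n)%:E)%E) ->
  forall t, 0 < t -> exists2 s, 0 < s & forall e, 0 < e < s ->
    (\int[mu]_y ((poisson delta e (y - x))%:E * `|F y - F x|%:E) <= t%:E)%E.
Proof.
move=> LF Lx t0' t0; pose K := shell_const delta (n := n).
have K0 : 0 < K by exact: shell_const_gt0.
pose t := t0' / K; have tp : 0 < t by rewrite divr_gt0.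
have [s s0 sx] := Lx t tp.
have LG := L1Linf_subr (F x) LF; have [mG _] := LG.
have [B B0 HB] := L1Linf_avg_le LG s0.
have b0 := shell_ratio_gt0 delta; have b1 := shell_ratio_lt1 delta0.
have [m mB] : exists m : nat, b ^+ m * B <= t.
  have /cvgrPdist_lt /(_ t tp)[m _ /(_ m (leqnn m))] :
      (fun m => b ^+ m * B) @ \oo --> 0.
    rewrite -(mul0r B); apply: cvgM; last exact: cvg_cst.
    by apply: cvg_expr; rewrite ger0_norm// ltW.
  rewrite sub0r normrN ger0_norm ?mulr_ge0 ?exprn_ge0 ?(ltW b0)// => mt.
  by exists m; exact: ltW.
exists (s / 2 ^+ m); first by rewrite divr_gt0// exprn_gt0.
move=> e /andP[e0]; rewrite ltr_pdivlMr ?exprn_gt0// => es.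
rewrite [X in (_ <= X%:E)%E](_ : t0' = K * t); last by rewrite /t mulrC divfK// gt_eqF.
apply: integral_poisson_le;
  [exact: delta0|exact: e0|exact: ltW|exact: measurable_norm|by move=> y; rewrite lee_fin|].
move=> k; set r := 2 ^+ k * e; have r0 : 0 < r by rewrite mulr_gt0// exprn_gt0.
rewrite EFinM -muleA.
have bk0 : 0 <= b ^+ k by rewrite exprn_ge0// ltW.
have J0 : (0 <= (r ^- n)%:E * \int[mu]_(y in cube x r) `|F y - F x|%:E)%E.
  rewrite mule_ge0 ?lee_fin ?invr_ge0 ?exprn_ge0 ?(ltW r0)//.
  by apply: integral_ge0 => y _; rewrite lee_fin.
have [rs|sr] := ltP r s.
  apply: (@le_trans _ _ (1%:E * t%:E)%E); last by rewrite mul1e.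
  apply: lee_pmul; [by []|by []|by rewrite lee_fin exprn_ile1// ltW|].
  by rewrite lee_pdivrMl ?exprn_gt0// -EFinM mulrC; apply: sx; rewrite r0.
apply: (@le_trans _ _ ((b ^+ k)%:E * B%:E)%E).
  by apply: lee_wpmul2l => //; exact: HB.
rewrite -EFinM lee_fin (le_trans _ mB)// ler_wpM2r//.
have mk : (m <= k)%N.
  rewrite leqNgt; apply/negP => km.
  have : r < s.
    apply: le_lt_trans es; rewrite /r mulrC ler_pM2l// ler_weXn2l// ?ler1n//.
    exact: ltnW.
  by rewrite ltNge sr.
by rewrite ler_wiXn2l// ltW.
Qed.

End pointwise_convergence.

Section decaying_kernel.
Context {R : realType} {n : nat}.
Local Notation mu := (leb R n).
Implicit Types (x y z : 'rV[R]_n) (f F : 'rV[R]_n -> R).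
Variables (Omega : set 'rV[R]_n) (h : 'rV[R]_n -> R).
Hypothesis mOmega : measurable (Omega : set (lebRn R n)).
Hypothesis h_ge0 : forall x, 0 <= h x.
Hypothesis h_decr : forall x y, enorm x <= enorm y -> h y <= h x.
Hypothesis h_mass : (\int[mu]_x (h x)%:E = 1)%E.
Variables (C delta : R).
Hypothesis C0 : 0 < C.
Hypothesis delta0 : 0 < delta.
Hypothesis h_decay : forall x, `|h x| <= C * (1 + enorm x) `^ (- (n%:R + delta)).

Lemma kern_le_poisson e x y : 0 < e -> kern h e x y <= C * poisson delta e (y - x).
Proof.
move=> e0; rewrite /kern /hscale /poisson mulrCA ler_wpM2l ?invr_ge0 ?exprn_ge0 ?(ltW e0)//.
exact: le_trans (ler_norm _) (h_decay _).
Qed.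

Lemma measurable_poisson_sub e x : 0 < e ->
  measurable_fun setT (fun y : lebRn R n => (poisson delta e (y - x))%:E).
Proof.
move=> e0; apply/measurable_EFinP; apply: measurable_poisson; [exact: delta0|exact: e0|].
move=> i; under eq_fun do rewrite !mxE.
by apply: measurable_funB; [exact: measurable_coord|exact: measurable_cst].
Qed.

Lemma kavg_le_poisson e x F : 0 < e -> measurable_fun setT (F : lebRn R n -> R) ->
  (kavg h e (fun y => `|F y|%:E) x <=
    C%:E * \int[mu]_y ((poisson delta e (y - x))%:E * `|F y|%:E))%E.
Proof.
move=> e0 mF; have mk := measurable_kern h_decr x e0.
have mp := measurable_poisson_sub x e0; have mn := measurable_norm mF.
have pF0 (y : lebRn R n) : setT y -> (0 <= (poisson delta e (y - x))%:E * `|F y|%:E)%E.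
  by move=> _; rewrite mule_ge0// lee_fin poisson_ge0.
have mpF : measurable_fun setT (fun y : lebRn R n => (poisson delta e (y - x))%:E * `|F y|%:E)%E.
  by apply: emeasurable_funM; [exact: mp|exact: mn].
have C0' : (0 <= C%:E)%E by rewrite lee_fin ltW.
rewrite -(ge0_integralZl mu measurableT mpF pF0 C0').
apply: ge0_le_integral.
- exact: measurableT.
- by move=> y _; rewrite -EFinM lee_fin mulr_ge0// kern_ge0.
- by apply: emeasurable_funM; [exact/measurable_EFinP|exact: mn].
- by apply: emeasurable_funM; [exact: measurable_cst|exact: mpF].
- by move=> y _; rewrite -!EFinM lee_fin mulrA ler_wpM2r// kern_le_poisson.
Qed.

Lemma kavg_bounded F e : L1Linf F -> 0 < e -> exists2 B, 0 <= B &
  forall x, (kavg h e (fun y => `|F y|%:E) x <= B%:E)%E.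
Proof.
move=> LF e0; have [B B0 HB] := integral_poisson_bounded delta0 LF e0.
exists (C * B); first by rewrite mulr_ge0// ltW.
move=> x; have [mF _] := LF; apply: le_trans (kavg_le_poisson x e0 mF) _.
by rewrite EFinM lee_wpmul2l// lee_fin ltW.
Qed.

Lemma L1Linf_locally_integrable F (k : nat) : L1Linf F ->
  mu.-integrable (cube 0 k%:R) (EFin \o (F : lebRn R n -> R)).
Proof.
move=> [mF [M M0 iF]].
have mc : measurable (cube 0 k%:R : set (lebRn R n)) by exact: measurable_cube.
apply: (@le_integrable _ _ _ mu _ mc _
  ((EFin \o (cst M : lebRn R n -> R)) \+ (EFin \o excess M F))%E).
- by apply/measurable_EFinP; apply: measurable_funTS; exact: mF.
- move=> y _; rewrite lee_fin; apply: (le_trans (le_excess M F y)); exact: ler_norm.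
- apply: integrableD; [exact: mc|exact: integrable_cst_cube|].
  by apply: integrableS iF; [exact: measurableT|exact: mc|].
Qed.

Variables (eps0 d0 : R).
Hypothesis eps00 : 0 < eps0.
Hypothesis d00 : 0 < d0.
Hypothesis d0_le : forall e x, 0 < e < eps0 -> Omega x -> d0 <= dens Omega h e x.

Lemma markov_defined_decay f e x : L1Linf (f \_ Omega) -> 0 < e < eps0 -> Omega x ->
  markov_defined Omega h e f x.
Proof.
move=> LF /andP[e0 ee0] Ox; have [B B0 HB] := kavg_bounded LF e0.
have [mF _] := LF.
apply: (markov_definedP mOmega h_ge0 h_decr e0 d00 _ Ox mF).
  by move=> y; apply: d0_le; rewrite e0.
by apply: le_lt_trans (HB x) _; rewrite ltry.
Qed.

Lemma markov_op_bounded f e : L1Linf (f \_ Omega) -> 0 < e < eps0 ->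
  exists B, forall x, Omega x -> `|markov_op Omega h e f x| <= B.
Proof.
move=> LF /andP[e0 ee0]; have [B B0 HB] := kavg_bounded LF e0.
have [mF _] := LF; exists (d0^-1 * B) => x Ox; rewrite -lee_fin.
apply: le_trans (abs_markov_op_le h_ge0 h_decr e0 d00 _ Ox mF) _.
  by move=> y; apply: d0_le; rewrite e0.
by rewrite EFinM lee_wpmul2l ?lee_fin ?invr_ge0// ltW.
Qed.

(** The operator reproduces constants, so its error at a point is the average of
    the deviation from the value there. *)
Lemma markov_op_dist f e x : L1Linf (f \_ Omega) -> 0 < e < eps0 -> Omega x ->
  (`|markov_op Omega h e f x - f x|%:E <=
    (d0^-1 * C)%:E * \int[mu]_y ((poisson delta e (y - x))%:E *
       `|(f \_ Omega) y - (f \_ Omega) x|%:E))%E.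
Proof.
move=> LF e0e Ox; have /andP[e0 _] := e0e; have [mF _] := LF.
have Fx : (f \_ Omega) x = f x by rewrite /restrict mem_set.
have dx0 : 0 < dens Omega h e x by exact: lt_le_trans (d0_le e0e Ox).
have df := markov_defined_decay LF e0e Ox.
have ik := integrable_kern_on mOmega h_ge0 h_decr h_mass x e0.
have -> : markov_op Omega h e f x - f x = markov_op Omega h e (fun y => f y - f x) x.
  have imk : mu.-integrable Omega (EFin \o (fun y : lebRn R n => f x * markov_kern Omega h e x y)).
    rewrite (_ : _ \o _ = (fun y => (f x / dens Omega h e x)%:E * (EFin \o kern h e x) y)%E).
      by apply: integrableZl; [exact: mOmega|exact: ik].
    by apply/funext => y /=; rewrite -EFinM; congr EFin; rewrite /markov_kern; ring.
  transitivity (\int[mu]_(y in Omega)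
      (markov_kern Omega h e x y * f y - f x * markov_kern Omega h e x y)).
    rewrite RintegralB; [|exact: mOmega|exact: df|exact: imk].
    congr (_ - _).
    rewrite (_ : (fun y => _) = (fun y => f x / dens Omega h e x * kern h e x y)).
      rewrite RintegralZl; [|exact: mOmega|exact: ik].
      by rewrite -mulrA -/(dens Omega h e x) mulVf ?mulr1// gt_eqF.
    by apply/funext => y; rewrite /markov_kern; ring.
  by apply: eq_Rintegral => y _; ring.
have mg : measurable_fun setT ((fun y => f y - f x) \_ Omega : lebRn R n -> R).
  rewrite (_ : _ \_ _ = (fun y => (f \_ Omega) y - f x) \_ Omega).
    apply: leb_measurable_restr; first exact: mOmega.
    by apply: measurable_funB; [exact: mF|exact: measurable_cst].
  by apply/funext => y; rewrite /restrict; case: ifP.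
apply: le_trans (abs_markov_op_le h_ge0 h_decr e0 d00 _ Ox mg) _.
  by move=> y; exact: d0_le.
rewrite EFinM -muleA lee_wpmul2l ?lee_fin ?invr_ge0 ?(ltW d00)//.
have mG : measurable_fun setT ((fun y => (f \_ Omega) y - (f \_ Omega) x) : lebRn R n -> R).
  by apply: measurable_funB; [exact: mF|exact: measurable_cst].
apply: le_trans (kavg_le_poisson x e0 mG).
have mk := measurable_kern h_decr x e0.
apply: ge0_le_integral.
- exact: measurableT.
- by move=> y _; rewrite -EFinM lee_fin mulr_ge0// kern_ge0.
- by apply: emeasurable_funM; [exact/measurable_EFinP|exact: measurable_norm].
- by apply: emeasurable_funM; [exact/measurable_EFinP|exact: measurable_norm].
- move=> y _; rewrite lee_wpmul2l ?lee_fin ?kern_ge0//.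
  by rewrite Fx /restrict; case: ifP => _; rewrite ?normr0.
Qed.

Lemma ae_markov_op_cvg f : L1Linf (f \_ Omega) ->
  {ae mu, forall x, Omega x -> markov_op Omega h eps f x @[eps --> 0^'+] --> f x}.
Proof.
move=> LF; have [mF _] := LF.
have := lebesgue_points mF (fun k => L1Linf_locally_integrable k LF).
apply: leb_aeS => x Lx Ox; apply/cvgrPdist_le => t t0.
have t'0 : 0 < t / (d0^-1 * C) by rewrite divr_gt0// mulr_gt0// invr_gt0.
have [s s0 Hs] := poisson_lebesgue_point delta0 LF Lx t'0.
near=> e.
have e0 : 0 < e by near: e; exact: nbhs_right_gt.
have es : e < s by near: e; exact: nbhs_right_lt.
have ee0 : e < eps0 by near: e; exact: nbhs_right_lt.
rewrite distrC -lee_fin; apply: le_trans (markov_op_dist LF _ Ox) _; first by rewrite e0.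
have := Hs e; rewrite e0 es => /(_ isT).
have dC0 : (0 <= (d0^-1 * C)%:E)%E by rewrite lee_fin mulr_ge0 ?invr_ge0// ltW.
move=> /(lee_wpmul2l dC0) /le_trans; apply.
by rewrite -EFinM lee_fin mulrC divfK// gt_eqF// mulr_gt0// invr_gt0.
Unshelve. all: by end_near. Qed.

End decaying_kernel.

(** * Continuity of integrals and of radial functions *)

Section continuity_tools.
Context {R : realType} {n : nat}.
Local Notation mu := (leb R n).
Implicit Types (x y z u : 'rV[R]_n).

Lemma cube_nbhs x r : 0 < r -> nbhs x (cube x r).
Proof. by move=> r0; rewrite cube_ball//; exact: nbhsx_ballx. Qed.

Lemma near_cube (P : 'rV[R]_n -> Prop) x r : 0 < r -> (forall y, cube x r y -> P y) ->
  \forall y \near x, P y.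
Proof.
by move=> r0 HP; apply: (@filterS _ _ (nbhs_filter x) (cube x r)) => //; exact: cube_nbhs.
Qed.

(** The topology has countable bases of cubes, so that dominated convergence for
    sequences applies to limits in [x]. *)
Lemma cvg_cube_seq (f : 'rV[R]_n -> R) x l :
  (forall u : nat -> 'rV[R]_n, (forall k, cube x k.+1%:R^-1 (u k)) ->
     f (u k) @[k --> \oo] --> (l : R)) ->
  f y @[y --> x] --> (l : R).
Proof.
move=> H; have FF := nbhs_filter x.
apply/cvgrPdist_lt => e e0; apply: contrapT => Hn.
have /choice[u Hu] : forall k : nat, exists y, cube x k.+1%:R^-1 y /\ e <= `|l - f y|.
  move=> k; apply: contrapT => /forallNP Hk; apply: Hn.
  apply: (@near_cube _ x k.+1%:R^-1); first by rewrite invr_gt0.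
  by move=> y yx; have := Hk y => /not_andP[//|/negP]; rewrite -ltNge.
have /cvgrPdist_lt/(_ e e0)[N _ /(_ N (leqnn N))] := H u (fun k => (Hu k).1).
by rewrite ltNge (Hu N).2.
Qed.

Lemma cube_seq_cvg x (u : nat -> 'rV[R]_n) : (forall k, cube x k.+1%:R^-1 (u k)) ->
  u k @[k --> \oo] --> x.
Proof.
move=> ux; apply/cvg_ballP => r r0.
have [k kr] := ltr_add_invr r0; rewrite add0r in kr.
exists k => // j /= kj; rewrite -cube_ball//.
apply: (@cubeS _ _ _ j.+1%:R^-1) => //; apply: le_trans (ltW kr).
by rewrite lef_pV2 ?posrE// ler_nat ltnS.
Qed.

Lemma continuous_integral (G : 'rV[R]_n -> lebRn R n -> R) (H : lebRn R n -> R) x s :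
  0 < s -> (forall u, measurable_fun setT (G u)) ->
  mu.-integrable setT (EFin \o H) ->
  (forall u y, cube x s u -> `|G u y| <= H y) ->
  {ae mu, forall y, G u y @[u --> x] --> G x y} ->
  \int[mu]_y G u y @[u --> x] --> \int[mu]_y G x y.
Proof.
move=> s0 mG iH GH aeG; apply: cvg_cube_seq => u ux.
have [k0 k0s] := ltr_add_invr s0; rewrite add0r in k0s.
have us j : cube x s (u (j + k0)%N).
  apply: (@cubeS _ _ _ (j + k0).+1%:R^-1); last exact: ux.
  by apply: le_trans (ltW k0s); rewrite lef_pV2 ?posrE// ler_nat ltnS leq_addl.
rewrite -(cvg_shiftn k0).
have mGE v : measurable_fun setT (EFin \o G v) by exact/measurable_EFinP.
have aeG' : {ae mu, forall y, setT y -> (EFin \o G (u (j + k0)%N)) y @[j --> \oo] --> (EFin \o G x) y}.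
  apply: leb_aeS aeG => y Gy _; apply: cvg_EFin; first exact: nearW.
  have : (G (u k) y) @[k --> \oo] --> G x y.
    by apply: (cvg_comp _ _ (cube_seq_cvg ux) Gy).
  by rewrite -(cvg_shiftn k0).
have aeH : {ae mu, forall y j, setT y -> (`|(EFin \o G (u (j + k0)%N)) y| <= (EFin \o H) y)%E}.
  by apply: aeW => y j _; rewrite lee_fin GH.
have [iG _ cvgG] := dominated_convergence measurableT (fun j => mGE _) (mGE x) aeG' iH aeH.
apply: fine_cvg; rewrite fineK; last exact: integrable_fin_num iG.
exact: cvgG.
Qed.

Lemma enorm_continuous : continuous (@enorm R n).
Proof.
have C (s : seq 'I_n) : continuous (fun z : 'rV[R]_n => \sum_(i <- s) z 0 i ^+ 2 : R).
  elim: s => [|i s IH] z; first by under eq_fun do rewrite big_nil; exact: cst_continuous.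
  have ci : {for z, continuous (fun z : 'rV[R]_n => z 0 i ^+ 2 : R)}.
    by apply: (@continuous_comp _ _ _ (fun z : 'rV[R]_n => z 0 i) (fun t : R => t ^+ 2));
      [exact: coord_continuous|exact: exprn_continuous].
  rewrite (_ : (fun z => _) = (fun z : 'rV[R]_n => z 0 i ^+ 2 + \sum_(j <- s) z 0 j ^+ 2 : R)).
    exact: (continuousD ci (IH z)).
  by apply/funext => y; rewrite big_cons.
move=> x; apply: (@continuous_comp _ _ _ (fun z => \sum_(i < n) z 0 i ^+ 2) (@Num.sqrt R)).
  exact: C.
exact: sqrt_continuous.
Qed.

Lemma enorm_eq0 x : enorm x = 0 -> x = 0.
Proof.
by move=> x0; apply/rowP => i; rewrite mxE; apply/normr0_eq0/eqP;
  rewrite eq_le normr_ge0 andbT -x0 le_coord_enorm.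
Qed.

(** A quasi-triangle inequality is enough for comparing kernels. *)
Lemma enormD_le x y : enorm (x + y) <= 2 * (enorm x + enorm y).
Proof.
rewrite -(ler_pXn2r (n := 2)) ?nnegrE ?mulr_ge0 ?addr_ge0 ?enorm_ge0//.
rewrite sqr_sqrtr; last by apply: sumr_ge0 => i _; exact: sqr_ge0.
have sx : enorm x ^+ 2 = \sum_(i < n) x 0 i ^+ 2.
  by rewrite sqr_sqrtr//; apply: sumr_ge0 => i _; exact: sqr_ge0.
have sy : enorm y ^+ 2 = \sum_(i < n) y 0 i ^+ 2.
  by rewrite sqr_sqrtr//; apply: sumr_ge0 => i _; exact: sqr_ge0.
apply: (@le_trans _ _ (2 * (enorm x ^+ 2 + enorm y ^+ 2))).
  rewrite sx sy -big_split mulr_sumr /=; apply: ler_sum => i _; rewrite mxE.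
  by have := sqr_ge0 (x 0 i - y 0 i); nra.
by have := enorm_ge0 x; have := enorm_ge0 y; nra.
Qed.

End continuity_tools.

(** Markov's inequality bounds the measure of the set on which every [D j]
    exceeds a given level by any of the integrals. *)
Lemma ae_inf_small d (T : measurableType d) (R : realType) (m : {measure set T -> \bar R})
    (D : nat -> T -> R) : (forall j x, 0 <= D j x) ->
  (forall j, measurable_fun setT (fun x => (D j x)%:E)) ->
  (\int[m]_x (D j x)%:E)%E @[j --> \oo] --> 0%E ->
  {ae m, forall x, forall t, 0 < t -> exists j, D j x <= t}.
Proof.
move=> D0 mD D_0.
pose E (l : nat) : set T := \bigcap_j [set x | l.+1%:R^-1 <= D j x].
have mE l : measurable (E l).
  apply: bigcapT_measurable => j.
  rewrite (_ : mkset _ = D j @^-1` `[l.+1%:R^-1, +oo[); last first.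
    by apply/seteqP; split => x /=; rewrite in_itv/= andbT.
  rewrite -[X in measurable X]setTI; have /measurable_EFinP mDj := mD j.
  by apply: mDj; [exact: measurableT|exact: measurable_itv].
apply: (@negligibleS _ _ _ m (\bigcup_l E l)).
  move=> x /= /existsNP[t /not_implyP[t0 /forallNP Ht]].
  have [l lt] := ltr_add_invr t0; rewrite add0r in lt.
  exists l => // j _ /=; rewrite (le_trans (ltW lt))//.
  by have /negP := Ht j; rewrite -ltNge => /ltW.
apply: negligible_bigcup => l; apply/negligibleP => //.
have l0 : 0 < l.+1%:R^-1 :> R by rewrite invr_gt0.
have El j : (l.+1%:R^-1%:E * m (E l) <= \int[m]_x (D j x)%:E)%E.
  rewrite -integral_cst//; apply: (@le_trans _ _ (\int[m]_(x in E l) (D j x)%:E)%E).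
    apply: ge0_le_integral.
    - exact: mE.
    - by move=> x _; rewrite lee_fin ltW.
    - exact: measurable_cst.
    - exact: measurable_funTS.
    - by move=> x Ex; rewrite lee_fin; exact: Ex.
  apply: ge0_subset_integral => //.
  by move=> x _; rewrite lee_fin.
have : (l.+1%:R^-1%:E * m (E l) <= 0)%E.
  rewrite -(cvg_lim _ D_0)//; apply: lime_ge; first by apply/cvg_ex; eexists; exact: D_0.
  exact: nearW.
by rewrite pmule_rle0// measure_le0 => /eqP.
Qed.

Section radial_continuity.
Context {R : realType} {n : nat}.
Local Notation mu := (leb R n).
Implicit Types (x y z u : 'rV[R]_n).
Variable k : 'rV[R]_n -> R.
Hypothesis k_ge0 : forall x, 0 <= k x.
Hypothesis k_decr : forall x y, enorm x <= enorm y -> k y <= k x.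
Hypothesis k_mass : (\int[mu]_x (k x)%:E = 1)%E.

Let c (j : nat) : R := j.+2%:R^-1.

Let D (j : nat) z := k ((1 - c j) *: z) - k ((1 + c j) *: z).

Let j2 (j : nat) : 0 < c j < 1.
Proof. by rewrite /c invr_gt0 ltr0n invf_lt1 ?ltr0n// ltr1n. Qed.

Let integral_dilate (s : R) : 0 < s -> (\int[mu]_z (k (s *: z))%:E = (s ^- n)%:E)%E.
Proof.
move=> s0; have := @ge0_integral_affine R n s 0 (fun z => (k z)%:E) s0.
rewrite k_mass mule1 => <-.
- by apply: eq_integral => z _; rewrite /affine addr0.
- by apply/measurable_EFinP; exact: measurable_h.
- by move=> z; rewrite lee_fin.
Qed.

Let integrable_dilate (s : R) : 0 < s -> mu.-integrable setT (fun z => (k (s *: z))%:E).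
Proof.
move=> s0; apply/integrableP; split.
  apply/measurable_EFinP; apply: (measurable_radial k_decr) => i.
  under eq_fun do rewrite mxE.
  by apply: measurable_funM; [exact: measurable_cst|exact: measurable_coord].
rewrite (eq_integral (fun z : lebRn R n => (k (s *: z))%:E)); last by move=> z _; rewrite gee0_abs ?lee_fin.
by rewrite integral_dilate// ltry.
Qed.

(** A radially decreasing integrable function is continuous almost
    everywhere: its oscillation at [z] is bounded by the difference of two
    dilates, whose integral tends to 0 with the dilation. *)
Lemma radial_ae_continuous : {ae mu, forall z, {for z, continuous k}}.
Proof.
have D0 j z : 0 <= D j z.
  rewrite subr_ge0; apply: k_decr; rewrite !enormZ; have /andP[h1 h2] := j2 j.
  by rewrite ler_wpM2r ?enorm_ge0// !ger0_norm; lra.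
have mD j : measurable_fun setT (fun z : lebRn R n => (D j z)%:E).
  have /andP[h1 h2] := j2 j.
  have p1 : 0 < 1 - c j :> R by lra.
  have p2 : 0 < 1 + c j :> R by lra.
  have := measurable_int mu (integrable_dilate p1) => /measurable_EFinP m1.
  have := measurable_int mu (integrable_dilate p2) => /measurable_EFinP m2.
  by apply/measurable_EFinP; exact: measurable_funB.
have intD j : (\int[mu]_z (D j z)%:E = ((1 - c j) ^- n - (1 + c j) ^- n)%:E)%E.
  have /andP[h1 h2] := j2 j.
  have p1 : 0 < 1 - c j :> R by lra.
  have p2 : 0 < 1 + c j :> R by lra.
  rewrite [RHS]EFinB -(integral_dilate p1) -(integral_dilate p2).
  rewrite -integralB; [|exact: measurableT|exact: integrable_dilate..].
  by apply: eq_integral => z _; rewrite EFinB.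
have j0 : c @ \oo --> 0.
  by rewrite -[X in X @ _ --> _]/(fun j => harmonic j.+1) cvg_shiftS; exact: cvg_harmonic.
have cvg_pow (s : R) : ((1 + s * c j) ^- n) @[j --> \oo] --> (1 : R).
  have h1 : (1 + s * c j) @[j --> \oo] --> (1 + s * 0 : R).
    by apply: cvgD; [exact: cvg_cst|apply: cvgM; [exact: cvg_cst|exact: j0]].
  rewrite mulr0 addr0 in h1.
  have h2 : ((1 + s * c j) ^+ n) @[j --> \oo] --> (1 ^+ n : R).
    exact: (cvg_comp _ _ h1 (@exprn_continuous R n 1)).
  rewrite expr1n in h2; have := cvgV (oner_neq0 R) h2; rewrite invr1; exact.
have intD0 : (\int[mu]_z (D j z)%:E)%E @[j --> \oo] --> 0%E.
  under eq_fun do rewrite intD.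
  apply: cvg_EFin; first exact: nearW.
  rewrite -(subrr 1); apply: cvgB.
    by have := cvg_pow (-1); under eq_fun do rewrite mulN1r.
  by have := cvg_pow 1; under eq_fun do rewrite mul1r.
have := @ae_inf_small _ (lebRn R n) R mu D D0 mD intD0.
have ae0 : {ae mu, forall z, n = 0%N \/ z != 0}.
  case: (posnP n) => [n0|n0]; first by apply: aeW => z; left.
  apply: leb_null_negligible; apply/eqP; rewrite eq_le leb_outer_ge0 andbT.
  apply/lee_addgt0Pr => t t0; rewrite add0e.
  pose r : R := Num.min (t / 2) (1 / 2).
  have r0 : 0 < r by rewrite lt_min !divr_gt0.
  apply: (@le_trans _ _ (leb R n (cube 0 r))).
    apply: le_leb_outer => z /= /not_orP[_ /negP]; rewrite negbK => /eqP -> i.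
    by rewrite subrr normr0.
  apply: le_trans (leb_cube_le _ (ltW r0)) _; rewrite lee_fin.
  have [rt r1] : r <= t / 2 /\ r <= 1 / 2 by split; rewrite ge_min lexx ?orbT.
  rewrite -[n]prednK// exprS (@le_trans _ _ (2 * r))//; last lra.
  by rewrite ler_piMr ?mulr_ge0 ?(ltW r0)// exprn_ile1 ?mulr_ge0 ?(ltW r0)//; lra.
move/(leb_aeI ae0); apply: leb_aeS => z [z0 Hz]; have FF := nbhs_filter z; case: z0 => z0;
  apply/cvgrPdist_le => t t0.
  apply: (@near_cube _ _ _ z 1) => // y _; suff -> : y = z by rewrite subrr normr0 ltW.
  by apply/rowP => i; have := ltn_ord i; rewrite [X in (_ < X)%N]z0.
have [j Djt] := Hz t t0.
have /andP[h1 h2] := j2 j.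
have ez : 0 < enorm z.
  by rewrite lt_neqAle enorm_ge0 andbT eq_sym; apply: contra_neq z0; exact: enorm_eq0.
have := @enorm_continuous R n z => /cvgrPdist_lt /(_ (c j * enorm z)).
rewrite mulr_gt0// => /(_ isT); apply: (@filterS _ _ (nbhs_filter z)) => y /=.
rewrite ltr_norml => /andP[yl yr].
have e1 : k y <= k ((1 - c j) *: z).
  by apply: k_decr; rewrite enormZ ger0_norm; lra.
have e2 : k ((1 + c j) *: z) <= k y.
  by apply: k_decr; rewrite enormZ ger0_norm; lra.
have e3 : k z <= k ((1 - c j) *: z).
  by apply: k_decr; rewrite enormZ ger0_norm; nra.
have e4 : k ((1 + c j) *: z) <= k z.
  by apply: k_decr; rewrite enormZ ger0_norm; nra.
by rewrite ler_norml; move: Djt; rewrite /D => ?; apply/andP; split; lra.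
Qed.

End radial_continuity.

(** * Continuity of the averages *)

Section averaged_functions.
Context {R : realType} {n : nat}.
Local Notation mu := (leb R n).
Implicit Types (x y z u : 'rV[R]_n) (f F : 'rV[R]_n -> R).
Variables (Omega : set 'rV[R]_n) (h : 'rV[R]_n -> R).
Hypothesis oOmega : open Omega.
Hypothesis h_ge0 : forall x, 0 <= h x.
Hypothesis h_decr : forall x y, enorm x <= enorm y -> h y <= h x.
Hypothesis h_mass : (\int[mu]_x (h x)%:E = 1)%E.
Variables (C delta : R).
Hypothesis C0 : 0 < C.
Hypothesis delta0 : 0 < delta.
Hypothesis h_decay : forall x, `|h x| <= C * (1 + enorm x) `^ (- (n%:R + delta)).

Let mOmega : measurable (Omega : set (lebRn R n)).
Proof. exact: open_leb_measurable. Qed.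

Lemma nbhs_cube x (A : set 'rV[R]_n) : nbhs x A -> exists2 s, 0 < s & cube x s `<=` A.
Proof. by move/nbhs_ballP => -[s /= s0 sA]; exists s => //; rewrite cube_ball. Qed.

Lemma ae_translate (P : 'rV[R]_n -> Prop) x :
  {ae mu, forall z, P z} -> {ae mu, forall y, P (y - x)}.
Proof.
move=> [A [mA A0 PA]].
have E y : affine 1 (- x) y = y - x by rewrite /affine scale1r.
exists (affine 1 (- x) @^-1` A); split.
- by rewrite -[X in measurable X]setTI; exact: (measurable_affine (- x) ltr01).
- by rewrite /leb leb_outer_affine// [X in (_ * X)%E]A0 mule0.
- by move=> y /= nP; rewrite /preimage /= E; exact: PA.
Qed.

Lemma kern_ae_continuous e x : 0 < e ->
  {ae mu, forall y, kern h e u y @[u --> x] --> kern h e x y}.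
Proof.
move=> e0.
have m1 : (\int[mu]_z (hscale h e z)%:E = 1)%E.
  rewrite -(integral_kern h_ge0 h_decr h_mass 0 e0).
  by apply: eq_integral => z _; rewrite /kern subr0.
have := radial_ae_continuous (fun z => hscale_ge0 h_ge0 z e0) (hscale_decr h_decr e0) m1.
move/(ae_translate x); apply: leb_aeS => y cy.
apply: (@continuous_comp _ _ _ (fun u : 'rV[R]_n => y - u) (hscale h e) x); last exact: cy.
have FF := nbhs_filter x.
by apply: cvgB; [exact: cvg_cst|exact: cvg_id].
Qed.

(** Moving the centre by less than half the scale changes [1 + |y - x| / e] by at
    most a factor 2. This gives the majorant for continuity in the centre. *)
Lemma poisson_shift e x u y : 0 < e -> enorm (u - x) <= e / 2 ->
  poisson delta e (y - u) <= 2 `^ (n%:R + delta) * poisson delta e (y - x).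
Proof.
move=> e0 ux; rewrite /poisson mulrCA ler_pM2l ?invr_gt0 ?exprn_gt0//.
set v := e^-1 *: (y - u); set w := e^-1 *: (y - x).
have nd0 : 0 <= n%:R + delta by rewrite addr_ge0// ltW.
have vw : 1 + enorm w <= 2 * (1 + enorm v).
  have N : enorm (e^-1 *: (u - x)) <= 1 / 2.
    rewrite enormZ gtr0_norm ?invr_gt0// ler_pdivrMl//.
    by apply: (le_trans ux); rewrite mul1r.
  have W : w = v + e^-1 *: (u - x).
    by rewrite /v /w -scalerDr addrACA (addrC (- u)) addrACA subrr addr0 addrC.
  have := enormD_le v (e^-1 *: (u - x)); rewrite -W.
  move: N; clearbody v w; lra.
have v0 : 0 < 1 + enorm v by rewrite ltr_pwDl// enorm_ge0.
have w0 : 0 < 1 + enorm w by rewrite ltr_pwDl// enorm_ge0.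
rewrite !powRN -[X in X^-1 <= _](mulKf (x := 2 `^ (n%:R + delta))); last by rewrite gt_eqF// powR_gt0.
rewrite invfM invrK ler_pM2l ?powR_gt0// lef_pV2 ?posrE ?mulr_gt0 ?powR_gt0//.
rewrite -powRM//; last exact: ltW.
by apply: ge0_ler_powR; rewrite ?nnegrE ?mulr_ge0// ltW.
Qed.

Definition kconv e F x : R := \int[mu]_y (kern h e x y * F y).

Lemma integrable_poisson_mul F e x : L1Linf F -> 0 < e ->
  mu.-integrable setT (EFin \o ((fun y => poisson delta e (y - x) * `|F y|) : lebRn R n -> R)).
Proof.
move=> LF e0; have [B B0 HB] := integral_poisson_bounded delta0 LF e0; have [mF _] := LF.
apply/integrableP; split.
  change (measurable_fun setT (fun y : lebRn R n => (poisson delta e (y - x))%:E * `|F y|%:E)%E).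
  apply: emeasurable_funM; last exact: measurable_norm.
  exact: measurable_poisson_sub.
apply: le_lt_trans (ltry B); apply: le_trans (HB x).
rewrite le_eqVlt; apply/orP; left; apply/eqP; apply: eq_integral => y _.
by rewrite /= -EFinM ger0_norm// mulr_ge0// poisson_ge0.
Qed.

Lemma measurable_kern_mul e x F : 0 < e -> measurable_fun setT (F : lebRn R n -> R) ->
  measurable_fun setT (fun y : lebRn R n => kern h e x y * F y).
Proof. by move=> e0 mF; apply: measurable_funM; [exact: measurable_kern|exact: mF]. Qed.

Lemma integrable_kern_mul F e x : L1Linf F -> 0 < e ->
  mu.-integrable setT (EFin \o ((fun y => kern h e x y * F y) : lebRn R n -> R)).
Proof.
move=> LF e0; have [mF _] := LF.
have iH : mu.-integrable setT (fun y : lebRn R n => C%:E * (poisson delta e (y - x) * `|F y|)%:E)%E.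
  by apply: integrableZl; [exact: measurableT|exact: integrable_poisson_mul].
apply: (@le_integrable _ _ _ mu _ measurableT _ _ _ _ iH).
  by apply/measurable_EFinP; exact: measurable_kern_mul.
move=> y _; rewrite -EFinM /= lee_fin normrM (ger0_norm (kern_ge0 h_ge0 x y e0)).
apply: (le_trans _ (ler_norm _)); rewrite mulrA ler_wpM2r//.
exact: kern_le_poisson.
Qed.

(** Dominated convergence: the kernel is continuous in its first argument for
    almost every second one, and locally dominated through
    [poisson_shift]. *)
Lemma kconv_continuous F e : L1Linf F -> 0 < e -> continuous (kconv e F).
Proof.
move=> LF e0 x; have [mF _] := LF.
have [s s0 sx] : exists2 s, 0 < s & forall u, cube x s u -> enorm (u - x) <= e / 2.
  have FF := nbhs_filter x.
  have : \forall u \near x, enorm (u - x) <= e / 2.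
    have c : {for x, continuous (fun u => enorm (u - x))}.
      apply: (@continuous_comp _ _ _ (fun u : 'rV[R]_n => u - x)); last exact: enorm_continuous.
      by apply: cvgB; [exact: cvg_id|exact: cvg_cst].
    move/cvgrPdist_lt : c => /(_ (e / 2)); rewrite divr_gt0// => /(_ isT).
    apply: (@filterS _ _ (nbhs_filter x)) => u.
    rewrite subrr (_ : enorm (0 : 'rV[R]_n) = 0); last first.
      by rewrite -(scale0r (0 : 'rV[R]_n)) enormZ normr0 mul0r.
    by rewrite sub0r normrN ger0_norm ?enorm_ge0// => /ltW.
  by move/nbhs_cube => [s s0 sA]; exists s.
pose H := fun y : lebRn R n => C * 2 `^ (n%:R + delta) * (poisson delta e (y - x) * `|F y|).
apply: (@continuous_integral _ _ (fun u y => kern h e u y * F y) H x s s0).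
- by move=> u; exact: measurable_kern_mul.
- suff : mu.-integrable setT (fun y : lebRn R n =>
      (C * 2 `^ (n%:R + delta))%:E * (poisson delta e (y - x) * `|F y|)%:E)%E by [].
  by apply: integrableZl; [exact: measurableT|exact: integrable_poisson_mul].
- move=> u y us; rewrite normrM (ger0_norm (kern_ge0 h_ge0 u y e0)) /H.
  rewrite mulrA; apply: ler_wpM2r => //.
  apply: (le_trans (kern_le_poisson h_decay u y e0)).
  have PS := poisson_shift y e0 (sx u us).
  by rewrite -[X in _ <= X]mulrA; apply: ler_wpM2l => //; exact: ltW.
- apply: leb_aeS (kern_ae_continuous x e0) => y cy.
  have FF := nbhs_filter x.
  by apply: cvgM; [exact: cy|exact: cvg_cst].
Qed.

Lemma L1Linf_indic : L1Linf (\1_Omega : 'rV[R]_n -> R).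
Proof.
have mi : measurable_fun setT (\1_(Omega : set (lebRn R n)) : lebRn R n -> R).
  exact: measurable_indic.
split; first exact: mi.
exists 1 => //; apply: integrable_ae0; first exact: measurable_excess.
apply: aeW => y; rewrite /excess indicE; case: (_ \in _); rewrite ?normr1 ?normr0.
  by rewrite subrr maxxx.
by apply/max_idPr; rewrite lerBlDr add0r.
Qed.

Lemma dens_kconv e x : dens Omega h e x = kconv e \1_Omega x.
Proof.
rewrite densE Rintegral_mkcond /kconv; apply: eq_Rintegral => y _.
by rewrite /restrict indicE; case: ifP => _; rewrite ?mulr1 ?mulr0.
Qed.

Variables (eps0 d0 : R).
Hypothesis d00 : 0 < d0.
Hypothesis d0_le : forall e x, 0 < e < eps0 -> Omega x -> d0 <= dens Omega h e x.

Lemma markov_op_kconv f e x : L1Linf (f \_ Omega) -> 0 < e < eps0 -> Omega x ->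
  markov_op Omega h e f x = kconv e (f \_ Omega) x / kconv e \1_Omega x.
Proof.
move=> LF /andP[e0 _] Ox; rewrite markov_opE -dens_kconv mulrC.
rewrite /kconv -(RintegralZl _ measurableT (integrable_kern_mul x LF e0)).
by apply: eq_Rintegral => y _; rewrite markov_kernE mulrA (mulrC (_^-1)).
Qed.

Lemma markov_op_Cb f e : L1Linf (f \_ Omega) -> 0 < e < eps0 ->
  Cb Omega (markov_op Omega h e f).
Proof.
move=> LF e0e; have /andP[e0 _] := e0e; split.
  rewrite continuous_open_subspace// => x /set_mem Ox.
  have FF := nbhs_filter x.
  rewrite /continuous_at (markov_op_kconv LF e0e Ox).
  have nO : nbhs x Omega by exact: open_nbhs_nbhs.
  apply: (@cvg_trans _ ((fun u => kconv e (f \_ Omega) u / kconv e \1_Omega u) @ x)).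
    apply: near_eq_cvg; apply: (@filterS _ _ (nbhs_filter x) Omega) => // u Ou.
    by rewrite (markov_op_kconv LF e0e Ou).
  have D0 : kconv e \1_Omega x != 0.
    by rewrite -dens_kconv gt_eqF// (lt_le_trans d00)// d0_le.
  have c1 := @kconv_continuous _ _ LF e0 x.
  have c2 : (kconv e \1_Omega u)^-1 @[u --> x] --> (kconv e \1_Omega x)^-1.
    exact: (cvgV D0 (@kconv_continuous _ _ L1Linf_indic e0 x)).
  exact: (cvgM c1 c2).
have [B HB] := markov_op_bounded h_ge0 h_decr C0 delta0 h_decay d00 d0_le LF e0e.
exists B; split; first exact: num_real.
by move=> M BM x Ox; apply: le_trans (HB x Ox) (ltW BM).
Qed.

End averaged_functions.

(** * Convergence in norm *)

Section generalised_dominated_convergence.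
Context d (T : measurableType d) (R : realType) (m : {measure set T -> \bar R}).

(** Convergence of integrals dominated by a sequence [S] whose integral is constant.
    The excess of [S] over its limit has the same integral as the deficit, and the
    deficit is dominated by the limit itself. *)
Lemma pratt_cvg0 (g S : nat -> T -> R) (G : T -> R) :
  (forall k, measurable_fun setT (g k)) ->
  (forall k, m.-integrable setT (EFin \o S k)) -> m.-integrable setT (EFin \o G) ->
  (forall k x, 0 <= g k x <= S k x) -> (forall x, 0 <= G x) ->
  (forall k, \int[m]_x (S k x)%:E = \int[m]_x (G x)%:E)%E ->
  {ae m, forall x, S k x @[k --> \oo] --> G x} ->
  {ae m, forall x, g k x @[k --> \oo] --> (0 : R)} ->
  (\int[m]_x (g k x)%:E @[k --> \oo] --> 0)%E.
Proof.
move=> mg iS iG gS G0 SG cS cg.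
have mS k : measurable_fun setT (S k) by apply/measurable_EFinP; case/integrableP: (iS k).
have mG : measurable_fun setT G by apply/measurable_EFinP; case/integrableP: iG.
pose a k x := Num.min (g k x) (G x); pose b k x := Num.max (G x - S k x) 0.
have ma k : measurable_fun setT (a k) by exact: measurable_minr.
have mb k : measurable_fun setT (b k).
  by apply: measurable_maxr => //; exact: measurable_funB.
have g0 k x : 0 <= g k x by have /andP[] := gS k x.
have a0 k x : 0 <= a k x by rewrite le_min g0 G0.
have b0 k x : 0 <= b k x by rewrite le_max lexx orbT.
have dct (c : nat -> T -> R) : (forall k, measurable_fun setT (c k)) ->
    (forall k x, 0 <= c k x <= G x) -> {ae m, forall x, c k x @[k --> \oo] --> (0 : R)} ->
    (\int[m]_x (c k x)%:E @[k --> \oo] --> 0)%E.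
  move=> mc cG cc.
  have [|||||_ _] := @dominated_convergence _ _ _ m setT measurableT
    (fun k x => (c k x)%:E) (cst 0%E) (fun x => (G x)%:E).
  - by move=> k; exact/measurable_EFinP.
  - exact: measurable_cst.
  - apply: filterS cc => x cx _; apply: (cvg_comp _ _ cx); exact: cvg_id.
  - exact: iG.
  - apply: aeW => x k _; have /andP[c0 cGx] := cG k x.
    by rewrite lee_fin ger0_norm.
  by rewrite integral_cst// mul0e.
have ca : (\int[m]_x (a k x)%:E @[k --> \oo] --> 0)%E.
  apply: dct => //; first by move=> k x; rewrite a0 ge_min lexx orbT.
  apply: filterS cg => x cx.
  apply: (squeeze_cvgr _ (cvg_cst 0) cx); apply: nearW => k.
  by rewrite a0 ge_min lexx.
have cb : (\int[m]_x (b k x)%:E @[k --> \oo] --> 0)%E.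
  apply: dct => //.
    move=> k x; rewrite b0 ge_max G0 andbT lerBlDr lerDl.
    by rewrite (le_trans (g0 k x))//; have /andP[] := gS k x.
  apply: filterS cS => x cx.
  have c1 : `|G x - S k x| @[k --> \oo] --> (0 : R).
    rewrite -[X in _ --> X](_ : `|G x - G x| = 0); last by rewrite subrr normr0.
    by apply: cvg_norm; apply: cvgB => //; exact: cvg_cst.
  apply: (squeeze_cvgr _ (cvg_cst 0) c1); apply: nearW => k.
  by rewrite b0 ge_max ler_norm normr_ge0.
have ib k : m.-integrable setT (EFin \o b k).
  apply: (@le_integrable _ _ _ m _ measurableT _ _ _ _ iG).
    exact/measurable_EFinP.
  move=> x _; rewrite lee_fin !ger0_norm//.
  rewrite ge_max G0 andbT lerBlDr lerDl.
  by rewrite (le_trans (g0 k x))//; have /andP[] := gS k x.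
have ia k : m.-integrable setT (EFin \o a k).
  apply: (@le_integrable _ _ _ m _ measurableT _ _ _ _ iG).
    exact/measurable_EFinP.
  by move=> x _; rewrite lee_fin !ger0_norm// ge_min lexx orbT.
have le k : (\int[m]_x (g k x)%:E <= \int[m]_x (a k x)%:E + \int[m]_x (b k x)%:E)%E.
  rewrite -ge0_integralD//; last 4 first.
  - by move=> x _; rewrite lee_fin.
  - exact/measurable_EFinP.
  - by move=> x _; rewrite lee_fin.
  - exact/measurable_EFinP.
  have iab := integrableD measurableT (ia k) (ib k).
  have : (\int[m]_x (g k x)%:E + \int[m]_x (G x)%:E <=
     \int[m]_x ((a k x)%:E + (b k x)%:E) + \int[m]_x (S k x)%:E)%E.
    rewrite -!ge0_integralD//; last 8 first.
    - by move=> x _; rewrite adde_ge0 ?lee_fin.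
    - by apply: emeasurable_funD; exact/measurable_EFinP.
    - by move=> x _; rewrite lee_fin (le_trans (g0 k x))//; have /andP[] := gS k x.
    - exact/measurable_EFinP.
    - by move=> x _; rewrite lee_fin.
    - exact/measurable_EFinP.
    - by move=> x _; rewrite lee_fin.
    - exact/measurable_EFinP.
    apply: ge0_le_integral => //.
    - by move=> x _; rewrite adde_ge0 ?lee_fin.
    - by apply: emeasurable_funD; exact/measurable_EFinP.
    - by apply: emeasurable_funD; [apply: emeasurable_funD|]; exact/measurable_EFinP.
    move=> x _; rewrite -!EFinD lee_fin /a /b /Num.min /Num.max.
    have /andP[] := gS k x; have := G0 x.
    by do 2 case: ifPn; rewrite -?leNgt; lra.
  rewrite SG leeD2rE//.
  exact: (integrable_fin_num measurableT iG).
apply: (squeeze_cvge _ (cvg_cst 0%E)).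
  2: by rewrite -[X in _ --> X]adde0; apply: cvgeD; [by []|exact: ca|exact: cb].
by apply: nearW => k; rewrite le andbT integral_ge0// => x _; rewrite lee_fin.
Qed.

End generalised_dominated_convergence.
Lemma powR_norm_cvg0 (R : realType) (u : nat -> R) (r : R) : 0 < r ->
  u k @[k --> \oo] --> (0 : R) -> `|u k| `^ r @[k --> \oo] --> (0 : R).
Proof.
move=> r0 /cvgr0Pnorm_lt cu; apply/cvgr0Pnorm_lt => t t0.
have /cu : 0 < t `^ r^-1 by rewrite powR_gt0.
apply: filterS => k uk; rewrite ger0_norm ?powR_ge0//.
have -> : t = (t `^ r^-1) `^ r by rewrite -powRrM mulVf ?gt_eqF// powRr1// ltW.
by apply: gt0_ltr_powR; rewrite ?nnegrE// powR_ge0.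
Qed.

Section Lp_convergence.
Context {R : realType} {n : nat}.
Local Notation mu := (leb R n).
Implicit Types (x y z u : 'rV[R]_n) (f F : 'rV[R]_n -> R).
Variables (Omega : set 'rV[R]_n) (h : 'rV[R]_n -> R).
Hypothesis mOmega : measurable (Omega : set (lebRn R n)).
Hypothesis h_ge0 : forall x, 0 <= h x.
Hypothesis h_decr : forall x y, enorm x <= enorm y -> h y <= h x.
Hypothesis h_mass : (\int[mu]_x (h x)%:E = 1)%E.
Variables (C delta : R).
Hypothesis C0 : 0 < C.
Hypothesis delta0 : 0 < delta.
Hypothesis h_decay : forall x, `|h x| <= C * (1 + enorm x) `^ (- (n%:R + delta)).

Lemma dens_setT e x : 0 < e -> dens setT h e x = 1.
Proof. by move=> e0; rewrite /dens /Rintegral integral_kern. Qed.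

Lemma markov_op_setT e F x : 0 < e -> markov_op setT h e F x = kconv h e F x.
Proof.
move=> e0; apply: eq_Rintegral => y _.
by rewrite markov_kernE dens_setT// divr1.
Qed.

Lemma ae_kconv_cvg F : L1Linf F ->
  {ae mu, forall x, kconv h e F x @[e --> 0^'+] --> F x}.
Proof.
move=> LF.
have L : L1Linf (F \_ setT) by rewrite patch_setT.
have d1 (e : R) x : 0 < e < 1 -> setT x -> 1 <= dens setT h e x.
  by move=> /andP[e0 _] _; rewrite dens_setT.
have := ae_markov_op_cvg measurableT h_ge0 h_decr h_mass C0 delta0 h_decay
  ltr01 ltr01 d1 L.
apply: leb_aeS => x /(_ I); apply: cvg_trans; apply: near_eq_cvg.
near=> e; apply: markov_op_setT; near: e; exact: nbhs_right_gt.
Unshelve. all: by end_near. Qed.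

Lemma kavg_kconv e F x : L1Linf F -> 0 < e ->
  kavg h e (EFin \o F) x = (kconv h e F x)%:E.
Proof.
move=> LF e0; rewrite /kconv /Rintegral fineK//.
apply: (integrable_fin_num measurableT).
exact: (integrable_kern_mul h_ge0 h_decr delta0 h_decay).
Qed.

Lemma L1_L1Linf F : mu.-integrable setT (EFin \o (F : lebRn R n -> R)) -> L1Linf F.
Proof.
move=> iF; split; first by apply/measurable_EFinP; case/integrableP: iF.
exists 0 => //; rewrite (_ : excess 0 F = fun x => `|F x|); first exact: (integrable_abse iF).
by apply/funext => x; rewrite /excess subr0 max_l.
Qed.

Section averages_of_integrable_functions.
Variable G : 'rV[R]_n -> R.
Hypothesis G0 : forall x, 0 <= G x.
Hypothesis iG : mu.-integrable setT (EFin \o (G : lebRn R n -> R)).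

Let LG : L1Linf G. Proof. exact: L1_L1Linf. Qed.

Let mGE : measurable_fun setT ((fun y => (G y)%:E) : lebRn R n -> \bar R).
Proof. by case/integrableP: iG. Qed.

Lemma kconv_ge0 e x : 0 < e -> 0 <= kconv h e G x.
Proof.
move=> e0; rewrite -lee_fin -kavg_kconv//.
by apply: kavg_ge0 => // y; rewrite lee_fin.
Qed.

Lemma integral_kconv e : 0 < e -> (\int[mu]_x (kconv h e G x)%:E = \int[mu]_x (G x)%:E)%E.
Proof.
move=> e0.
have fG0 y : (0 <= (G y)%:E)%E by rewrite lee_fin.
rewrite -(integral_kavg h_ge0 h_decr h_mass e0 mGE fG0).
by apply: eq_integral => x _; rewrite -kavg_kconv.
Qed.

Lemma measurable_kconv e : 0 < e -> measurable_fun setT (kconv h e G : lebRn R n -> R).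
Proof.
move=> e0; apply/measurable_EFinP.
have fG0 y : (0 <= (G y)%:E)%E by rewrite lee_fin.
rewrite (_ : _ \o _ = (kavg h e (fun y => (G y)%:E) : lebRn R n -> \bar R)); last first.
  by apply/funext => x; rewrite kavg_kconv.
exact: (measurable_kavg h_ge0 h_decr e0 mGE fG0).
Qed.

Lemma integrable_kconv e : 0 < e -> mu.-integrable setT (EFin \o (kconv h e G : lebRn R n -> R)).
Proof.
move=> e0; apply/integrableP; split.
  by apply/measurable_EFinP; exact: measurable_kconv.
rewrite (eq_integral (fun x : lebRn R n => (kconv h e G x)%:E)); last first.
  by move=> x _; rewrite /= ger0_norm// kconv_ge0.
rewrite integral_kconv//; have /integrableP[_] := iG.
by under eq_integral do rewrite /= (ger0_norm (G0 _)).
Qed.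

End averages_of_integrable_functions.

Variables (eps0 d0 : R).
Hypothesis eps00 : 0 < eps0.
Hypothesis d00 : 0 < d0.
Hypothesis d0_le : forall e x, 0 < e < eps0 -> Omega x -> d0 <= dens Omega h e x.

Section fixed_function.
Variables (p : R) (f : 'rV[R]_n -> R).
Hypothesis p1 : 1 <= p.
Hypothesis Lf : Lp Omega p%:E f.

Let p0 : 0 < p. Proof. exact: lt_le_trans p1. Qed.
Let mf : measurable_fun setT (f \_ Omega : lebRn R n -> R).
Proof. by have [] := (LpP _ _ _).1 Lf. Qed.
Let LF : L1Linf (f \_ Omega). Proof. exact: Lp_L1Linf Lf. Qed.

Let G x := `|(f \_ Omega) x| `^ p.

Let mG : measurable_fun setT (G : lebRn R n -> R).
Proof.
apply: (measurableT_comp (measurable_powR p)).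
by apply: measurableT_comp; [exact: normr_measurable|exact: mf].
Qed.

Let iG : mu.-integrable setT (EFin \o (G : lebRn R n -> R)).
Proof.
have [_] := (LpP _ _ _).1 Lf; rewrite Lp_normE// => Nf.
apply/integrableP; split; first by apply/measurable_EFinP; exact: mG.
rewrite (eq_integral (fun x : lebRn R n => (G x)%:E)); last first.
  by move=> x _; rewrite /= ger0_norm// powR_ge0.
by apply: lty_poweRy Nf; rewrite invr_eq0 gt_eqF.
Qed.

Let LG : L1Linf G. Proof. exact: L1_L1Linf. Qed.

Let G_ge0 x : 0 <= G x. Proof. exact: powR_ge0. Qed.

Let err e x := `|((fun x => markov_op Omega h e f x - f x) \_ Omega) x| `^ p.

Let c := 2 `^ p * (d0^-1 `^ p + 1).

Let err_le e x : 0 < e < eps0 -> 0 <= err e x <= c * (kconv h e G x + G x).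
Proof.
move=> e0e; have /andP[e0 ee0] := e0e.
have dle y : Omega y -> d0 <= dens Omega h e y by exact: d0_le.
have conv0 : 0 <= kconv h e G x by exact: kconv_ge0.
have G0 : 0 <= G x by exact: powR_ge0.
have c0 : 0 <= c by rewrite mulr_ge0 ?powR_ge0// addr_ge0// powR_ge0.
rewrite powR_ge0/= /err /restrict; case: ifPn => [/set_mem Ox|_]; last first.
  by rewrite normr0 powR0 ?gt_eqF// mulr_ge0// addr_ge0.
have := abs_markov_op_powR_le h_ge0 h_decr h_mass e0 d00 dle p1 Ox mf.
rewrite (kavg_kconv x LG e0) -EFinM lee_fin => H.
have Fx : G x = `|f x| `^ p by rewrite /G /restrict mem_set.
set a := `|markov_op _ _ _ _ _| in H *; set b := `|f x| in Fx *.
have ab : `|markov_op Omega h e f x - f x| <= 2 * Num.max a b.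
  apply: (le_trans (ler_normB _ _)); rewrite -/a -/b mulr_natl mulr2n.
  by rewrite lerD// le_max lexx ?orbT.
have ab2 : Num.max a b `^ p <= a `^ p + b `^ p.
  by rewrite /Num.max; case: ifP => _; rewrite ?lerDl ?lerDr powR_ge0.
apply: (@le_trans _ _ ((2 * Num.max a b) `^ p)).
  by apply: ge0_ler_powR; rewrite ?nnegrE ?(ltW p0)// mulr_ge0// le_max normr_ge0.
rewrite powRM//; last by rewrite le_max normr_ge0.
rewrite -mulrA ler_wpM2l ?powR_ge0//; apply: (le_trans ab2).
rewrite -Fx mulrDl mulrDr mul1r; apply: (le_trans (lerD H (lexx _))).
rewrite -addrA lerD2l; apply: (@le_trans _ _ (kconv h e G x + G x)); first by rewrite lerDr.
by rewrite lerDr mulr_ge0// powR_ge0.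
Qed.

Let measurable_err e : 0 < e -> measurable_fun setT (err e : lebRn R n -> R).
Proof.
move=> e0; apply: (measurableT_comp (measurable_powR p)).
apply: measurableT_comp; first exact: normr_measurable.
rewrite (_ : _ \_ _ = (fun x => markov_op Omega h e f x - (f \_ Omega) x) \_ Omega).
  apply: leb_measurable_restr; first exact: mOmega.
  by apply: measurable_funB; [exact: measurable_markov_op|exact: mf].
by apply/funext => x; rewrite /restrict; case: ifP.
Qed.

Let integral_err_cvg0 (u : nat -> R) : (forall k, 0 < u k < eps0) ->
  u k @[k --> \oo] --> (0 : R) -> (\int[mu]_x (err (u k) x)%:E @[k --> \oo] --> 0)%E.
Proof.
move=> ue cu; have u0 k : 0 < u k by have /andP[] := ue k.
have G0 x : 0 <= G x by exact: powR_ge0.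
have c0 : 0 <= c by rewrite mulr_ge0 ?powR_ge0// addr_ge0// powR_ge0.
have iS k : mu.-integrable setT (fun x : lebRn R n => (c * (kconv h (u k) G x + G x))%:E).
  have iD : mu.-integrable setT (fun x : lebRn R n => (kconv h (u k) G x)%:E + (G x)%:E)%E.
    by apply: integrableD; [exact: measurableT|exact: integrable_kconv|exact: iG].
  suff : mu.-integrable setT (fun x : lebRn R n => c%:E * ((kconv h (u k) G x)%:E + (G x)%:E))%E by [].
  by apply: integrableZl; [exact: measurableT|exact: iD].
have iGG : mu.-integrable setT (fun x : lebRn R n => (c * (G x + G x))%:E).
  have iD : mu.-integrable setT (fun x : lebRn R n => (G x)%:E + (G x)%:E)%E.
    by apply: integrableD; [exact: measurableT|exact: iG|exact: iG].
  suff : mu.-integrable setT (fun x : lebRn R n => c%:E * ((G x)%:E + (G x)%:E))%E by [].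
  by apply: integrableZl; [exact: measurableT|exact: iD].
apply: (@pratt_cvg0 _ _ _ mu (fun k => err (u k))
  (fun k x => c * (kconv h (u k) G x + G x)) (fun x => c * (G x + G x))).
- by move=> k; exact: measurable_err.
- exact: iS.
- exact: iGG.
- by move=> k x; exact: err_le.
- by move=> x; rewrite mulr_ge0// addr_ge0.
- move=> k; transitivity (c%:E * (\int[mu]_x (kconv h (u k) G x)%:E + \int[mu]_x (G x)%:E))%E.
    rewrite -(integralD measurableT (integrable_kconv G_ge0 iG (u0 k)) iG) -integralZl.
    + by [].
    + exact: measurableT.
    + by apply: integrableD; [exact: measurableT|exact: integrable_kconv|exact: iG].
  rewrite (integral_kconv G_ge0 iG (u0 k)) -(integralD measurableT iG iG) -integralZl.
  + by [].
  + exact: measurableT.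
  + by apply: integrableD; [exact: measurableT|exact: iG|exact: iG].
- apply: leb_aeS (ae_kconv_cvg LG) => x cx.
  have cGx := (cvg_at_rightP _ _ _).1 cx u (conj u0 cu).
  by apply: cvgM; [exact: cvg_cst|apply: cvgD; [exact: cGx|exact: cvg_cst]].
- have := ae_markov_op_cvg mOmega h_ge0 h_decr h_mass C0 delta0 h_decay eps00 d00 d0_le LF.
  apply: leb_aeS => x cx; have [Ox|nOx] := pselect (Omega x); last first.
    rewrite (_ : (fun k => _) = fun=> 0); first exact: cvg_cst.
    by apply/funext => k; rewrite /err /restrict memNset// normr0 powR0// gt_eqF.
  rewrite (_ : (fun k => _) = fun k => `|markov_op Omega h (u k) f x - f x| `^ p); last first.
    by apply/funext => k; rewrite /err /restrict mem_set.
  have cPx := (cvg_at_rightP _ _ _).1 (cx Ox) u (conj u0 cu).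
  apply: powR_norm_cvg0; first exact: p0.
  rewrite -[X in _ --> X](subrr (f x)).
  by apply: cvgB; [exact: cPx|exact: cvg_cst].
Qed.

(** The [p]-th power of the error is at most a multiple of
    [kconv h e G + G] with [G = |f| ^ p]. These majorants converge almost everywhere
    and all have the same integral, so [pratt_cvg0] applies. *)
Lemma markov_op_Lp_cvg :
  Lp_norm Omega p%:E (fun x => markov_op Omega h eps f x - f x) @[eps --> 0^'+] --> 0%E.
Proof.
have errN e : Lp_norm Omega p%:E (fun x => markov_op Omega h e f x - f x) =
    ((\int[mu]_x (err e x)%:E) `^ p^-1)%E by rewrite Lp_normE.
have err0 e : (0 <= \int[mu]_x (err e x)%:E)%E.
  by apply: integral_ge0 => x _; rewrite lee_fin; exact: powR_ge0.
have fin e : 0 < e < eps0 -> (\int[mu]_x (err e x)%:E)%E \is a fin_num.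
  move=> e0e; have /andP[e0 _] := e0e.
  apply: (integrable_fin_num measurableT).
  have iD : mu.-integrable setT (fun x : lebRn R n => c%:E * ((kconv h e G x)%:E + (G x)%:E))%E.
    apply: integrableZl; first exact: measurableT.
    by apply: integrableD; [exact: measurableT|exact: integrable_kconv|exact: iG].
  apply: (@le_integrable _ _ _ mu _ measurableT _ _ _ _ iD).
    by apply/measurable_EFinP; exact: measurable_err.
  move=> x _; have /andP[er0 erS] := err_le x e0e.
  by rewrite -EFinD -EFinM /= lee_fin (ger0_norm er0) (le_trans erS)// ler_norm.
under eq_fun do rewrite errN.
apply/fine_cvgP; split.
  near=> e; have e0e : 0 < e < eps0.
    by apply/andP; split; near: e; [exact: nbhs_right_gt|exact: nbhs_right_lt].
  by rewrite -(fineK (fin e e0e)) poweR_EFin.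
apply/cvg_at_rightP => u [u0 cu].
pose v k := Num.min (u k) (eps0 / 2).
have ve k : 0 < v k < eps0.
  by rewrite /v lt_min u0 divr_gt0//= gt_min ltr_pdivrMr// mulr_natr mulr2n ltrDl eps00 orbT.
have vu : \forall k \near \oo, v k = u k.
  near=> k; apply/min_idPl; rewrite ltW//; near: k.
  by move/cvgr_lt : cu; apply; rewrite divr_gt0.
have cv : v k @[k --> \oo] --> (0 : R).
  apply: cvg_trans cu; apply: near_eq_cvg.
  by apply: filterS vu => k ->.
have /fine_cvgP[_ cJ] := integral_err_cvg0 ve cv.
apply: (@cvg_trans _ ((`|fine (\int[mu]_x (err (v k) x)%:E)| `^ p^-1) @[k --> \oo])).
  apply: near_eq_cvg; apply: filterS vu => k vk /=.
  have := fin _ (ve k); rewrite vk => F.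
  by rewrite -[in RHS](fineK F) poweR_EFin /= ger0_norm// fine_ge0.
by apply: powR_norm_cvg0; [rewrite invr_gt0|exact: cJ].
Unshelve. all: by end_near. Qed.

End fixed_function.
End Lp_convergence.

(** * Scalar products, Gaussians, and differentiation of integrals *)

Lemma is_derive_integral d (T : measurableType d) (R : realType)
    (m : {measure set T -> \bar R}) (f df : R -> T -> R) (H : T -> R) (t0 eta : R) :
  0 < eta -> (forall t, m.-integrable setT (EFin \o f t)) ->
  (forall t y, is_derive t (1 : R) (f^~ y : R -> R) (df t y)) ->
  m.-integrable setT (EFin \o H) ->
  (forall t y, `|t - t0| < eta -> `|df t y| <= H y) ->
  is_derive t0 (1 : R) (fun t : R => \int[m]_y f t y) (\int[m]_y df t0 y).
Proof.
move=> eta0 mf fd iH dH.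
pose u := t0 - eta; pose v := t0 + eta.
have It : `]u, v[%classic t0 by rewrite /u /v /= in_itv/=; apply/andP; split; move: eta0; lra.
have Hge0 y : 0 <= H y.
  by apply: le_trans (dH t0 y _); rewrite ?normr_ge0// subrr normr0.
have dE t y : partial1of2 f t y = df t y by rewrite partial1of2E; exact: derive_val.
have dn t y : `]u, v[%classic t -> setT y -> `|partial1of2 f t y| <= H y.
  rewrite /u /v /= in_itv/= => tI _; rewrite dE dH//.
  by rewrite ltr_norml; apply/andP; split; case/andP: tI; lra.
have der t y : `]u, v[%classic t -> setT y -> derivable (f^~ y) t 1.
  by move=> _ _; exact: ex_derive.
have if' t : `]u, v[%classic t -> m.-integrable setT (EFin \o f t) by [].
apply: DeriveDef.
  exact: (derivable_under_integral measurableT It if' der Hge0 iH dn).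
rewrite -derive1E (differentiation_under_integral measurableT It if' der Hge0 iH dn).
by apply: eq_Rintegral => y _; rewrite dE.
Qed.

Section scalar_product.
Context {R : realType} {n : nat}.
Local Notation mu := (leb R n).
Implicit Types (x y z u w : 'rV[R]_n).

Lemma dotpC x y : dotp x y = dotp y x.
Proof. by apply: eq_bigr => i _; rewrite mulrC. Qed.

Lemma dotpDl x y z : dotp (x + y) z = dotp x z + dotp y z.
Proof. by rewrite -big_split; apply: eq_bigr => i _; rewrite mxE mulrDl. Qed.

Lemma dotpZl s x y : dotp (s *: x) y = s * dotp x y.
Proof. by rewrite mulr_sumr; apply: eq_bigr => i _; rewrite mxE mulrA. Qed.

Lemma dotpNl x y : dotp (- x) y = - dotp x y.
Proof. by rewrite -scaleN1r dotpZl mulN1r. Qed.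

Lemma dotpBl x y z : dotp (x - y) z = dotp x z - dotp y z.
Proof. by rewrite dotpDl dotpNl. Qed.

Lemma dotpZr s x y : dotp x (s *: y) = s * dotp x y.
Proof. by rewrite dotpC dotpZl dotpC. Qed.

Lemma dotpDr x y z : dotp x (y + z) = dotp x y + dotp x z.
Proof. by rewrite dotpC dotpDl !(dotpC x). Qed.

Lemma enorm_sqr x : enorm x ^+ 2 = dotp x x.
Proof.
rewrite sqr_sqrtr; first by apply: eq_bigr => i _; rewrite expr2.
by apply: sumr_ge0 => i _; exact: sqr_ge0.
Qed.

Lemma enorm_sqrD s w z : enorm (w + s *: z) ^+ 2 =
  enorm w ^+ 2 + 2 * s * dotp z w + s ^+ 2 * enorm z ^+ 2.
Proof. rewrite !enorm_sqr dotpDl !dotpDr !dotpZl !dotpZr (dotpC w z); ring. Qed.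

(** The crude constant spares the Cauchy-Schwarz inequality. *)
Lemma dotp_le x y : `|dotp x y| <= n%:R * enorm x * enorm y.
Proof.
apply: (le_trans (ler_norm_sum _ _ _)).
rewrite -mulrA -[n in n%:R]card_ord -sum1_card natr_sum mulr_suml.
apply: ler_sum => i _; rewrite mul1r normrM.
by apply: ler_pM => //; exact: le_coord_enorm.
Qed.

Lemma measurable_dotp d (T : measurableType d) (v w : T -> 'rV[R]_n) :
  (forall i, measurable_fun setT (fun t => v t 0 i)) ->
  (forall i, measurable_fun setT (fun t => w t 0 i)) ->
  measurable_fun setT (fun t => dotp (v t) (w t)).
Proof.
move=> mv mw; apply: measurable_sum => i.
by apply: measurable_funM; [exact: mv|exact: mw].
Qed.

End scalar_product.

Section gaussian.
Context {R : realType} {n : nat}.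
Local Notation mu := (leb R n).
Implicit Types (x y z u w : 'rV[R]_n).

Definition gauss w : R := expR (- (enorm w ^+ 2 / 2)).

Lemma gauss_gt0 w : 0 < gauss w. Proof. exact: expR_gt0. Qed.

Lemma gauss_ge0 w : 0 <= gauss w. Proof. exact: expR_ge0. Qed.

Lemma gauss_le1 w : gauss w <= 1.
Proof. by rewrite /gauss -expR0 ler_expR oppr_le0 divr_ge0// sqr_ge0. Qed.

Lemma gauss_decr x y : enorm x <= enorm y -> gauss y <= gauss x.
Proof.
move=> xy; rewrite ler_expR lerN2 ler_pM2r ?invr_gt0//.
by rewrite ler_sqr// nnegrE enorm_ge0.
Qed.

(** Powers are absorbed through [1 + t <= expR t] and [m * t - t^2 / 2 <= m^2 / 2]. *)
Lemma gauss_decay w : (1 + enorm w) * gauss w <=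
  expR (n.+2%:R ^+ 2 / 2) * poisson 1 1 w.
Proof.
have t0 := enorm_ge0 w; set t := enorm w in t0 *.
have -> : poisson 1 1 w = (1 + t) ^- n.+1.
  rewrite /poisson expr1n invr1 mul1r scale1r -/t powRN -(natrD R n 1) addn1.
  by rewrite powR_mulrn// addr_ge0.
have p0 : 0 < (1 + t) ^+ n.+1 by rewrite exprn_gt0// ltr_pwDl.
rewrite ler_pdivlMr// mulrAC -exprS.
apply: (@le_trans _ _ (expR t ^+ n.+2 * gauss w)).
  rewrite ler_wpM2r ?gauss_ge0// lerXn2r ?nnegrE ?expR_ge0 ?addr_ge0//.
  exact: expR_ge1Dx.
rewrite -expRM_natl -expRD ler_expR -/t.
rewrite -subr_ge0.
have -> : n.+2%:R ^+ 2 / 2 - (n.+2%:R * t - t ^+ 2 / 2) = (n.+2%:R - t) ^+ 2 / 2 by field.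
by rewrite divr_ge0// sqr_ge0.
Qed.

Lemma integrable_poisson x e delta : 0 < delta -> 0 < e ->
  mu.-integrable setT (EFin \o ((fun y => poisson delta e (y - x)) : lebRn R n -> R)).
Proof.
move=> d0 e0.
have L : L1Linf (\1_setT : 'rV[R]_n -> R) by apply: L1Linf_indic; exact: openT.
have := integrable_poisson_mul d0 x L e0.
rewrite (_ : (fun y : 'rV[R]_n => poisson delta e (y - x) * _) = (fun y => poisson delta e (y - x)))//.
by apply/funext => y; rewrite indicT normr1 mulr1.
Qed.

Lemma integrable_poisson0 e delta : 0 < delta -> 0 < e ->
  mu.-integrable setT (EFin \o (poisson delta e : lebRn R n -> R)).
Proof.
move=> d0 e0; have := integrable_poisson 0 d0 e0.
by under [in X in X -> _]eq_fun do rewrite subr0.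
Qed.

Lemma measurable_gauss d (T : measurableType d) (v : T -> 'rV[R]_n) :
  (forall i, measurable_fun setT (fun t => v t 0 i)) ->
  measurable_fun setT (fun t => gauss (v t)).
Proof. by move=> mv; apply: measurable_radial => //; exact: gauss_decr. Qed.

End gaussian.

(** * The transform of the Gaussian *)

Section one_variable_derivatives.
Context {R : realType}.
Implicit Types q r a t s : R.

Lemma is_derive_lin c0 c1 s : is_derive s (1 : R) (fun s => c0 + s * c1) c1.
Proof.
rewrite (_ : (fun s => _) = cst c0 + c1 \*: id); last first.
  by apply/funext => u; rewrite /= mulrC.
by apply: is_derive_eq; rewrite add0r scaler1.
Qed.

Lemma is_derive_quad q r a s :
  is_derive s (1 : R) (fun s => - ((q + 2 * s * r + s ^+ 2 * a) / 2)) (- (r + s * a)).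
Proof.
have d1 := is_derive_lin (- (q / 2)) (- r) s.
have d2 := is_derive_lin 0 (- (a / 2)) s.
have d3 := is_derive_lin 0 1 s.
rewrite (_ : (fun s => _) = (fun s => - (q / 2) + s * (- r)) +
    (fun s => 0 + s * (- (a / 2))) * (fun s => 0 + s * 1)); last first.
  by apply/funext => u; rewrite !fctE; field.
apply: (is_derive_eq (is_deriveD d1 (is_deriveM d2 d3))).
by rewrite /GRing.scale/=; field.
Qed.

Lemma is_derive_cos_lin r t : is_derive t (1 : R) (fun t => cos (t * r)) (- (r * sin (t * r))).
Proof.
have dl := is_derive_lin 0 r t.
rewrite (_ : (fun t => _) = @cos R \o (fun s => 0 + s * r)); last first.
  by apply/funext => u /=; rewrite add0r.
apply: (is_derive_eq (is_derive1_comp (is_derive_cos _) dl)).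
by rewrite add0r mulNr mulrC.
Qed.

Lemma is_derive_gauss_sin q r a t s :
  is_derive s (1 : R)
    (fun s => expR (- ((q + 2 * s * r + s ^+ 2 * a) / 2)) * sin (t * (r + s * a)))
    (expR (- ((q + 2 * s * r + s ^+ 2 * a) / 2)) *
      (t * a * cos (t * (r + s * a)) - (r + s * a) * sin (t * (r + s * a)))).
Proof.
have dq := is_derive_quad q r a s.
have de := is_derive1_comp (is_derive_expR _) dq.
have dl := is_derive_lin (t * r) (t * a) s.
have ds := is_derive1_comp (is_derive_sin _) dl.
rewrite (_ : (fun s => _) = (expR \o (fun s => - ((q + 2 * s * r + s ^+ 2 * a) / 2)))
    * (@sin R \o (fun s => t * r + s * (t * a)))); last first.
  apply/funext => u; rewrite !fctE /=.
  by rewrite (_ : t * r + u * (t * a) = t * (r + u * a)); last ring.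
apply: (is_derive_eq (is_deriveM de ds)); rewrite /GRing.scale/=.
rewrite (_ : t * r + s * (t * a) = t * (r + s * a)); [ring|ring].
Qed.

End one_variable_derivatives.

Section gaussian_transform.
Context {R : realType} {n : nat}.
Local Notation mu := (leb R n).
Implicit Types (x y z u w : 'rV[R]_n) (f F : 'rV[R]_n -> R).

(** The Gaussian beats the kernel [poisson 1 1] even after multiplication by
    [1 + |w|], so the integrability of that kernel is all that is needed. *)
Lemma integrable_gauss_growth (phi : lebRn R n -> R) (K : R) :
  measurable_fun setT phi -> (forall w, `|phi w| <= K * (1 + enorm w)) ->
  mu.-integrable setT (fun w : lebRn R n => (gauss w * phi w)%:E).
Proof.
move=> mphi phiK.
pose E : R := expR (n.+2%:R ^+ 2 / 2).
have iH : mu.-integrable setT (fun y : lebRn R n => (K * E)%:E * (poisson 1 1 y)%:E)%E.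
  by apply: integrableZl; [exact: measurableT|exact: integrable_poisson0].
apply: (@le_integrable _ _ _ mu _ measurableT _ _ _ _ iH).
  apply/measurable_EFinP; apply: measurable_funM; last exact: mphi.
  by apply: measurable_gauss => i; exact: measurable_coord.
move=> w _; rewrite -EFinM /= lee_fin normrM (ger0_norm (gauss_ge0 w)).
apply: (le_trans _ (ler_norm _)); apply: (le_trans (ler_wpM2l (gauss_ge0 w) (phiK w))).
rewrite mulrCA -mulrA ler_wpM2l//; last by rewrite mulrC; exact: gauss_decay.
have := le_trans (normr_ge0 _) (phiK 0); rewrite pmulr_lge0//.
by rewrite ltr_pwDl// enorm_ge0.
Qed.

Lemma integrable_gauss_bounded (phi : lebRn R n -> R) (K : R) :
  measurable_fun setT phi -> (forall w, `|phi w| <= K) ->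
  mu.-integrable setT (fun w : lebRn R n => (gauss w * phi w)%:E).
Proof.
move=> mphi phiK; apply: (integrable_gauss_growth (K := K) mphi) => w.
apply: (le_trans (phiK w)).
by rewrite ler_peMr ?lerDl ?enorm_ge0// (le_trans _ (phiK w)).
Qed.

Let mdotp z : measurable_fun setT (fun w : lebRn R n => dotp z w).
Proof.
apply: measurable_dotp => i; [exact: measurable_cst|exact: measurable_coord].
Qed.

Let mcos t z : measurable_fun setT (fun w : lebRn R n => cos (t * dotp z w)).
Proof.
apply: (measurableT_comp (f := @cos R)).
  exact: (continuous_measurable_fun (@continuous_cos R)).
by apply: measurable_funM; [exact: measurable_cst|exact: mdotp].
Qed.

Let msin t z : measurable_fun setT (fun w : lebRn R n => sin (t * dotp z w)).
Proof.
apply: (measurableT_comp (f := @sin R)).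
  exact: (continuous_measurable_fun (@continuous_sin R)).
by apply: measurable_funM; [exact: measurable_cst|exact: mdotp].
Qed.

Let cos1 (t : R) : `|cos t| <= 1. Proof. by rewrite ler_norml cos_geN1 cos_le1. Qed.
Let sin1 (t : R) : `|sin t| <= 1. Proof. by rewrite ler_norml sin_geN1 sin_le1. Qed.

Let dgauss t z w := gauss w *
  (t * enorm z ^+ 2 * cos (t * dotp z w) - dotp z w * sin (t * dotp z w)).

Let dgauss_le t z : exists2 K, 0 <= K & forall w, `|dgauss t z w| <= K * poisson 1 1 w.
Proof.
pose K : R := `|t| * enorm z ^+ 2 + n%:R * enorm z.
have K0 : 0 <= K by rewrite addr_ge0// mulr_ge0// ?sqr_ge0// enorm_ge0.
exists (K * expR (n.+2%:R ^+ 2 / 2)); first by rewrite mulr_ge0// expR_ge0.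
move=> w; rewrite /dgauss normrM (ger0_norm (gauss_ge0 w)).
rewrite -[X in _ <= X]mulrA; apply: le_trans (ler_wpM2l K0 (gauss_decay w)).
rewrite [X in _ <= X]mulrA [X in X <= _]mulrC ler_wpM2r ?gauss_ge0//.
apply: (le_trans (ler_normB _ _)); rewrite !normrM.
have a0 : 0 <= enorm w by exact: enorm_ge0.
have z0 : 0 <= enorm z by exact: enorm_ge0.
have dz := dotp_le z w.
have := ler_pM (normr_ge0 _) (normr_ge0 _) dz (sin1 (t * dotp z w)).
have tz0 : 0 <= `|t| * enorm z ^+ 2 by rewrite mulr_ge0// sqr_ge0.
have := ler_wpM2l tz0 (cos1 (t * dotp z w)).
rewrite (ger0_norm z0) /K !mulr1.
have nz0 : 0 <= n%:R * enorm z :> R by rewrite mulr_ge0.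
have := mulr_ge0 tz0 a0.
lra.
Qed.

(** The integrand is the derivative of [gauss * sin] along [z], and integrals
    are invariant under translation along [z]. *)
Lemma integral_dgauss t z : \int[mu]_w dgauss t z w = 0.
Proof.
pose f (s : R) (w : lebRn R n) : R := gauss (w + s *: z) * sin (t * dotp z (w + s *: z)).
have affE s w : affine 1 (s *: z) w = w + s *: z by rewrite /affine scale1r.
have if0 : mu.-integrable setT (fun w : lebRn R n => (gauss w * sin (t * dotp z w))%:E).
  exact: integrable_gauss_bounded (msin t z) (fun w => sin1 _).
have if' s : mu.-integrable setT (EFin \o f s).
  have E : EFin \o f s = (fun w : lebRn R n =>
      (fun w : lebRn R n => (gauss w * sin (t * dotp z w))%:E) (affine 1 (s *: z) w)).
    by apply/funext => w; rewrite affE.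
  by rewrite E; exact: (integrable_affine (s *: z) ltr01 if0).
have fE s w : f s w = expR (- ((enorm w ^+ 2 + 2 * s * dotp z w + s ^+ 2 * enorm z ^+ 2) / 2))
    * sin (t * (dotp z w + s * enorm z ^+ 2)).
  by rewrite /f /gauss enorm_sqrD dotpDr dotpZr -(enorm_sqr z).
have fd s w : is_derive s (1 : R) (f^~ w : R -> R) (dgauss t z (w + s *: z)).
  rewrite (_ : f^~ w = fun s => expR (- ((enorm w ^+ 2 + 2 * s * dotp z w
      + s ^+ 2 * enorm z ^+ 2) / 2)) * sin (t * (dotp z w + s * enorm z ^+ 2))).
    rewrite /dgauss /gauss enorm_sqrD dotpDr dotpZr -(enorm_sqr z).
    exact: is_derive_gauss_sin.
  by apply/funext => s'; rewrite fE.
have [K K0 HK] := dgauss_le t z.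
pose eta : R := (2 * (1 + enorm z))^-1.
have z0 : 0 < 1 + enorm z by rewrite ltr_pwDl// enorm_ge0.
have eta0 : 0 < eta by rewrite invr_gt0 mulr_gt0.
pose H (w : lebRn R n) : R := K * 2 `^ (n%:R + 1) * poisson 1 1 w.
have iH : mu.-integrable setT (EFin \o H).
  suff : mu.-integrable setT (fun y : lebRn R n => (K * 2 `^ (n%:R + 1))%:E * (poisson 1 1 y)%:E)%E by [].
  by apply: integrableZl; [exact: measurableT|exact: integrable_poisson0].
have dH s w : `|s - 0| < eta -> `|dgauss t z (w + s *: z)| <= H w.
  rewrite subr0 => se; apply: (le_trans (HK _)); rewrite /H -mulrA ler_wpM2l//.
  have zs : enorm (- (s *: z) - 0) <= 1 / 2.
    rewrite subr0 enormN enormZ; apply: (le_trans (ler_wpM2r (enorm_ge0 z) (ltW se))).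
    rewrite /eta ler_pdivrMl ?mulr_gt0//; have := enorm_ge0 z; lra.
  have := poisson_shift (delta := 1) ltr01 w ltr01 zs.
  by rewrite opprK subr0.
have D := is_derive_integral eta0 if' fd iH dH.
have cst_f : (fun s : R => \int[mu]_w f s w) = cst (\int[mu]_w (gauss w * sin (t * dotp z w))).
  apply/funext => s /=; have := Rintegral_affine (s *: z) ltr01 if0.
  rewrite expr1n invr1 mul1r => <-.
  by apply: eq_Rintegral => w _; rewrite affE.
have : 'D_1 (fun s : R => \int[mu]_w f s w) 0 = \int[mu]_w dgauss t z (w + 0 *: z).
  exact: derive_val.
rewrite cst_f derive_cst => /esym.
under eq_Rintegral do rewrite scale0r addr0.
by [].
Qed.

(** Along the line through [z], [t |-> \int gauss * cos (t z.w)] solves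
    [phi' = - t |z|^2 phi], because of [integral_dgauss]; multiplying by the
    inverse of the solution gives a function of derivative 0. *)
Lemma integral_gauss_cos z : \int[mu]_w (gauss w * cos (dotp z w)) = gauss z * \int[mu]_w gauss w.
Proof.
pose f (t : R) (w : lebRn R n) : R := gauss w * cos (t * dotp z w).
pose a := enorm z ^+ 2.
have if' t : mu.-integrable setT (EFin \o f t).
  exact: integrable_gauss_bounded (mcos t z) (fun w => cos1 _).
have id' t : mu.-integrable setT (EFin \o (dgauss t z : lebRn R n -> R)).
  have [K K0 HK] := dgauss_le t z.
  have iH : mu.-integrable setT (fun y : lebRn R n => K%:E * (poisson 1 1 y)%:E)%E.
    by apply: integrableZl; [exact: measurableT|exact: integrable_poisson0].
  apply: (@le_integrable _ _ _ mu _ measurableT _ _ _ _ iH).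
    apply/measurable_EFinP; apply: measurable_funM.
      by apply: measurable_gauss => i; exact: measurable_coord.
    apply: measurable_funB.
      by apply: measurable_funM; [exact: measurable_cst|exact: mcos].
    by apply: measurable_funM; [exact: mdotp|exact: msin].
  by move=> w _; rewrite -EFinM /= lee_fin; apply: (le_trans (HK w)); exact: ler_norm.
pose df (t : R) (w : lebRn R n) : R := - (gauss w * (dotp z w * sin (t * dotp z w))).
have fd t w : is_derive t (1 : R) (f^~ w : R -> R) (df t w).
  rewrite (_ : f^~ w = gauss w \*: (fun t => cos (t * dotp z w))); last first.
    by apply/funext.
  apply: (is_derive_eq (is_deriveZ (gauss w) (is_derive_cos_lin (dotp z w) t))).
  by rewrite /df /GRing.scale/= mulrN.
pose K : R := n%:R * enorm z.
pose H (w : lebRn R n) : R := K * expR (n.+2%:R ^+ 2 / 2) * poisson 1 1 w.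
have K0 : 0 <= K by rewrite mulr_ge0// enorm_ge0.
have iH : mu.-integrable setT (EFin \o H).
  suff : mu.-integrable setT (fun y : lebRn R n =>
    (K * expR (n.+2%:R ^+ 2 / 2))%:E * (poisson 1 1 y)%:E)%E by [].
  by apply: integrableZl; [exact: measurableT|exact: integrable_poisson0].
have dH t0 t w : `|t - t0| < 1 -> `|df t w| <= H w.
  move=> _; rewrite /df /H normrN normrM (ger0_norm (gauss_ge0 w)).
  rewrite -[X in _ <= X]mulrA; apply: le_trans (ler_wpM2l K0 (gauss_decay w)).
  rewrite [X in _ <= X]mulrA [X in X <= _]mulrC ler_wpM2r ?gauss_ge0//.
  rewrite normrM; have := ler_pM (normr_ge0 _) (normr_ge0 _) (dotp_le z w) (sin1 (t * dotp z w)).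
  by rewrite mulr1 -/K mulrDr mulr1 => /le_trans; apply; rewrite lerDr.
have D t : is_derive t (1 : R) (fun s : R => \int[mu]_w f s w) (- (t * a) * \int[mu]_w f t w).
  apply: (is_derive_eq (is_derive_integral ltr01 if' fd iH (dH t))).
  have iaf : mu.-integrable setT (EFin \o (fun w => (- (t * a)) * f t w)).
    suff : mu.-integrable setT (fun w : lebRn R n => (- (t * a))%:E * (f t w)%:E)%E by [].
    by apply: integrableZl; [exact: measurableT|exact: if'].
  transitivity (\int[mu]_w (dgauss t z w + (- (t * a)) * f t w)).
    by apply: eq_Rintegral => w _; rewrite /df /dgauss /f /a; ring.
  rewrite (RintegralD measurableT (id' t) iaf) integral_dgauss add0r.
  by rewrite (RintegralZl _ measurableT (if' t)).
pose Q (t : R) : R := expR (- ((0 + 2 * t * 0 + t ^+ 2 * (- a)) / 2)) * \int[mu]_w f t w.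
have dQ t : is_derive t (1 : R) Q 0.
  have de := is_derive1_comp (is_derive_expR _) (is_derive_quad 0 0 (- a) t).
  rewrite (_ : Q = (expR \o (fun s => - ((0 + 2 * s * 0 + s ^+ 2 * (- a)) / 2)))
    * (fun s : R => \int[mu]_w f s w)); last by apply/funext => s; rewrite !fctE.
  apply: (is_derive_eq (is_deriveM de (D t))); rewrite /GRing.scale/=; ring.
have := is_derive_0_is_cst 1 0 dQ; rewrite /Q /f.
under eq_Rintegral do rewrite mul1r.
under [in X in _ = X -> _]eq_Rintegral do rewrite mul0r cos0 mulr1.
rewrite (_ : - ((0 + 2 * 0 * 0 + 0 ^+ 2 * - a) / 2) = 0); last by ring.
rewrite expR0 mul1r => <-; rewrite mulrA /gauss -/a -expRD.
have -> : - (a / 2) - (0 + 2 * 1 * 0 + 1 ^+ 2 * - a) / 2 = 0 by field.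
by rewrite expR0 mul1r.
Qed.

End gaussian_transform.

(** * Trigonometric integrals *)

Section trigonometric_integrals.
Context {R : realType} {n : nat}.
Local Notation mu := (leb R n).
Local Notation L1 F := (mu.-integrable setT (EFin \o (F : lebRn R n -> R))).
Implicit Types (x y z u w : 'rV[R]_n) (F G A B : 'rV[R]_n -> R).

Lemma cos_norm_le1 (t : R) : `|cos t| <= 1.
Proof. by rewrite ler_norml cos_geN1 cos_le1. Qed.

Lemma sin_norm_le1 (t : R) : `|sin t| <= 1.
Proof. by rewrite ler_norml sin_geN1 sin_le1. Qed.

Lemma L1_measurable F : L1 F -> measurable_fun setT (F : lebRn R n -> R).
Proof. by case/integrableP => /measurable_EFinP. Qed.

Lemma L1D F G : L1 F -> L1 G -> L1 (fun w => F w + G w).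
Proof. by move=> iF iG; exact: (integrableD measurableT iF iG). Qed.

Lemma L1Z (c : R) F : L1 F -> L1 (fun w => c * F w).
Proof. by move=> iF; exact: (integrableZl measurableT c iF). Qed.

Lemma L1_norm F : L1 F -> L1 (fun w => `|F w|).
Proof. by move=> iF; exact: (integrable_abse iF). Qed.

Lemma L1_le F G : measurable_fun setT (F : lebRn R n -> R) -> L1 G ->
  (forall w, `|F w| <= G w) -> L1 F.
Proof.
move=> mF iG FG; apply: (@le_integrable _ _ _ mu _ measurableT _ _ _ _ iG).
  exact/measurable_EFinP.
by move=> w _; rewrite /= lee_fin (le_trans (FG w))// ler_norm.
Qed.

Lemma L1_mul_bounded F (g : lebRn R n -> R) K : L1 F -> measurable_fun setT g ->
  (forall w, `|g w| <= K) -> L1 (fun w => F w * g w).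
Proof.
move=> iF mg gK; apply: (@L1_le _ (fun w => K * `|F w|)).
- by apply: measurable_funM; [exact: L1_measurable|exact: mg].
- by apply: L1Z; exact: L1_norm.
- by move=> w; rewrite normrM mulrC ler_wpM2r.
Qed.

Lemma measurable_cos_dotp d (T : measurableType d) (v w : T -> 'rV[R]_n) :
  (forall i, measurable_fun setT (fun t => v t 0 i)) ->
  (forall i, measurable_fun setT (fun t => w t 0 i)) ->
  measurable_fun setT (fun t => cos (dotp (v t) (w t))).
Proof.
move=> mv mw; apply: (measurableT_comp (f := @cos R)).
  exact: (continuous_measurable_fun (@continuous_cos R)).
exact: measurable_dotp.
Qed.

Lemma measurable_sin_dotp d (T : measurableType d) (v w : T -> 'rV[R]_n) :
  (forall i, measurable_fun setT (fun t => v t 0 i)) ->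
  (forall i, measurable_fun setT (fun t => w t 0 i)) ->
  measurable_fun setT (fun t => sin (dotp (v t) (w t))).
Proof.
move=> mv mw; apply: (measurableT_comp (f := @sin R)).
  exact: (continuous_measurable_fun (@continuous_sin R)).
exact: measurable_dotp.
Qed.

Let mcos x : measurable_fun setT (fun w : lebRn R n => cos (dotp x w)).
Proof. by apply: measurable_cos_dotp => i; [exact: measurable_cst|exact: measurable_coord]. Qed.

Let msin x : measurable_fun setT (fun w : lebRn R n => sin (dotp x w)).
Proof. by apply: measurable_sin_dotp => i; [exact: measurable_cst|exact: measurable_coord]. Qed.

Lemma L1_mul_cos F x : L1 F -> L1 (fun w => F w * cos (dotp x w)).
Proof. by move=> iF; apply: (L1_mul_bounded iF (mcos x)) => w; exact: cos_norm_le1. Qed.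

Lemma L1_mul_sin F x : L1 F -> L1 (fun w => F w * sin (dotp x w)).
Proof. by move=> iF; apply: (L1_mul_bounded iF (msin x)) => w; exact: sin_norm_le1. Qed.

(** The real part of [(A - i B) exp (i x.w)]: a real form of Fourier integrals that
    is closed under differentiation in [x]. *)
Definition trig A B x w : R := A w * cos (dotp x w) + B w * sin (dotp x w).

Definition trigint A B x : R := \int[mu]_w trig A B x w.

Lemma trig_norm_le A B x w : `|trig A B x w| <= `|A w| + `|B w|.
Proof.
apply: (le_trans (ler_normD _ _)); rewrite !normrM lerD//.
  by rewrite ler_piMr// cos_norm_le1.
by rewrite ler_piMr// sin_norm_le1.
Qed.

Lemma L1_trig A B x : L1 A -> L1 B -> L1 (trig A B x).
Proof. by move=> iA iB; apply: L1D; [exact: L1_mul_cos|exact: L1_mul_sin]. Qed.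

Lemma dotp_continuous w : continuous (fun u : 'rV[R]_n => dotp u w).
Proof.
have C (s : seq 'I_n) : continuous (fun u : 'rV[R]_n => \sum_(i <- s) u 0 i * w 0 i : R).
  elim: s => [|i s IH] z; first by under eq_fun do rewrite big_nil; exact: cst_continuous.
  have ci : {for z, continuous (fun u : 'rV[R]_n => u 0 i * w 0 i : R)}.
    have FF := nbhs_filter z.
    by apply: cvgM; [exact: coord_continuous|exact: cvg_cst].
  rewrite (_ : (fun z => _) = (fun u : 'rV[R]_n => u 0 i * w 0 i + \sum_(j <- s) u 0 j * w 0 j : R)).
    exact: (continuousD ci (IH z)).
  by apply/funext => y; rewrite big_cons.
exact: C.
Qed.

Lemma trig_continuous A B w x : trig A B u w @[u --> x] --> trig A B x w.
Proof.
have FF := nbhs_filter x.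
have cc : cos (dotp u w) @[u --> x] --> cos (dotp x w).
  by apply: (@continuous_comp _ _ _ (fun u : 'rV[R]_n => dotp u w) (@cos R));
    [exact: dotp_continuous|exact: continuous_cos].
have cs : sin (dotp u w) @[u --> x] --> sin (dotp x w).
  by apply: (@continuous_comp _ _ _ (fun u : 'rV[R]_n => dotp u w) (@sin R));
    [exact: dotp_continuous|exact: continuous_sin].
exact: (cvgD (cvgM (cvg_cst (A w)) cc) (cvgM (cvg_cst (B w)) cs)).
Qed.

Lemma trigint_continuous A B : L1 A -> L1 B -> continuous (trigint A B).
Proof.
move=> iA iB x.
apply: (@continuous_integral _ _ (trig A B) (fun w => `|A w| + `|B w|) x 1 ltr01).
- by move=> u; apply: L1_measurable; exact: L1_trig.
- by apply: L1D; exact: L1_norm.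
- by move=> u y _; exact: trig_norm_le.
- by apply: aeW => w; exact: trig_continuous.
Qed.

Lemma measurable_trigint A B : L1 A -> L1 B ->
  measurable_fun setT (trigint A B : lebRn R n -> R).
Proof. by move=> iA iB; apply: continuous_leb_measurable; exact: trigint_continuous. Qed.

Lemma trigint_bounded A B : L1 A -> L1 B ->
  exists2 K, 0 <= K & forall x, `|trigint A B x| <= K.
Proof.
move=> iA iB; have iN : L1 (fun w => `|A w| + `|B w|) by apply: L1D; exact: L1_norm.
exists (\int[mu]_w (`|A w| + `|B w|)).
  by apply: Rintegral_ge0 => w _; rewrite addr_ge0.
move=> x; apply: (le_trans (le_normr_Rintegral measurableT (L1_trig x iA iB))).
apply: le_Rintegral; first exact: measurableT.
- by apply: L1_norm; exact: L1_trig.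
- exact: iN.
- by move=> w _; exact: trig_norm_le.
Qed.

Definition cosint F w : R := \int[mu]_y (F y * cos (dotp w y)).
Definition sinint F w : R := \int[mu]_y (F y * sin (dotp w y)).

Lemma cosintE F : cosint F = trigint F (cst 0).
Proof.
by apply/funext => w; apply: eq_Rintegral => y _; rewrite /trig mul0r addr0.
Qed.

Lemma sinintE F : sinint F = trigint (cst 0) F.
Proof.
by apply/funext => w; apply: eq_Rintegral => y _; rewrite /trig mul0r add0r.
Qed.

Lemma L1_0 : L1 (cst 0 : 'rV[R]_n -> R).
Proof. exact: integrable0. Qed.

Lemma measurable_cosint F : L1 F -> measurable_fun setT (cosint F : lebRn R n -> R).
Proof. by move=> iF; rewrite cosintE; apply: measurable_trigint => //; exact: L1_0. Qed.

Lemma measurable_sinint F : L1 F -> measurable_fun setT (sinint F : lebRn R n -> R).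
Proof. by move=> iF; rewrite sinintE; apply: measurable_trigint => //; exact: L1_0. Qed.

Lemma cosint_bounded F : L1 F -> exists2 K, 0 <= K & forall x, `|cosint F x| <= K.
Proof. by move=> iF; rewrite cosintE; apply: trigint_bounded => //; exact: L1_0. Qed.

Lemma sinint_bounded F : L1 F -> exists2 K, 0 <= K & forall x, `|sinint F x| <= K.
Proof. by move=> iF; rewrite sinintE; apply: trigint_bounded => //; exact: L1_0. Qed.

(** The addition formulas turn a product of transforms into a double integral. *)
Lemma trig_transform F x w : L1 F ->
  trig (cosint F) (sinint F) x w = \int[mu]_y (F y * cos (dotp (y - x) w)).
Proof.
move=> iF; rewrite /trig /cosint /sinint mulrC [X in _ + X]mulrC.
rewrite -(RintegralZl _ measurableT (L1_mul_cos w iF)).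
rewrite -(RintegralZl _ measurableT (L1_mul_sin w iF)).
have i1 : L1 (fun y => cos (dotp x w) * (F y * cos (dotp w y))) by apply: L1Z; exact: L1_mul_cos.
have i2 : L1 (fun y => sin (dotp x w) * (F y * sin (dotp w y))) by apply: L1Z; exact: L1_mul_sin.
rewrite -(RintegralD measurableT i1 i2); apply: eq_Rintegral => y _.
rewrite dotpBl cosB (dotpC w y); ring.
Qed.

Lemma leb_fubini (H : 'rV[R]_n -> 'rV[R]_n -> R) :
  measurable_fun setT (fun z : lebRn R n * lebRn R n => H z.1 z.2) ->
  (forall x, L1 (H x)) -> (forall y, L1 (H^~ y)) ->
  (\int[mu]_x \int[mu]_y `|(H x y)%:E| < +oo)%E ->
  \int[mu]_x (\int[mu]_y H x y) = \int[mu]_y (\int[mu]_x H x y).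
Proof.
move=> mH i1 i2 Hoo; rewrite /Rintegral; congr fine.
have mHE : measurable_fun setT (fun z : lebRn R n * lebRn R n => (H z.1 z.2)%:E).
  exact/measurable_EFinP.
have iH : (mu \x mu)%E.-integrable setT (fun z : lebRn R n * lebRn R n => (H z.1 z.2)%:E).
  by apply/integrable12ltyP.
transitivity (\int[mu]_x \int[mu]_y (H x y)%:E)%E.
  by apply: eq_integral => x _; rewrite fineK//; exact: (integrable_fin_num measurableT (i1 x)).
rewrite (Fubini iH); apply: eq_integral => y _.
by rewrite fineK//; exact: (integrable_fin_num measurableT (i2 y)).
Qed.

(** Domination by a product makes all the integrability conditions of
    Fubini's theorem automatic. *)
Lemma leb_fubini_prod (H : 'rV[R]_n -> 'rV[R]_n -> R) F G :
  measurable_fun setT (fun z : lebRn R n * lebRn R n => H z.1 z.2) -> L1 F -> L1 G ->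
  (forall x y, `|H x y| <= `|F x| * `|G y|) ->
  \int[mu]_x (\int[mu]_y H x y) = \int[mu]_y (\int[mu]_x H x y).
Proof.
move=> mH iF iG HFG.
have m1 x : measurable_fun setT (H x : lebRn R n -> R).
  exact: (measurableT_comp mH (measurable_pair1 (x : lebRn R n))).
have m2 y : measurable_fun setT (H^~ y : lebRn R n -> R).
  exact: (measurableT_comp mH (measurable_pair2 (y : lebRn R n))).
have i1 x : L1 (H x) by exact: (L1_le (m1 x) (L1Z `|F x| (L1_norm iG))).
have i2 y : L1 (H^~ y).
  by apply: (L1_le (m2 y) (L1Z `|G y| (L1_norm iF))) => x; rewrite mulrC.
apply: leb_fubini; [exact: mH|exact: i1|exact: i2|].
have mG := L1_measurable iG; have mF := L1_measurable iF.
have [_ Goo] := integrableP _ _ _ iG; have [_ Foo] := integrableP _ _ _ iF.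
apply: (@le_lt_trans _ _ (\int[mu]_x (`|(F x)%:E| * \int[mu]_y `|(G y)%:E|))%E).
  apply: ge0_le_integral.
  - exact: measurableT.
  - by move=> x _; exact: integral_ge0.
  - have mHE : measurable_fun setT (fun z : lebRn R n * lebRn R n => `|(H z.1 z.2)%:E|%E).
      by apply: measurableT_comp; [exact: abse_measurable|exact/measurable_EFinP].
    by apply: (@measurable_fun_fubini_tonelli_F _ _ _ _ _ mu
      (fun z : lebRn R n * lebRn R n => `|(H z.1 z.2)%:E|%E)); [exact: mHE|].
  - apply: emeasurable_funM; last exact: measurable_cst.
    by apply: measurableT_comp; [exact: abse_measurable|exact/measurable_EFinP].
  - move=> x _.
    have mGE : measurable_fun setT (fun y : lebRn R n => `|(G y)%:E|%E).
      by apply: measurableT_comp; [exact: abse_measurable|exact/measurable_EFinP].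
    have G0 (y : lebRn R n) : setT y -> (0 <= `|(G y)%:E|)%E by [].
    rewrite -(ge0_integralZl mu measurableT mGE G0 (abse_ge0 _)).
    apply: ge0_le_integral.
    + exact: measurableT.
    + by [].
    + apply: measurableT_comp; first exact: abse_measurable.
      by apply/measurable_EFinP; exact: (L1_measurable (i1 x)).
    + by apply: emeasurable_funM; [exact: measurable_cst|exact: mGE].
    + by move=> y _; rewrite !abse_EFin -EFinM lee_fin.
have mFE : measurable_fun setT (fun y : lebRn R n => `|(F y)%:E|%E).
  by apply: measurableT_comp; [exact: abse_measurable|exact/measurable_EFinP].
have F0 (y : lebRn R n) : setT y -> (0 <= `|(F y)%:E|)%E by [].
have Gi0 : (0 <= \int[mu]_y `|(G y)%:E|)%E by exact: integral_ge0.
rewrite (ge0_integralZr mu measurableT mFE F0 Gi0).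
by apply: lte_mul_pinfty => //; [exact: integral_ge0|rewrite ge0_fin_numE//; exact: integral_ge0].
Qed.

End trigonometric_integrals.

(** * Gaussian summation of the inverse transform *)

Section gaussian_means.
Context {R : realType} {n : nat}.
Local Notation mu := (leb R n).
Local Notation L1 F := (mu.-integrable setT (EFin \o (F : lebRn R n -> R))).
Implicit Types (x y z u w : 'rV[R]_n) (F G A B : 'rV[R]_n -> R).
Hypothesis leb_neq0 : leb R n setT != 0%E.

(** By dilation, if one cube were null then all of them would be. *)
Lemma leb_cube_gt0 x r : 0 < r -> (0 < leb R n (cube x r))%E.
Proof.
move=> r0; rewrite leb_cube// mule_gt0 ?lte_fin ?exprn_gt0//.
rewrite lt_neqAle leb_outer_ge0 andbT eq_sym; apply/negP => /eqP c0.
move/negP : leb_neq0; apply; rewrite -cube0_bigcup; apply/eqP.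
apply/eqP; rewrite eq_le leb_outer_ge0 andbT.
apply: (le_trans (leb_outer_sigma_subadditive _)).
have c0' : leb_outer (cube (0 : 'rV[R]_n) 1) = 0%E by exact: c0.
rewrite eseries0// => -[|k] _ _; last first.
  by rewrite -[LHS]/(leb R n _) leb_cube ?ltr0Sn// c0 mule0.
apply/eqP; rewrite eq_le leb_outer_ge0 andbT -[leRHS]c0'.
by apply: le_leb_outer; apply: cubeS.
Qed.

(** An open set carries positive measure, so continuous functions that agree
    almost everywhere agree. *)
Lemma continuous_ae_eq F G : continuous F -> continuous G ->
  {ae mu, forall x, F x = G x} -> forall x, F x = G x.
Proof.
move=> cF cG [N [mN N0 FN]] x; apply: contrapT => nFG.
have cFG : continuous (fun y => F y - G y : R).
  by move=> y; exact: (continuousB (cF y) (cG y)).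
have FF := nbhs_filter x.
have nz : \forall y \near x, F y - G y != 0.
  have FG0 : F x - G x != 0 by rewrite subr_eq0; exact/eqP.
  have := cFG x; move/cvgrPdist_lt => /(_ `|F x - G x|); rewrite normr_gt0 => /(_ FG0).
  apply: (@filterS _ _ (nbhs_filter x)) => y; apply: contraTN => /eqP ->.
  by rewrite subr0 ltxx.
have [s s0 sN] := nbhs_cube nz.
have := leb_cube_gt0 x s0; rewrite ltNge => /negP; apply.
rewrite -N0; apply: le_leb_outer => y /sN Fy; apply: FN => /= E.
by move/negP : Fy; apply; rewrite E subrr.
Qed.

Lemma L1_gauss : L1 gauss.
Proof.
have E : gauss = (fun w : 'rV[R]_n => gauss w * cst 1 w) by apply/funext => w; rewrite mulr1.
rewrite E; apply: (@integrable_gauss_bounded R n (cst 1) 1); first exact: measurable_cst.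
by move=> w; rewrite normr1.
Qed.

Definition gmass : R := \int[mu]_w gauss w.

Lemma gmass_gt0 : 0 < gmass.
Proof.
rewrite lt_neqAle Rintegral_ge0 ?andbT => [|w _]; last exact: gauss_ge0.
apply/eqP => g0.
have mg : measurable_fun setT (EFin \o (gauss : lebRn R n -> R)) by case/integrableP: L1_gauss.
have : (\int[mu]_w `|(EFin \o gauss) w| = 0)%E.
  rewrite (eq_integral (fun w : lebRn R n => (gauss w)%:E)); last first.
    by move=> w _; rewrite /= ger0_norm// gauss_ge0.
  rewrite -[LHS]fineK; first by congr EFin.
  exact: (integrable_fin_num measurableT L1_gauss).
move/(ae_eq_integral_abs mu measurableT mg) => [N [mN N0 gN]].
move/negP : leb_neq0; apply; apply/eqP; apply/eqP.
rewrite eq_le leb_outer_ge0 andbT -[leRHS]N0; apply: le_leb_outer => w _.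
apply: gN => /= /(_ I) -[] /eqP; rewrite gt_eqF//; exact: gauss_gt0.
Qed.

Definition gkern w : R := gmass^-1 * gauss w.

Lemma gkern_ge0 w : 0 <= gkern w.
Proof. by rewrite mulr_ge0 ?gauss_ge0// invr_ge0 ltW// gmass_gt0. Qed.

Lemma gkern_decr x y : enorm x <= enorm y -> gkern y <= gkern x.
Proof. by move=> xy; rewrite ler_wpM2l ?gauss_decr// invr_ge0 ltW// gmass_gt0. Qed.

Lemma gkern_mass : (\int[mu]_w (gkern w)%:E = 1)%E.
Proof.
have iL := integrable_fin_num measurableT (L1Z gmass^-1 L1_gauss).
rewrite -[LHS]fineK; last exact: iL.
rewrite (_ : fine _ = \int[mu]_w (gmass^-1 * gauss w))//.
rewrite (RintegralZl _ measurableT L1_gauss) mulVf// gt_eqF//; exact: gmass_gt0.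
Qed.

Definition gkern_const : R := gmass^-1 * expR (n.+2%:R ^+ 2 / 2).

Lemma gkern_const_gt0 : 0 < gkern_const.
Proof. by rewrite mulr_gt0 ?expR_gt0// invr_gt0 gmass_gt0. Qed.

Lemma gkern_decay w : `|gkern w| <= gkern_const * (1 + enorm w) `^ (- (n%:R + 1)).
Proof.
rewrite ger0_norm ?gkern_ge0// /gkern /gkern_const -mulrA ler_wpM2l//.
  by rewrite invr_ge0 ltW// gmass_gt0.
have pE : poisson 1 1 w = (1 + enorm w) `^ (- (n%:R + 1)).
  by rewrite /poisson expr1n invr1 mul1r scale1r.
rewrite -pE; apply: le_trans (gauss_decay w).
by rewrite ler_peMl ?gauss_ge0// lerDl enorm_ge0.
Qed.

Lemma L1_gauss_scale e : 0 < e -> L1 (fun w => gauss (e *: w)).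
Proof.
move=> e0.
have E : (fun w => gauss (e *: w)) = (fun w : 'rV[R]_n => gauss (affine e 0 w)).
  by apply/funext => w; rewrite /affine addr0.
by rewrite E; exact: (integrable_affine 0 e0 L1_gauss).
Qed.

(** The Gaussian reproduces itself, so the transform of a dilated Gaussian is again
    a dilate of [gkern]. *)
Lemma integral_gauss_scale e x y : 0 < e ->
  \int[mu]_w (gauss (e *: w) * cos (dotp (y - x) w)) = gmass ^+ 2 * kern gkern e x y.
Proof.
move=> e0; pose f w := gauss w * cos (dotp (e^-1 *: (y - x)) w).
have if' : L1 f by apply: L1_mul_cos; exact: L1_gauss.
have := Rintegral_affine 0 e0 if'; rewrite /f integral_gauss_cos => H.
transitivity (e ^- n * (gauss (e^-1 *: (y - x)) * gmass)).
  rewrite -H; apply: eq_Rintegral => w _.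
  by rewrite /affine addr0 dotpZl dotpZr mulrA mulVf ?mul1r// gt_eqF.
rewrite /kern /hscale /gkern expr2.
have g0 := gmass_gt0; field.
by rewrite !gt_eqF// exprn_gt0.
Qed.

Let measurable_sub_dotp x : measurable_fun setT
  (fun z : lebRn R n * lebRn R n => cos (dotp (z.2 - x : 'rV[R]_n) z.1)).
Proof.
apply: measurable_cos_dotp => i; last exact: (measurableT_comp (measurable_coord i)).
under eq_fun do rewrite !mxE.
apply: measurable_funB; last exact: measurable_cst.
exact: (measurableT_comp (measurable_coord i)).
Qed.

Let measurable_gauss1 e : measurable_fun setT
  (fun z : lebRn R n * lebRn R n => gauss (e *: (z.1 : 'rV[R]_n))).
Proof.
apply: measurable_gauss => i; under eq_fun do rewrite !mxE.
apply: measurable_funM; first exact: measurable_cst.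
exact: (measurableT_comp (measurable_coord i)).
Qed.

(** Gaussian summation of the inverse transform amounts to convolution with
    the Gaussian density. *)
Lemma gauss_mean F e x : L1 F -> 0 < e ->
  \int[mu]_w (gauss (e *: w) * trig (cosint F) (sinint F) x w) =
  gmass ^+ 2 * kconv gkern e F x.
Proof.
move=> iF e0; have mF := L1_measurable iF.
transitivity (\int[mu]_w (\int[mu]_y (gauss (e *: w) * (F y * cos (dotp (y - x) w))))).
  apply: eq_Rintegral => w _; rewrite trig_transform//.
  have i1 : L1 (fun y => F y * cos (dotp (y - x) w)).
    apply: (L1_mul_bounded iF (K := 1)) => [|y]; last exact: cos_norm_le1.
    exact: (measurableT_comp (measurable_sub_dotp x) (measurable_pair1 (w : lebRn R n))).
  by rewrite (RintegralZl _ measurableT i1).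
rewrite (leb_fubini_prod (F := fun w => gauss (e *: w)) (G := F)); last first.
- move=> w y; rewrite !normrM mulrA ler_piMr ?mulr_ge0//; exact: cos_norm_le1.
- exact: iF.
- exact: L1_gauss_scale.
- apply: measurable_funM; first exact: measurable_gauss1.
  apply: measurable_funM; last exact: measurable_sub_dotp.
  exact: (measurableT_comp mF).
have ik := integrable_kern_mul gkern_ge0 gkern_decr ltr01 gkern_decay x (L1_L1Linf iF) e0.
rewrite /kconv -(RintegralZl _ measurableT ik); apply: eq_Rintegral => y _.
rewrite mulrA -integral_gauss_scale// mulrC.
have i2 : L1 (fun w => gauss (e *: w) * cos (dotp (y - x) w)).
  by apply: L1_mul_cos; exact: L1_gauss_scale.
rewrite -(RintegralZl _ measurableT i2).
by apply: eq_Rintegral => w _; ring.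
Qed.

End gaussian_means.

Arguments gmass : clear implicits.

(** * Plancherel's inequality and inversion *)

Section plancherel_and_inversion.
Context {R : realType} {n : nat}.
Local Notation mu := (leb R n).
Local Notation L1 F := (mu.-integrable setT (EFin \o (F : lebRn R n -> R))).
Implicit Types (x y z u w : 'rV[R]_n) (F G A B : 'rV[R]_n -> R).
Hypothesis leb_neq0 : leb R n setT != 0%E.

Let mass := gkern_mass leb_neq0.
Let ge0 := gkern_ge0 leb_neq0.
Let decr := gkern_decr leb_neq0.
Let decay := gkern_decay leb_neq0.
Let C0 := gkern_const_gt0 leb_neq0.

(** The squared modulus of the Fourier transform of [F]. *)
Definition power F w : R := cosint F w ^+ 2 + sinint F w ^+ 2.

Lemma power_ge0 F w : 0 <= power F w.
Proof. by rewrite addr_ge0// sqr_ge0. Qed.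

Lemma measurable_power F : L1 F -> measurable_fun setT (power F : lebRn R n -> R).
Proof.
move=> iF; apply: measurable_funD; apply: measurable_funX.
  exact: measurable_cosint.
exact: measurable_sinint.
Qed.

Lemma powerE F w : L1 F ->
  power F w = \int[mu]_x (F x * trig (cosint F) (sinint F) x w).
Proof.
move=> iF; rewrite /power !expr2 {1}/cosint {2}/sinint.
have i1 := L1_mul_cos w iF; have i2 := L1_mul_sin w iF.
rewrite -(RintegralZr _ measurableT i1) -(RintegralZr _ measurableT i2).
have j1 : L1 (fun y => F y * cos (dotp w y) * cosint F w).
  by apply: (L1_mul_bounded i1 (measurable_cst _) (K := `|cosint F w|)).
have j2 : L1 (fun y => F y * sin (dotp w y) * sinint F w).
  by apply: (L1_mul_bounded i2 (measurable_cst _) (K := `|sinint F w|)).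
rewrite -(RintegralD measurableT j1 j2); apply: eq_Rintegral => y _.
by rewrite /trig (dotpC y); ring.
Qed.

Let mul_kconv_le F e x : L1 F -> L1 (fun x => F x ^+ 2) -> 0 < e ->
  F x * kconv gkern e F x <= 2^-1 * (F x ^+ 2 + kconv gkern e (fun x => F x ^+ 2) x).
Proof.
move=> iF iF2 e0.
have ik := integrable_kern_mul ge0 decr ltr01 decay x (L1_L1Linf iF) e0.
have ik2 := integrable_kern_mul ge0 decr ltr01 decay x (L1_L1Linf iF2) e0.
have ik0 := integrable_kern ge0 decr mass x e0.
have k1 : \int[mu]_y kern gkern e x y = 1.
  by rewrite /Rintegral (integral_kern ge0 decr mass x e0).
have Fx2 : F x ^+ 2 = \int[mu]_y (F x ^+ 2 * kern gkern e x y).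
  by rewrite (RintegralZl _ measurableT ik0) k1 mulr1.
rewrite [in X in _ <= X]Fx2 /kconv.
have j0 : L1 (fun y => F x ^+ 2 * kern gkern e x y) by exact: L1Z.
rewrite -(RintegralD measurableT j0 ik2).
have j1 := L1D j0 ik2.
rewrite -(RintegralZl _ measurableT j1) -(RintegralZl _ measurableT ik).
apply: le_Rintegral; first exact: measurableT.
- exact: (L1Z (F x) ik).
- exact: (L1Z 2^-1 j1).
- move=> y _; have k0 : 0 <= kern gkern e x y by exact: kern_ge0.
  have := mulr_ge0 k0 (sqr_ge0 (F x - F y)); lra.
Qed.

Let measurable_kconv_L1 F e : L1 F -> 0 < e ->
  measurable_fun setT (kconv gkern e F : lebRn R n -> R).
Proof.
move=> iF e0; apply: continuous_leb_measurable => x.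
exact: (kconv_continuous ge0 decr mass C0 ltr01 decay (L1_L1Linf iF) e0).
Qed.

Let gauss_power_le F e : L1 F -> L1 (fun x => F x ^+ 2) -> 0 < e ->
  \int[mu]_w (gauss (e *: w) * power F w) <= gmass R n ^+ 2 * \int[mu]_x (F x ^+ 2).
Proof.
move=> iF iF2 e0; have mF := L1_measurable iF.
have [Kc Kc0 HKc] := cosint_bounded iF; have [Ks Ks0 HKs] := sinint_bounded iF.
have mc := measurable_cosint iF; have ms := measurable_sinint iF.
have tK x w : `|trig (cosint F) (sinint F) x w| <= Kc + Ks.
  by apply: (le_trans (trig_norm_le _ _ _ _)); exact: lerD.
have mt : measurable_fun setT (fun z : lebRn R n * lebRn R n =>
    trig (cosint F) (sinint F) z.2 z.1).
  apply: measurable_funD; apply: measurable_funM.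
  - exact: (measurableT_comp mc).
  - by apply: measurable_cos_dotp => i; exact: (measurableT_comp (measurable_coord i)).
  - exact: (measurableT_comp ms).
  - by apply: measurable_sin_dotp => i; exact: (measurableT_comp (measurable_coord i)).
have mg : measurable_fun setT (fun z : lebRn R n * lebRn R n => gauss (e *: (z.1 : 'rV[R]_n))).
  apply: measurable_gauss => i; under eq_fun do rewrite !mxE.
  apply: measurable_funM; first exact: measurable_cst.
  exact: (measurableT_comp (measurable_coord i)).
have it w : L1 (fun x => F x * trig (cosint F) (sinint F) x w).
  apply: (L1_mul_bounded iF (K := Kc + Ks)) => [|x]; last exact: tK.
  exact: (measurableT_comp mt (measurable_pair1 (w : lebRn R n))).
have -> : \int[mu]_w (gauss (e *: w) * power F w) =
    \int[mu]_w \int[mu]_x (gauss (e *: w) * (F x * trig (cosint F) (sinint F) x w)).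
  by apply: eq_Rintegral => w _; rewrite (powerE w iF) -(RintegralZl _ measurableT (it w)).
rewrite (leb_fubini_prod (F := fun w => (Kc + Ks) * gauss (e *: w)) (G := F)); last first.
- move=> w x; rewrite !normrM (ger0_norm (addr_ge0 Kc0 Ks0)).
  rewrite [X in _ <= X](_ : _ = `|gauss (e *: w)| * (`|F x| * (Kc + Ks))); last by ring.
  by apply: ler_wpM2l => //; exact: ler_wpM2l.
- exact: iF.
- by apply: L1Z; exact: L1_gauss_scale.
- apply: measurable_funM; first exact: mg.
  apply: measurable_funM; last exact: mt.
  exact: (measurableT_comp mF).
have -> : \int[mu]_x \int[mu]_w (gauss (e *: w) * (F x * trig (cosint F) (sinint F) x w)) =
    \int[mu]_x (gmass R n ^+ 2 * (F x * kconv gkern e F x)).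
  apply: eq_Rintegral => x _; rewrite mulrCA -(gauss_mean leb_neq0 x iF e0).
  have i3 : L1 (fun w => gauss (e *: w) * trig (cosint F) (sinint F) x w).
    apply: (L1_mul_bounded (L1_gauss_scale e0) (K := Kc + Ks)) => [|w]; last exact: tK.
    exact: (measurableT_comp mt (measurable_pair2 (x : lebRn R n))).
  by rewrite -(RintegralZl _ measurableT i3); apply: eq_Rintegral => w _; ring.
have F20 x : 0 <= F x ^+ 2 by exact: sqr_ge0.
have iq := integrable_kconv ge0 decr mass ltr01 decay F20 iF2 e0.
have iM : L1 (fun x => 2^-1 * (F x ^+ 2 + kconv gkern e (fun x => F x ^+ 2) x)).
  by apply: L1Z; exact: L1D.
have [b Hb] : exists b, forall x, `|kconv gkern e F x| <= b.
  have [b b0 Hb] := kavg_bounded ge0 decr C0 ltr01 decay (L1_L1Linf iF) e0.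
  exists b => x; rewrite -lee_fin; apply: le_trans (Hb x).
  apply: (le_trans (abs_Rintegral_le mu _)).
    by apply: measurable_funM; [exact: (measurable_kern decr x e0)|exact: mF].
  rewrite le_eqVlt; apply/orP; left; apply/eqP; apply: eq_integral => y _.
  by rewrite normrM (ger0_norm (kern_ge0 ge0 x y e0)) -EFinM.
have iL : L1 (fun x => F x * kconv gkern e F x).
  exact: (L1_mul_bounded iF (measurable_kconv_L1 iF e0) Hb).
rewrite (RintegralZl _ measurableT iL) ler_wpM2l ?sqr_ge0//.
have -> : \int[mu]_x (F x ^+ 2) =
    \int[mu]_x (2^-1 * (F x ^+ 2 + kconv gkern e (fun x => F x ^+ 2) x)).
  have iD := L1D iF2 iq.
  rewrite (RintegralZl _ measurableT iD) (RintegralD measurableT iF2 iq).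
  rewrite [X in _ + X](_ : _ = \int[mu]_x (F x ^+ 2)); first by field.
  by rewrite /Rintegral (integral_kconv ge0 decr mass ltr01 decay F20 iF2 e0).
apply: le_Rintegral; first exact: measurableT.
- exact: iL.
- exact: iM.
- by move=> x _; exact: mul_kconv_le.
Qed.

Let scale_cvg w : gauss (k.+1%:R^-1 *: w) @[k --> \oo] --> (1 : R).
Proof.
have c0 : - ((k.+1%:R^-1 * enorm w) ^+ 2 / 2) @[k --> \oo] --> - ((0 * enorm w) ^+ 2 / 2).
  apply: cvgN; apply: cvgM; last exact: cvg_cst.
  have c1 : k.+1%:R^-1 * enorm w @[k --> \oo] --> 0 * enorm w.
    by apply: cvgM; [exact: cvg_harmonic|exact: cvg_cst].
  exact: (cvgM c1 c1).
rewrite (_ : (fun k => _) = fun k => expR (- ((k.+1%:R^-1 * enorm w) ^+ 2 / 2))); last first.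
  by apply/funext => k; rewrite /gauss enormZ ger0_norm.
rewrite -[X in _ --> X](_ : expR (- ((0 * enorm w) ^+ 2 / 2)) = 1); last first.
  by rewrite mul0r expr0n/= mul0r oppr0 expR0.
exact: (continuous_cvg _ (@continuous_expR R _) c0).
Qed.

(** Half of Plancherel's identity: the energy of the transform, cut off by a wide
    Gaussian, is the scalar product of [F] with a Gaussian mean of [F]. *)
Lemma plancherel_le F : L1 F -> L1 (fun x => F x ^+ 2) ->
  (\int[mu]_w (power F w)%:E <= (gmass R n ^+ 2 * \int[mu]_x (F x ^+ 2))%:E)%E.
Proof.
move=> iF iF2; have mp := measurable_power iF.
pose g (k : nat) (w : lebRn R n) := (gauss (k.+1%:R^-1 *: w) * power F w)%:E.
have [Kc Kc0 HKc] := cosint_bounded iF; have [Ks Ks0 HKs] := sinint_bounded iF.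
have ke (k : nat) : 0 < k.+1%:R^-1 :> R by rewrite invr_gt0.
have ig k : mu.-integrable setT (g k).
  apply: (L1_mul_bounded (L1_gauss_scale (ke k)) mp (K := Kc ^+ 2 + Ks ^+ 2)) => w.
  rewrite ger0_norm ?power_ge0// /power -real_normK ?num_real// -[X in _ + X]real_normK ?num_real//.
  by rewrite lerD// lerXn2r ?nnegrE.
have g0 k w : (0 <= g k w)%E by rewrite lee_fin mulr_ge0 ?gauss_ge0// power_ge0.
have mono w : setT w -> {homo g^~ w : k l / (k <= l)%N >-> (k <= l)%E}.
  move=> _ k l kl; rewrite lee_fin ler_wpM2r ?power_ge0// gauss_decr// !enormZ.
  by rewrite ler_wpM2r ?enorm_ge0// !ger0_norm// lef_pV2 ?posrE// ler_nat.
have := cvg_monotone_convergence (mu := mu) measurableT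
  (fun k => measurable_int mu (ig k)) (fun k w _ => g0 k w) mono.
rewrite (eq_integral (fun w : lebRn R n => (power F w)%:E)); last first.
  move=> w _; apply/cvg_lim => //; apply/fine_cvgP; split; first exact: nearW.
  rewrite -[X in _ --> X]mul1r.
  by apply: cvgM; [exact: scale_cvg|exact: cvg_cst].
move=> cg; rewrite -(cvg_lim _ cg)//; apply: lime_le; first by apply/cvg_ex; eexists; exact: cg.
apply: nearW => k.
have := gauss_power_le iF iF2 (ke k); rewrite -lee_fin; apply: le_trans.
by rewrite /Rintegral fineK//; exact: (integrable_fin_num measurableT (ig k)).
Qed.

(** The Gaussian sums of the inverse transform are Gaussian means of [G]. As the
    cut-off widens, the sums converge by dominated convergence and the means
    tend to [G] almost everywhere; continuity of both limits removes the
    exceptional set. *)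
Lemma fourier_inversion G x : L1 G -> continuous G -> L1 (cosint G) -> L1 (sinint G) ->
  gmass R n ^+ 2 * G x = trigint (cosint G) (sinint G) x.
Proof.
move=> iG cG iC iS; move: x; apply: (continuous_ae_eq leb_neq0).
- move=> x; have FF := nbhs_filter x.
  by apply: cvgM; [exact: cvg_cst|exact: cG].
- exact: trigint_continuous.
have := ae_kconv_cvg ge0 decr mass C0 ltr01 decay (L1_L1Linf iG).
apply: leb_aeS => x cx.
have ke (k : nat) : 0 < k.+1%:R^-1 :> R by rewrite invr_gt0.
have c1 := (cvg_at_rightP _ _ _).1 cx _ (conj ke (@cvg_harmonic R)).
have c2 : gmass R n ^+ 2 * kconv gkern k.+1%:R^-1 G x @[k --> \oo] --> gmass R n ^+ 2 * G x.
  by apply: cvgM; [exact: cvg_cst|exact: c1].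
suff c3 : gmass R n ^+ 2 * kconv gkern k.+1%:R^-1 G x @[k --> \oo] -->
    trigint (cosint G) (sinint G) x by exact: (cvg_unique _ c2 c3).
rewrite (_ : (fun k => _) = (fun k : nat => \int[mu]_w
    (gauss (k.+1%:R^-1 *: w) * trig (cosint G) (sinint G) x w))); last first.
  by apply/funext => k; rewrite -(gauss_mean leb_neq0 x iG (ke k)).
have it := L1_trig x iC iS.
have ig k : L1 (fun w => gauss (k.+1%:R^-1 *: w) * trig (cosint G) (sinint G) x w).
  rewrite (_ : (fun w => _) = (fun w => trig (cosint G) (sinint G) x w * gauss (k.+1%:R^-1 *: w))).
    apply: (L1_mul_bounded it (L1_measurable (L1_gauss_scale (ke k))) (K := 1)) => w.
    by rewrite ger0_norm ?gauss_ge0// gauss_le1.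
  by apply/funext => w; rewrite mulrC.
have cw : {ae mu, forall w, setT w ->
    (gauss (k.+1%:R^-1 *: w) * trig (cosint G) (sinint G) x w)%:E @[k --> \oo] -->
    (trig (cosint G) (sinint G) x w)%:E}.
  apply: aeW => w _; apply/fine_cvgP; split; first exact: nearW.
  rewrite -[X in _ --> X]mul1r.
  by apply: cvgM; [exact: scale_cvg|exact: cvg_cst].
have dw : {ae mu, forall w (k : nat), setT w ->
    (`|(gauss (k.+1%:R^-1 *: w) * trig (cosint G) (sinint G) x w)%:E| <=
    `|trig (cosint G) (sinint G) x w|%:E)%E}.
  apply: aeW => w k _.
  by rewrite lee_fin normrM ger0_norm ?gauss_ge0// ler_piMl// gauss_le1.
have [_ _ ] := dominated_convergence measurableT
  (fun k => measurable_int mu (ig k)) (measurable_int mu it) cw (L1_norm it) dw.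
rewrite /trigint /Rintegral; set I := (\int[mu]_w (trig _ _ x w)%:E)%E.
have -> : I = (fine I)%:E by rewrite fineK//; exact: (integrable_fin_num measurableT it).
by case/fine_cvgP.
Qed.

End plancherel_and_inversion.

(** * Functions with continuous partial derivatives *)

Section frechet.
Context {R : realType} {n : nat}.
Implicit Types (x y z u w : 'rV[R]_n) (f g : 'rV[R]_n -> R).

Lemma differentiable_eps f x : differentiable f x ->
  forall e : R, 0 < e -> \forall h \near (0 : 'rV[R]_n),
    `|f (h + x) - f x - 'd f x h| <= e * `|h|.
Proof.
move=> /diff_locally /eqaddoP df e e0.
have := df _ e0; apply: (@filterS _ _ (nbhs_filter (0 : 'rV[R]_n))) => h.
by rewrite !fctE /= opprD addrA.
Qed.

Lemma eps_differentiable f x (L : {linear 'rV[R]_n -> R}) : continuous L ->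
  (forall e : R, 0 < e -> \forall h \near (0 : 'rV[R]_n),
    `|f (h + x) - f x - L h| <= e * `|h|) ->
  differentiable f x /\ 'd f x = L :> ('rV[R]_n -> R).
Proof.
move=> cL H.
have E : f \o shift x = cst (f x) + L +o_ (nbhs (0 : 'rV[R]_n)) id.
  apply/eqaddoP => e e0; have := H e e0.
  apply: (@filterS _ _ (nbhs_filter (0 : 'rV[R]_n))) => h.
  by rewrite !fctE /= opprD addrA.
have D := diff_unique cL E.
by split=> //; apply/diff_locallyP; rewrite D.
Qed.

Lemma near_eq_differentiable f g x : (\forall y \near x, f y = g y) ->
  differentiable f x -> differentiable g x.
Proof.
move=> fg df; suff [] : differentiable g x /\ 'd g x = 'd f x :> ('rV[R]_n -> R) by [].
apply: eps_differentiable; first exact: diff_continuous.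
move=> e e0; have fgx : f x = g x by exact: (nbhs_singleton fg).
have F0 := nbhs_filter (0 : 'rV[R]_n).
have s : \forall h \near (0 : 'rV[R]_n), f (h + x) = g (h + x).
  have c : (fun h : 'rV[R]_n => h + x) h @[h --> (0 : 'rV[R]_n)] --> x.
    by rewrite -[X in _ --> X]add0r; apply: cvgD; [exact: cvg_id|exact: cvg_cst].
  exact: (c _ fg).
by apply: filterS2 s (differentiable_eps df e0) => h <-; rewrite fgx.
Qed.

End frechet.

Section Cr_algebra.
Context {R : realType} {n : nat}.
Implicit Types (x y z u w : 'rV[R]_n) (f g : 'rV[R]_n -> R).
Variable Omega : set 'rV[R]_n.
Hypothesis oOmega : open Omega.

Let near_Omega x : Omega x -> nbhs x Omega.
Proof. by move=> Ox; apply: open_nbhs_nbhs; split. Qed.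

Lemma Cr_ext r f g : (forall x, Omega x -> f x = g x) -> Cr Omega r f -> Cr Omega r g.
Proof.
elim: r f g => [|r IH] f g fg /=.
  by apply: subspace_eq_continuous => x /set_mem Ox; exact: fg.
have nfg x : Omega x -> \forall y \near x, f y = g y.
  by move=> Ox; apply: (@filterS _ _ (nbhs_filter x) _ _ fg); exact: near_Omega.
move=> [df pf]; split=> [x Ox|i].
  by apply: near_eq_differentiable (df x Ox); exact: nfg.
by apply: IH (pf i) => x Ox; apply: near_eq_derive; exact: nfg.
Qed.

Lemma Cr_continuous r f : Cr Omega r f -> {within Omega, continuous f}.
Proof.
case: r => [//|r] [df _]; rewrite continuous_open_subspace// => x /set_mem Ox.
exact: differentiable_continuous (df x Ox).
Qed.

Lemma CrS r f : Cr Omega r.+1 f -> Cr Omega r f.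
Proof.
elim: r f => [|r IH] f; first exact: Cr_continuous.
by move=> [df pf]; split=> // i; exact: IH.
Qed.

Lemma Cr_cst r (c : R) : Cr Omega r (cst c).
Proof.
elim: r c => [|r IH] c; first by apply: continuous_subspaceT => x; exact: cst_continuous.
split=> [x _|i]; first exact: differentiable_cst.
by rewrite (_ : (fun x => _) = cst 0)//; apply/funext => x; rewrite derive_cst.
Qed.

Lemma CrD r f g : Cr Omega r f -> Cr Omega r g -> Cr Omega r (f + g).
Proof.
elim: r f g => [|r IH] f g /=.
  move=> cf cg; move: cf cg; rewrite !continuous_open_subspace// => cf cg x Ox.
  exact: (continuousD (cf x Ox) (cg x Ox)).
move=> [df pf] [dg pg]; split=> [x Ox|i].
  by apply: differentiableD; [exact: df|exact: dg].
apply: (Cr_ext _ (IH _ _ (pf i) (pg i))) => x Ox.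
by rewrite deriveD//; apply: diff_derivable; [exact: df|exact: dg].
Qed.

Lemma CrM r f g : Cr Omega r f -> Cr Omega r g -> Cr Omega r (f * g).
Proof.
elim: r f g => [|r IH] f g.
  move=> /= cf cg; move: cf cg; rewrite !continuous_open_subspace// => cf cg x Ox.
  exact: (continuousM (cf x Ox) (cg x Ox)).
move=> Cf Cg; have cf := CrS Cf; have cg := CrS Cg.
case: Cf => [df pf]; case: Cg => [dg pg]; split=> [x Ox|i].
  by apply: differentiableM; [exact: df|exact: dg].
apply: (Cr_ext _ (CrD (IH _ _ cf (pg i)) (IH _ _ cg (pf i)))) => x Ox.
by rewrite deriveM//; apply: diff_derivable; [exact: df|exact: dg].
Qed.

(** The derivative of [1 / f] is a product of functions of lower order, among them
    [1 / f] itself. *)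
Lemma CrV r f : (forall x, Omega x -> f x != 0) -> Cr Omega r f ->
  Cr Omega r (fun x => (f x)^-1).
Proof.
move=> f0; elim: r => [|r IH].
  move=> /= cf; move: cf; rewrite !continuous_open_subspace// => cf x Ox.
  by apply: (continuousV _ (cf x Ox)); apply: f0; exact: set_mem.
move=> Cf; have cV := IH (CrS Cf); case: Cf => [df pf]; split=> [x Ox|i].
  by apply: differentiableV; [exact: df|exact: f0].
apply: (Cr_ext _ (CrM (Cr_cst r (-1)) (CrM (CrM cV cV) (pf i)))) => x Ox.
rewrite deriveV; [|exact: f0|by apply: diff_derivable; exact: df].
rewrite !fctE /GRing.scale/= expr2 invfM; ring.
Qed.

End Cr_algebra.

(** * Smoothness of trigonometric integrals *)

Section trigonometric_remainder.
Context {R : realType}.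
Implicit Types b : R.

Let mvt (f df : R -> R) b (K : R) : 0 <= b ->
  (forall t, is_derive t (1 : R) f (df t)) -> (forall t, 0 <= t <= b -> `|df t| <= K) ->
  `|f b - f 0| <= K * b.
Proof.
move=> b0 fd dK.
have [c|c cb ->] := @MVT_segment R f df 0 b b0 (fun t _ => fd t).
  by apply: continuous_subspaceT => t; apply/differentiable_continuous/derivable1_diffP; exact: ex_derive.
by move: cb; rewrite subr0 normrM (ger0_norm b0) in_itv/= => cb; rewrite ler_wpM2r// dK.
Qed.

Let sin_le b : 0 <= b -> `|sin b| <= b.
Proof.
move=> b0; have := @mvt sin cos b 1 b0 (fun t => is_derive_sin t) (fun t _ => cos_norm_le1 t).
by rewrite sin0 subr0 mul1r.
Qed.

Let cos_le b : 0 <= b -> `|cos b - 1| <= b * Num.min 1 b.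
Proof.
move=> b0; have m1 : 0 <= Num.min 1 b by rewrite le_min ler01.
have := @mvt cos (fun t => - sin t) b (Num.min 1 b) b0 (fun t => is_derive_cos t).
rewrite cos0 (mulrC b); apply => t /andP[t0 tb].
by rewrite normrN le_min sin_norm_le1 (le_trans (sin_le t0)).
Qed.

Let sin_sub_le b : 0 <= b -> `|sin b - b| <= b * (2 * Num.min 1 b).
Proof.
move=> b0.
have fd (t : R) : is_derive t (1 : R) (fun t => sin t - t) (cos t - 1).
  exact: (is_deriveB (is_derive_sin t) (is_derive_id t (1 : R))).
have := @mvt (fun t => sin t - t) (fun t => cos t - 1) b (2 * Num.min 1 b) b0 fd.
rewrite sin0 !subr0 (mulrC b); apply => t /andP[t0 tb].
have [t1|t1] := leP 1 t.
  have b1 : 1 <= b by exact: le_trans tb.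
  rewrite min_l// mulr1 (le_trans (ler_normB _ _))// normr1.
  by have := cos_norm_le1 t; lra.
apply: (le_trans (cos_le t0)); rewrite (min_r (ltW t1)).
have : t * t <= t by rewrite ler_piMr// ltW.
have : t <= Num.min 1 b by rewrite le_min tb (ltW t1).
lra.
Qed.

(** First-order Taylor remainders of [cos] and [sin], in a form that is both
    bounded by a multiple of [|b|] and small compared with it near 0. *)
Lemma trig_remainder b :
  `|cos b - 1| + `|sin b - b| <= 3 * (`|b| * Num.min 1 `|b|).
Proof.
wlog b0 : b / 0 <= b => [H|].
  have [|/ltW b0] := leP 0 b; first exact: H.
  have := H (- b); rewrite oppr_ge0 cosN sinN normrN -opprD normrN.
  by move=> /(_ b0).
rewrite (ger0_norm b0); have := cos_le b0; have := sin_sub_le b0; lra.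
Qed.

End trigonometric_remainder.

Section smooth_trigonometric_integrals.
Context {R : realType} {n : nat}.
Local Notation mu := (leb R n).
Local Notation L1 F := (mu.-integrable setT (EFin \o (F : lebRn R n -> R))).
Implicit Types (x y z u w h : 'rV[R]_n) (F G A B : 'rV[R]_n -> R).

Lemma enorm_le_norm h : enorm h <= n%:R * `|h|.
Proof.
have H i : `|h 0 i| <= `|h|.
  rewrite [leRHS]mx_normrE.
  exact: (le_bigmax 0 (fun ij : 'I_1 * 'I_n => `|h ij.1 ij.2|) (0, i)).
rewrite -[leRHS]ger0_norm ?mulr_ge0// -sqrtr_sqr; apply: ler_wsqrtr.
rewrite exprMn; apply: (@le_trans _ _ (\sum_(i < n) `|h| ^+ 2)).
  apply: ler_sum => i _; rewrite -real_normK ?num_real//.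
  by rewrite lerXn2r ?nnegrE.
rewrite sumr_const card_ord -[leLHS]mulr_natl ler_wpM2r ?sqr_ge0//.
by rewrite -natrX ler_nat -{1}(expn1 n); case: (n) => // m; rewrite leq_pexp2l.
Qed.

(** The scalar product as a bundled linear function of its left argument, the form
    in which differentials are stated. *)
Definition dotpl w h : R := dotp h w.

Let dotpl_linear w : linear (dotpl w).
Proof. by move=> a x y; rewrite /dotpl dotpDl dotpZl. Qed.

HB.instance Definition _ w := GRing.isLinear.Build R 'rV[R]_n R *:%R (dotpl w) (dotpl_linear w).

Let trigD A B x w h : trig A B (h + x) w - trig A B x w - dotp h w * trig B (fun w => - A w) x w =
  trig A B x w * (cos (dotp h w) - 1)
  + trig B (fun w => - A w) x w * (sin (dotp h w) - dotp h w).
Proof. rewrite /trig dotpDl cosD sinD; ring. Qed.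

Let trig_remainder_le A B x w h :
  `|trig A B (h + x) w - trig A B x w - dotp h w * trig B (fun w => - A w) x w| <=
  3 * ((`|A w| + `|B w|) * (`|dotp h w| * Num.min 1 `|dotp h w|)).
Proof.
rewrite trigD; apply: (le_trans (ler_normD _ _)); rewrite !normrM.
have t1 := trig_norm_le A B x w.
have t2 := trig_norm_le B (fun w => - A w) x w; rewrite normrN addrC in t2.
apply: (@le_trans _ _ ((`|A w| + `|B w|) *
    (`|cos (dotp h w) - 1| + `|sin (dotp h w) - dotp h w|))).
  by rewrite mulrDr lerD// ler_wpM2r.
by rewrite mulrCA ler_wpM2l ?addr_ge0// trig_remainder.
Qed.

Let partial A B x (i : 'I_n) :=
  trigint (fun w => w 0 i * B w) (fun w => w 0 i * - A w) x.

Section derivative.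
Variables (A B : 'rV[R]_n -> R) (x : 'rV[R]_n).
Hypotheses (iA : L1 A) (iB : L1 B).
Hypotheses (iwA : L1 (fun w => enorm w * A w)) (iwB : L1 (fun w => enorm w * B w)).

Let mcoord (i : 'I_n) : measurable_fun setT (fun w : lebRn R n => (w : 'rV[R]_n) 0 i).
Proof. exact: measurable_coord. Qed.

Let L1_coord (i : 'I_n) F : L1 F -> L1 (fun w => enorm w * F w) -> L1 (fun w => w 0 i * F w).
Proof.
move=> iF iwF; apply: (L1_le _ (L1_norm iwF)).
  by apply: measurable_funM; [exact: mcoord|exact: L1_measurable].
move=> w; rewrite !normrM ler_wpM2r// (le_trans (le_coord_enorm w i))//.
exact: ler_norm.
Qed.

Let iNA : L1 (fun w => - A w).
Proof. by have := L1Z (-1) iA; under eq_fun do rewrite mulN1r. Qed.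

Let iwNA : L1 (fun w => enorm w * - A w).
Proof. by have := L1Z (-1) iwA; under eq_fun do rewrite mulN1r -mulrN. Qed.

Let coordE (i : 'I_n) w : trig (fun w => w 0 i * B w) (fun w => w 0 i * - A w) x w =
  w 0 i * trig B (fun w => - A w) x w.
Proof. rewrite /trig; ring. Qed.

Let grad_sum h (s : seq 'I_n) :
  L1 (fun w => (\sum_(i <- s) h 0 i * w 0 i) * trig B (fun w => - A w) x w) /\
  \int[mu]_w ((\sum_(i <- s) h 0 i * w 0 i) * trig B (fun w => - A w) x w) =
  \sum_(i <- s) h 0 i * partial A B x i.
Proof.
elim: s => [|i s [IH1 IH2]].
  rewrite (_ : (fun w => _) = cst 0); last by apply/funext => w; rewrite big_nil mul0r.
  by split; [exact: L1_0|rewrite /Rintegral integral0 big_nil].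
have it := L1_trig x (L1_coord i iB iwB) (L1_coord i iNA iwNA).
have iht := L1Z (h 0 i) it.
rewrite (_ : (fun w => _) = (fun w => h 0 i * trig (fun w => w 0 i * B w) (fun w => w 0 i * - A w) x w
   + (\sum_(i <- s) h 0 i * w 0 i) * trig B (fun w => - A w) x w)); last first.
  by apply/funext => w; rewrite big_cons mulrDl coordE mulrA.
split; first exact: L1D.
by rewrite (RintegralD measurableT iht IH1) IH2 (RintegralZl _ measurableT it) big_cons.
Qed.

Let grad := \row_i partial A B x i.

Let grad_int h : L1 (fun w => dotp h w * trig B (fun w => - A w) x w) /\
  \int[mu]_w (dotp h w * trig B (fun w => - A w) x w) = dotpl grad h.
Proof.
have [g1 g2] := grad_sum h (index_enum 'I_n); split; first exact: g1.
by rewrite g2; apply: eq_bigr => i _; rewrite mxE.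
Qed.

Let W w := enorm w * (`|A w| + `|B w|).

Let W_ge0 w : 0 <= W w. Proof. by rewrite mulr_ge0 ?enorm_ge0// addr_ge0. Qed.

Let iW : L1 W.
Proof.
have := L1D (L1_norm iwA) (L1_norm iwB).
rewrite (_ : (fun w => _ + _) = W)//; apply/funext => w.
by rewrite /W !normrM (ger0_norm (enorm_ge0 w)) mulrDr.
Qed.

(* The remainder of the first-order expansion at increment [h] is at most
   [|h| Phi |h|] up to constants, and [Phi] tends to 0 at 0 by dominated convergence. *)
Let Phi (s : R) := \int[mu]_w (W w * Num.min 1 (s * enorm w)).

Let menorm : measurable_fun setT (@enorm R n : lebRn R n -> R).
Proof. by apply: measurable_enorm_comp => i; exact: mcoord. Qed.

Let mmin s : measurable_fun setT (fun w : lebRn R n => Num.min 1 (s * enorm w)).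
Proof.
apply: measurable_minr; first exact: measurable_cst.
by apply: measurable_funM; [exact: measurable_cst|exact: menorm].
Qed.

Let min1 s w : 0 <= s -> `|Num.min 1 (s * enorm w)| <= 1.
Proof.
by move=> s0; rewrite ger0_norm ?ge_min ?lexx// le_min ler01 mulr_ge0// enorm_ge0.
Qed.

Let iPhi s : 0 <= s -> L1 (fun w => W w * Num.min 1 (s * enorm w)).
Proof.
by move=> s0; apply: (L1_mul_bounded iW (mmin s) (K := 1)) => w; exact: min1.
Qed.

Let Phi_mono s t : 0 <= s <= t -> Phi s <= Phi t.
Proof.
move=> /andP[s0 st]; apply: le_Rintegral; first exact: measurableT.
- exact: iPhi.
- by apply: iPhi; exact: le_trans st.
- move=> w _; rewrite ler_wpM2l//.
  by rewrite le_min !ge_min lexx/= ler_wpM2r ?orbT ?enorm_ge0.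
Qed.

Let Phi_cvg0 : Phi k.+1%:R^-1 @[k --> \oo] --> (0 : R).
Proof.
have cw : {ae mu, forall w, setT w ->
    (W w * Num.min 1 (k.+1%:R^-1 * enorm w))%:E @[k --> \oo] --> 0%E}.
  apply: aeW => w _; apply/fine_cvgP; split; first exact: nearW.
  have c : W w * (k.+1%:R^-1 * enorm w) @[k --> \oo] --> W w * (0 * enorm w).
    by apply: cvgM; [exact: cvg_cst|apply: cvgM; [exact: cvg_harmonic|exact: cvg_cst]].
  rewrite mul0r mulr0 in c.
  apply: (squeeze_cvgr _ (cvg_cst 0) c); apply: nearW => k /=.
  rewrite mulr_ge0//=; last by rewrite le_min ler01 mulr_ge0 ?enorm_ge0.
  by rewrite ler_wpM2l// ge_min lexx orbT.
have dw : {ae mu, forall w (k : nat), setT w ->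
    (`|(W w * Num.min 1 (k.+1%:R^-1 * enorm w))%:E| <= (W w)%:E)%E}.
  apply: aeW => w k _; rewrite lee_fin normrM (ger0_norm (W_ge0 w)) ler_piMr//.
  exact: min1.
have k0 (k : nat) : 0 <= k.+1%:R^-1 :> R by rewrite invr_ge0.
have [_ _ ] := dominated_convergence measurableT
  (fun k => measurable_int mu (iPhi (k0 k))) (measurable_cst _) cw iW dw.
by rewrite integral_cst// mul0e => /fine_cvgP[].
Qed.

Let remainder_le h :
  `|trigint A B (h + x) - trigint A B x - dotpl grad h| <=
  3 * (n%:R * enorm h * Phi (n%:R * enorm h)).
Proof.
have [ig gE] := grad_int h; have i1 := L1_trig (h + x) iA iB; have i2 := L1_trig x iA iB.
have s0 : 0 <= n%:R * enorm h by rewrite mulr_ge0// enorm_ge0.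
have i12 : L1 (fun w => trig A B (h + x) w - trig A B x w) by exact: (integrableB measurableT i1 i2).
have i3 : L1 (fun w => trig A B (h + x) w - trig A B x w - dotp h w * trig B (fun w => - A w) x w).
  exact: (integrableB measurableT i12 ig).
rewrite -gE /trigint -(RintegralB measurableT i1 i2) -(RintegralB measurableT i12 ig).
apply: (le_trans (le_normr_Rintegral measurableT i3)).
rewrite mulrA -(RintegralZl _ measurableT (iPhi s0)).
apply: le_Rintegral; first exact: measurableT.
- exact: L1_norm.
- exact: (L1Z _ (iPhi s0)).
move=> w _; apply: (le_trans (trig_remainder_le A B x w h)).
have dw : `|dotp h w| <= n%:R * enorm h * enorm w by exact: dotp_le.
have m0 : 0 <= Num.min 1 `|dotp h w| by rewrite le_min ler01/=.
have mm : Num.min 1 `|dotp h w| <= Num.min 1 (n%:R * enorm h * enorm w).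
  by rewrite le_min !ge_min lexx/= dw orbT.
have AB0 : 0 <= `|A w| + `|B w| by rewrite addr_ge0.
have H := ler_wpM2l AB0 (ler_pM (normr_ge0 _) m0 dw mm).
rewrite [X in _ <= X](_ : _ = 3 * ((`|A w| + `|B w|) *
  (n%:R * enorm h * enorm w * Num.min 1 (n%:R * enorm h * enorm w)))).
  by apply: ler_wpM2l.
by rewrite /W; ring.
Qed.

Lemma trigint_differentiable : differentiable (trigint A B) x /\
  'd (trigint A B) x = dotpl grad :> ('rV[R]_n -> R).
Proof.
apply: eps_differentiable; first by move=> u; exact: dotp_continuous.
move=> e e0.
have N0 : 0 < 3 * (n%:R * n%:R) + 1 :> R by rewrite ltr_wpDl// mulr_ge0// mulr_ge0.
have d0 : 0 < e / (3 * (n%:R * n%:R) + 1) by rewrite divr_gt0.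
have /cvgrPdist_lt /(_ _ d0) [k _ /(_ k (leqnn k))] := Phi_cvg0.
rewrite /= sub0r normrN => Pk.
have k0 : 0 < k.+1%:R^-1 / (n%:R * n%:R + 1) :> R.
  by rewrite divr_gt0 ?invr_gt0// ltr_wpDl// mulr_ge0.
have F0 := nbhs_filter (0 : 'rV[R]_n).
have near_h : \forall h \near (0 : 'rV[R]_n), `|h| < k.+1%:R^-1 / (n%:R * n%:R + 1).
  exact: nbhs0_lt.
apply: (@filterS _ _ (nbhs_filter (0 : 'rV[R]_n)) _ _ _ near_h) => h hk.
apply: (le_trans (remainder_le h)).
have hn : n%:R * enorm h <= n%:R * n%:R * `|h|.
  by rewrite -mulrA ler_wpM2l// enorm_le_norm.
have sk : n%:R * enorm h <= k.+1%:R^-1.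
  apply: (le_trans hn); apply: (@le_trans _ _ ((n%:R * n%:R + 1) * `|h|)).
    by rewrite ler_wpM2r// lerDl.
  by rewrite mulrC -ler_pdivlMr ?ltW// ltr_wpDl// mulr_ge0.
have s0 : 0 <= n%:R * enorm h by rewrite mulr_ge0// enorm_ge0.
have Pl : Phi (n%:R * enorm h) <= e / (3 * (n%:R * n%:R) + 1).
  apply: (@le_trans _ _ (Phi k.+1%:R^-1)); first by apply: Phi_mono; rewrite s0.
  by apply: (le_trans (ler_norm _)); exact: ltW.
have Ph0 : 0 <= Phi (n%:R * enorm h).
  by apply: Rintegral_ge0 => w _; rewrite mulr_ge0// le_min ler01 mulr_ge0// enorm_ge0.
apply: (@le_trans _ _ (3 * (n%:R * n%:R * `|h| * (e / (3 * (n%:R * n%:R) + 1))))).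
  by rewrite ler_wpM2l//; apply: ler_pM.
rewrite [leLHS](_ : _ = e * `|h| * ((3 * (n%:R * n%:R)) / (3 * (n%:R * n%:R) + 1))).
  apply: ler_piMr; first by rewrite mulr_ge0// ltW.
  by rewrite ler_pdivrMr// mul1r lerDl.
ring.
Qed.

Lemma derive_trigint i : 'D_(delta_mx 0 i) (trigint A B) x =
  trigint (fun w => w 0 i * B w) (fun w => w 0 i * - A w) x.
Proof.
have [df dE] := trigint_differentiable.
rewrite deriveE// dE /dotpl /dotp (bigD1 i)//= big1 => [|j ji].
  by rewrite !mxE !eqxx mul1r addr0.
by rewrite mxE eqxx (negbTE ji) mul0r.
Qed.

End derivative.

(** Each derivative costs one factor of size [|w|], which the weight provides. *)
Lemma trigint_Cr (Omega : set 'rV[R]_n) r A B :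
  measurable_fun setT (A : lebRn R n -> R) -> measurable_fun setT (B : lebRn R n -> R) ->
  L1 (fun w => (1 + enorm w) ^+ r * A w) -> L1 (fun w => (1 + enorm w) ^+ r * B w) ->
  Cr Omega r (trigint A B).
Proof.
have e0 w : 0 <= enorm w by exact: enorm_ge0.
have e1 w : 1 <= 1 + enorm w by rewrite lerDl.
have p1 k w : 1 <= (1 + enorm w) ^+ k by exact: exprn_ege1.
have me : measurable_fun setT (@enorm R n : lebRn R n -> R).
  by apply: measurable_enorm_comp => i; exact: measurable_coord.
have mp k : measurable_fun setT (fun w : lebRn R n => (1 + enorm w) ^+ k).
  by apply: measurable_funX; apply: measurable_funD; [exact: measurable_cst|exact: me].
have low k F : measurable_fun setT (F : lebRn R n -> R) ->
    L1 (fun w => (1 + enorm w) ^+ k * F w) -> L1 F.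
  move=> mF iF; apply: (L1_le mF (L1_norm iF)) => w.
  by rewrite normrM ler_peMl// (le_trans (p1 k w))// ler_norm.
have low1 k F : measurable_fun setT (F : lebRn R n -> R) ->
    L1 (fun w => (1 + enorm w) ^+ k.+1 * F w) -> L1 (fun w => enorm w * F w).
  move=> mF iF; apply: (L1_le _ (L1_norm iF)).
    by apply: measurable_funM; [exact: me|exact: mF].
  move=> w; rewrite !normrM ler_wpM2r// (ger0_norm (e0 w)) ger0_norm ?exprn_ge0 ?addr_ge0//.
  rewrite exprS; apply: (@le_trans _ _ (1 + enorm w)); first by rewrite lerDr.
  by rewrite ler_peMr// addr_ge0.
elim: r A B => [|r IH] A B mA mB iA iB.
  by apply: continuous_subspaceT; apply: trigint_continuous; exact: (low 0%N).
have jA := low _ _ mA iA; have jB := low _ _ mB iB.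
have kA := low1 _ _ mA iA; have kB := low1 _ _ mB iB.
split=> [x _|i]; first by have [] := trigint_differentiable x jA jB kA kB.
rewrite (_ : (fun x => _) = trigint (fun w => w 0 i * B w) (fun w => w 0 i * - A w)); last first.
  by apply/funext => x; rewrite derive_trigint.
have mc : measurable_fun setT (fun w : lebRn R n => (w : 'rV[R]_n) 0 i) by exact: measurable_coord.
have step F : measurable_fun setT (F : lebRn R n -> R) ->
    L1 (fun w => (1 + enorm w) ^+ r.+1 * F w) -> L1 (fun w => (1 + enorm w) ^+ r * (w 0 i * F w)).
  move=> mF iF; apply: (L1_le _ (L1_norm iF)).
    by apply: measurable_funM; [exact: mp|apply: measurable_funM; [exact: mc|exact: mF]].
  move=> w; rewrite exprSr !normrM !mulrA ler_wpM2r// ler_wpM2l//.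
  by rewrite (le_trans (le_coord_enorm w i))// (le_trans _ (ler_norm _))// lerDr.
have mNA : measurable_fun setT ((fun w => - A w) : lebRn R n -> R).
  by under eq_fun do rewrite -mulN1r; apply: measurable_funM; [exact: measurable_cst|exact: mA].
apply: IH.
- by apply: measurable_funM; [exact: mc|exact: mB].
- by apply: measurable_funM; [exact: mc|exact: mNA].
- exact: step.
- apply: step => //.
  by have := L1Z (-1) iA; under eq_fun do rewrite mulN1r -mulrN.
Qed.

End smooth_trigonometric_integrals.

(** * Transforms of convolutions and dilations *)

Section transform_of_averages.
Context {R : realType} {n : nat}.
Local Notation mu := (leb R n).
Local Notation L1 F := (mu.-integrable setT (EFin \o (F : lebRn R n -> R))).
Implicit Types (x y z u w : 'rV[R]_n) (F G A B : 'rV[R]_n -> R).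
Variable h : 'rV[R]_n -> R.
Hypothesis h_ge0 : forall x, 0 <= h x.
Hypothesis h_decr : forall x y, enorm x <= enorm y -> h y <= h x.
Hypothesis h_mass : (\int[mu]_x (h x)%:E = 1)%E.
Variables (C delta : R).
Hypothesis C0 : 0 < C.
Hypothesis delta0 : 0 < delta.
Hypothesis h_decay : forall x, `|h x| <= C * (1 + enorm x) `^ (- (n%:R + delta)).

Lemma leb_neq0_of_mass : leb R n setT != 0%E.
Proof.
apply/eqP => m0; have : (\int[mu]_x (h x)%:E = 0)%E.
  apply: null_set_integral; [exact: measurableT| |exact: m0].
  by apply/measurable_EFinP; exact: measurable_h.
by rewrite h_mass => /eqP; rewrite onee_eq0.
Qed.

Lemma L1_h : L1 h.
Proof.
apply/integrableP; split; first by apply/measurable_EFinP; exact: measurable_h.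
rewrite (eq_integral (fun x : lebRn R n => (h x)%:E)) ?h_mass ?ltry// => x _.
by rewrite /= ger0_norm.
Qed.

Lemma L1_hscale e : 0 < e -> L1 (hscale h e).
Proof.
move=> e0; rewrite (_ : hscale h e = kern h e 0).
  exact: integrable_kern.
by apply/funext => y; rewrite /kern subr0.
Qed.

Lemma kconv_norm_le F e x : L1 F -> 0 < e ->
  `|kconv h e F x| <= kconv h e (fun y => `|F y|) x.
Proof.
move=> iF e0; have iFa := L1_norm iF.
have i1 := integrable_kern_mul h_ge0 h_decr delta0 h_decay x (L1_L1Linf iF) e0.
have i2 := integrable_kern_mul h_ge0 h_decr delta0 h_decay x (L1_L1Linf iFa) e0.
apply: (le_trans (le_normr_Rintegral measurableT i1)).
apply: le_Rintegral; first exact: measurableT.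
- exact: (L1_norm i1).
- exact: i2.
- by move=> y _; rewrite normrM (ger0_norm (kern_ge0 h_ge0 x y e0)).
Qed.

Lemma L1_kconv F e : L1 F -> 0 < e -> L1 (kconv h e F).
Proof.
move=> iF e0; have iFa := L1_norm iF.
apply: (L1_le _ (integrable_kconv h_ge0 h_decr h_mass delta0 h_decay
  (fun y => normr_ge0 (F y)) iFa e0)); last by move=> x; exact: kconv_norm_le.
apply: continuous_leb_measurable => x.
exact: (kconv_continuous h_ge0 h_decr h_mass C0 delta0 h_decay (L1_L1Linf iF) e0).
Qed.

(** Transforms turn convolution into multiplication of the complex numbers
    [cosint + i sinint]; both real parts are treated at once, as the
    coefficients of [alpha] and [beta]. *)
Lemma transform_kconv (alpha beta : R) F e w : L1 F -> 0 < e ->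
  alpha * cosint (kconv h e F) w + beta * sinint (kconv h e F) w =
  (alpha * cosint (hscale h e) w + beta * sinint (hscale h e) w) * cosint F w +
  (beta * cosint (hscale h e) w - alpha * sinint (hscale h e) w) * sinint F w.
Proof.
move=> iF e0; have iG := L1_kconv iF e0; have ik := L1_hscale e0.
pose phi x := alpha * cos (dotp w x) + beta * sin (dotp w x).
have mphi : measurable_fun setT (phi : lebRn R n -> R).
  by apply: measurable_funD; (apply: measurable_funM; first exact: measurable_cst);
    [apply: measurable_cos_dotp|apply: measurable_sin_dotp] => i;
    [exact: measurable_cst|exact: measurable_coord|exact: measurable_cst|exact: measurable_coord].
have phiK x : `|phi x| <= `|alpha| + `|beta|.
  apply: (le_trans (ler_normD _ _)); rewrite !normrM lerD//.
    by rewrite ler_piMr// cos_norm_le1.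
  by rewrite ler_piMr// sin_norm_le1.
have lin G : L1 G -> \int[mu]_x (G x * phi x) = alpha * cosint G w + beta * sinint G w.
  move=> jG; have j1 := L1_mul_cos w jG; have j2 := L1_mul_sin w jG.
  rewrite /cosint /sinint -(RintegralZl _ measurableT j1) -(RintegralZl _ measurableT j2).
  rewrite -(RintegralD measurableT (L1Z alpha j1) (L1Z beta j2)).
  by apply: eq_Rintegral => x _; rewrite /phi; ring.
rewrite -(lin _ iG).
have iky x : L1 (fun y => kern h e x y * F y).
  exact: (integrable_kern_mul h_ge0 h_decr delta0 h_decay x (L1_L1Linf iF) e0).
have ikx y : L1 (fun x => kern h e x y).
  rewrite (_ : (fun x => _) = kern h e y); first exact: integrable_kern.
  by apply/funext => x; rewrite kern_sym.
pose H x y := kern h e x y * F y * phi x.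
have mF := L1_measurable iF.
have mH : measurable_fun setT (fun z : lebRn R n * lebRn R n => H z.1 z.2).
  apply: measurable_funM; last exact: (measurableT_comp mphi).
  by apply: measurable_funM; [exact: measurable_kern2|exact: (measurableT_comp mF)].
transitivity (\int[mu]_x \int[mu]_y H x y).
  by apply: eq_Rintegral => x _; rewrite /kconv -(RintegralZr _ measurableT (iky x)).
have i1 x : L1 (H x).
  by apply: (L1_mul_bounded (iky x) (measurable_cst _) (K := `|phi x|)).
have i2 y : L1 (H^~ y).
  rewrite /H; under eq_fun do rewrite mulrAC.
  apply: (L1_mul_bounded _ (measurable_cst _) (K := `|F y|)); last by [].
  exact: (L1_mul_bounded (ikx y) mphi phiK).
have iFa := L1_norm iF.
have mFa : measurable_fun setT ((fun y => `|F y|%:E) : lebRn R n -> \bar R).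
  exact: (measurable_norm mF).
have Hoo : (\int[mu]_x \int[mu]_y `|(H x y)%:E| < +oo)%E.
  pose K := `|alpha| + `|beta|.
  have K0 : (0 <= K%:E)%E by rewrite lee_fin addr_ge0.
  have Fa0 y : (0 <= `|F y|%:E)%E by [].
  have mka := measurable_kavg h_ge0 h_decr e0 mFa Fa0.
  have mk x : measurable_fun setT (fun y : lebRn R n => ((kern h e x y)%:E * `|F y|%:E)%E).
    by apply: emeasurable_funM; [apply/measurable_EFinP; exact: measurable_kern|exact: mFa].
  have k0 x (y : lebRn R n) : setT y -> (0 <= (kern h e x y)%:E * `|F y|%:E)%E.
    by move=> _; rewrite mule_ge0// lee_fin kern_ge0.
  have ka0 (x : lebRn R n) : setT x -> (0 <= kavg h e (fun y => `|F y|%:E) x)%E.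
    by move=> _; exact: kavg_ge0.
  apply: (@le_lt_trans _ _ (\int[mu]_x (K%:E * kavg h e (fun y => `|F y|%:E) x))%E).
    apply: ge0_le_integral.
    - exact: measurableT.
    - by move=> x _; exact: integral_ge0.
    - have mHE : measurable_fun setT (fun z : lebRn R n * lebRn R n => `|(H z.1 z.2)%:E|%E).
        by apply: measurableT_comp; [exact: abse_measurable|exact/measurable_EFinP].
      by apply: (@measurable_fun_fubini_tonelli_F _ _ _ _ _ mu
        (fun z : lebRn R n * lebRn R n => `|(H z.1 z.2)%:E|%E)); [exact: mHE|].
    - by apply: emeasurable_funM; [exact: measurable_cst|exact: mka].
    - move=> x _; rewrite /kavg -(ge0_integralZl mu measurableT (mk x) (k0 x) K0).
      apply: ge0_le_integral.
      + exact: measurableT.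
      + by [].
      + apply: measurableT_comp; first exact: abse_measurable.
        by apply/measurable_EFinP; exact: (L1_measurable (i1 x)).
      + by apply: emeasurable_funM; [exact: measurable_cst|exact: mk].
      + move=> y _; rewrite -!EFinM abse_EFin lee_fin /H normrM (normrM (kern h e x y)).
        rewrite (ger0_norm (kern_ge0 h_ge0 x y e0)) [X in _ <= X]mulrC.
        by apply: ler_wpM2l; [rewrite mulr_ge0// kern_ge0|exact: phiK].
  rewrite (ge0_integralZl mu measurableT mka ka0 K0).
  rewrite (integral_kavg h_ge0 h_decr h_mass e0 mFa Fa0).
  have [_ Foo] := integrableP _ _ _ iF.
  apply: lte_mul_pinfty => //; rewrite ge0_fin_numE//; exact: integral_ge0.
rewrite (leb_fubini mH i1 i2 Hoo).
pose a := alpha * cosint (hscale h e) w + beta * sinint (hscale h e) w.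
pose b := beta * cosint (hscale h e) w - alpha * sinint (hscale h e) w.
transitivity (\int[mu]_y (a * (F y * cos (dotp w y)) + b * (F y * sin (dotp w y)))).
  apply: eq_Rintegral => y _.
  pose g u := hscale h e u * (phi (u + y)).
  pose cy := alpha * cos (dotp w y) + beta * sin (dotp w y).
  pose sy := beta * cos (dotp w y) - alpha * sin (dotp w y).
  have gE : g = fun u => cy * (hscale h e u * cos (dotp w u)) + sy * (hscale h e u * sin (dotp w u)).
    by apply/funext => u; rewrite /g /phi /cy /sy dotpDr cosD sinD; ring.
  have j1 := L1_mul_cos w ik; have j2 := L1_mul_sin w ik.
  have ig : L1 g by rewrite gE; exact: (L1D (L1Z cy j1) (L1Z sy j2)).
  transitivity (F y * \int[mu]_u g u).
    have := Rintegral_affine (- y) ltr01 ig; rewrite expr1n invr1 mul1r => <-.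
    have ig' : L1 (fun x => g (affine 1 (- y) x)) by exact: (integrable_affine (- y) ltr01 ig).
    rewrite -(RintegralZl _ measurableT ig'); apply: eq_Rintegral => x _.
    rewrite /g /affine scale1r subrK /H (kern_sym h_decr) /kern; ring.
  have -> : \int[mu]_u g u = cy * cosint (hscale h e) w + sy * sinint (hscale h e) w.
    rewrite gE (RintegralD measurableT (L1Z cy j1) (L1Z sy j2)).
    by rewrite (RintegralZl _ measurableT j1) (RintegralZl _ measurableT j2).
  by rewrite /a /b /cy /sy; ring.
have j1 := L1_mul_cos w iF; have j2 := L1_mul_sin w iF.
rewrite (RintegralD measurableT (L1Z a j1) (L1Z b j2)).
by rewrite (RintegralZl _ measurableT j1) (RintegralZl _ measurableT j2).
Qed.

Lemma cosint_kconv F e w : L1 F -> 0 < e -> cosint (kconv h e F) w =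
  cosint (hscale h e) w * cosint F w - sinint (hscale h e) w * sinint F w.
Proof. by move=> iF e0; have := transform_kconv 1 0 w iF e0; lra. Qed.

Lemma sinint_kconv F e w : L1 F -> 0 < e -> sinint (kconv h e F) w =
  sinint (hscale h e) w * cosint F w + cosint (hscale h e) w * sinint F w.
Proof. by move=> iF e0; have := transform_kconv 0 1 w iF e0; lra. Qed.

Let scale_transform e w : 0 < e ->
  cosint (hscale h e) w = cosint h (e *: w) /\ sinint (hscale h e) w = sinint h (e *: w).
Proof.
move=> e0; have ei0 : 0 < e^-1 by rewrite invr_gt0.
have j1 := L1_mul_cos (e *: w) L1_h; have j2 := L1_mul_sin (e *: w) L1_h.
have i1 := integrable_affine 0 ei0 j1; have i2 := integrable_affine 0 ei0 j2.
have en : e ^- n * (e^-1) ^- n = 1 by rewrite exprVn invrK mulVf// gt_eqF// exprn_gt0.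
have dE x : dotp w x = dotp (e *: w) (affine e^-1 0 x).
  by rewrite /affine addr0 dotpZl dotpZr mulrA mulfV ?mul1r// gt_eqF.
split.
- transitivity (e ^- n * \int[mu]_x (h (affine e^-1 0 x) * cos (dotp (e *: w) (affine e^-1 0 x)))).
    rewrite -(RintegralZl _ measurableT i1); apply: eq_Rintegral => x _.
    by rewrite dE /hscale {2}/affine addr0 mulrA.
  by rewrite (Rintegral_affine 0 ei0 j1) mulrA en mul1r.
- transitivity (e ^- n * \int[mu]_x (h (affine e^-1 0 x) * sin (dotp (e *: w) (affine e^-1 0 x)))).
    rewrite -(RintegralZl _ measurableT i2); apply: eq_Rintegral => x _.
    by rewrite dE /hscale {2}/affine addr0 mulrA.
  by rewrite (Rintegral_affine 0 ei0 j2) mulrA en mul1r.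
Qed.

Lemma power_hscale e w : 0 < e -> power (hscale h e) w = power h (e *: w).
Proof. by move=> e0; have [E1 E2] := scale_transform w e0; rewrite /power E1 E2. Qed.

End transform_of_averages.

(** * The square integrable transform of an integrable function *)

Section fourier_transform.
Context {R : realType} {n : nat}.
Local Notation mu := (leb R n).
Local Notation L1 F := (mu.-integrable setT (EFin \o (F : lebRn R n -> R))).
Implicit Types (x y z u w : 'rV[R]_n) (F G A B : 'rV[R]_n -> R).

Lemma fourier_re_cosint F : fourier_re F = cosint F.
Proof. by apply/funext => w; apply: eq_Rintegral => x _; rewrite dotpC. Qed.

Lemma fourier_im_sinint F : fourier_im F = fun w => - sinint F w.
Proof. by apply/funext => w; congr (- _); apply: eq_Rintegral => x _; rewrite dotpC. Qed.

Lemma Lp2_sqr F : Lp setT 2%:E F -> L1 (fun x => F x ^+ 2).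
Proof.
move=> /LpP; rewrite patch_setT => -[mF NF].
apply/integrableP; split; first by apply/measurable_EFinP; exact: measurable_funX.
move: NF; rewrite Lp_normE// patch_setT => /(lty_poweRy (invr_neq0 _)).
rewrite pnatr_eq0 => /(_ isT); congr (_ < _)%E; apply: eq_integral => x _.
by rewrite powR_mulrn// real_normK ?num_real//= ger0_norm ?sqr_ge0.
Qed.

(** Convergence in mean square makes [F k w - U w] small for arbitrarily late
    [k] at almost every [w], which pins the pointwise limit down without
    extracting a subsequence. *)
Lemma L2_cvg_unique (F : nat -> 'rV[R]_n -> R) G U :
  (forall k, measurable_fun setT (F k : lebRn R n -> R)) ->
  measurable_fun setT (U : lebRn R n -> R) ->
  (forall w, F k w @[k --> \oo] --> G w) ->
  Lp_norm setT 2%:E (fun w => F k w - U w) @[k --> \oo] --> 0%E ->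
  {ae mu, forall w, U w = G w}.
Proof.
move=> mF mU cF /fine_cvgP[fN cN].
pose D k (w : lebRn R n) : R := (F k w - U w) ^+ 2.
have mD k : measurable_fun setT (fun w : lebRn R n => (D k w)%:E).
  by apply/measurable_EFinP; apply: measurable_funX; apply: measurable_funB; [exact: mF|exact: mU].
have D0 k w : 0 <= D k w by exact: sqr_ge0.
have NE k : Lp_norm setT 2%:E (fun w => F k w - U w) = ((\int[mu]_w (D k w)%:E) `^ 2^-1)%E.
  rewrite Lp_normE// patch_setT; congr (_ `^ _)%E; apply: eq_integral => w _.
  by rewrite powR_mulrn// real_normK ?num_real.
have intD : (\int[mu]_w (D k w)%:E @[k --> \oo] --> 0)%E.
  have c2 : fine (Lp_norm setT 2%:E (fun w => F k w - U w)) *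
      fine (Lp_norm setT 2%:E (fun w => F k w - U w)) @[k --> \oo] --> (0 * 0 : R).
    by apply: cvgM; exact: cN.
  rewrite mulr0 in c2.
  have E : \forall k \near \oo, (\int[mu]_w (D k w)%:E)%E =
    (fine (Lp_norm setT 2%:E (fun w => F k w - U w)) *
     fine (Lp_norm setT 2%:E (fun w => F k w - U w)))%:E.
    apply: filterS fN => k; rewrite NE => f.
    have I0 : (0 <= \int[mu]_w (D k w)%:E)%E by apply: integral_ge0 => w _; rewrite lee_fin.
    have fI : (\int[mu]_w (D k w)%:E)%E \is a fin_num.
      rewrite ge0_fin_numE//; apply: (lty_poweRy (r := 2^-1)); first by rewrite invr_eq0 pnatr_eq0.
      by rewrite -ge0_fin_numE// poweR_ge0.
    rewrite -[in LHS](fineK fI) -[in RHS](fineK fI) poweR_EFin /= powR12_sqrt ?fine_ge0//.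
    by rewrite -expr2 sqr_sqrtr// fine_ge0.
  apply: (@cvg_trans _ ((fine (Lp_norm setT 2%:E (fun w => F k w - U w)) *
     fine (Lp_norm setT 2%:E (fun w => F k w - U w)))%:E @[k --> \oo])).
    by apply: near_eq_cvg; apply: filterS E => k ->.
  by apply/fine_cvgP; split; [exact: nearW|exact: c2].
have small : {ae mu, forall w (m : nat) (t : R), 0 < t -> exists j, D (j + m)%N w <= t}.
  apply/ae_foralln => m.
  apply: (ae_inf_small (m := mu) (D := fun j => D (j + m)%N)) => //.
  by rewrite (cvg_shiftn m (fun k => \int[mu]_w (D k w)%:E)%E).
move: small; apply: leb_aeS => w Hw; apply/eqP; rewrite -subr_eq0; apply/eqP.
apply/eqP; apply: contraT => UG.
have d0 : 0 < `|U w - G w| by rewrite normr_gt0.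
have d2 : 0 < `|U w - G w| / 2 by rewrite divr_gt0.
have /cvgrPdist_lt /(_ _ d2) [m _ Hm] := cF w.
have t0 : 0 < (`|U w - G w| / 2) ^+ 2 by rewrite exprn_gt0.
have [j Dj] := Hw m _ t0.
have := Hm (j + m)%N (leq_addl _ _) => /= Gj.
have Fj : `|F (j + m)%N w - U w| <= `|U w - G w| / 2.
  rewrite -(ler_pXn2r (n := 2)) ?nnegrE ?normr_ge0 ?(ltW d2)//.
  by rewrite real_normK ?num_real.
have : `|U w - G w| <= `|G w - F (j + m)%N w| + `|F (j + m)%N w - U w|.
  rewrite -normrN opprB; have := ler_normD (G w - F (j + m)%N w) (F (j + m)%N w - U w).
  by rewrite addrA subrK.
lra.
Qed.

Let ball_lim x : \forall k \near \oo, x \in eball (0 : 'rV[R]_n) k%:R.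
Proof.
near=> k; apply/mem_set; rewrite /eball /= subr0.
apply: (@lt_le_trans _ _ (Num.truncn (enorm x)).+1%:R); first exact: truncnS_gt.
by rewrite ler_nat; near: k; exact: nbhs_infty_ge.
Unshelve. all: by end_near. Qed.

Let trunc F (k : nat) := F \_ (eball (0 : 'rV[R]_n) k%:R).

Let L1_trunc F k : L1 F -> L1 (trunc F k).
Proof.
move=> iF; apply: (L1_le _ (L1_norm iF)).
  by apply: leb_measurable_restr; [exact: measurable_eball|exact: L1_measurable].
by move=> x; rewrite /trunc /restrict; case: ifP => _; rewrite ?normr0.
Qed.

Let trig_cvg F (phi : 'rV[R]_n -> R) : L1 F -> measurable_fun setT (phi : lebRn R n -> R) ->
  (forall x, `|phi x| <= 1) ->
  \int[mu]_x (trunc F k x * phi x) @[k --> \oo] --> \int[mu]_x (F x * phi x).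
Proof.
move=> iF mphi phi1.
have iFp := L1_mul_bounded iF mphi phi1.
have ik k := L1_mul_bounded (L1_trunc k iF) mphi phi1.
have cx : {ae mu, forall x, setT x ->
    (trunc F k x * phi x)%:E @[k --> \oo] --> (F x * phi x)%:E}.
  apply: aeW => x _; apply: cvg_near_cst.
  by apply: filterS (ball_lim x) => k xk; rewrite /trunc /restrict xk.
have dx : {ae mu, forall x (k : nat), setT x -> (`|(trunc F k x * phi x)%:E| <= `|F x|%:E)%E}.
  apply: aeW => x k _; rewrite lee_fin normrM /trunc /restrict.
  by case: ifP => _; rewrite ?normr0 ?mul0r// ler_piMr.
have [_ _ ] := dominated_convergence measurableT
  (fun k => measurable_int mu (ik k)) (measurable_int mu iFp) cx (L1_norm iF) dx.
rewrite -[X in _ --> X](fineK (integrable_fin_num measurableT iFp)).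
by case/fine_cvgP.
Qed.

(** For an integrable function the transforms of its truncations converge
    everywhere to its transform, which must then be the [L^2] limit. *)
Lemma fourier_L2_ae F (u v : 'rV[R]_n -> R) : L1 F -> fourier_L2 F u v ->
  {ae mu, forall w, u w ^+ 2 + v w ^+ 2 = power F w}.
Proof.
move=> iF [/LpP[mu' _] /LpP[mv' _] cu cv].
have mu1 : measurable_fun setT (u : lebRn R n -> R) by move: mu'; rewrite patch_setT.
have mv1 : measurable_fun setT (v : lebRn R n -> R) by move: mv'; rewrite patch_setT.
have mcos w : measurable_fun setT (fun x : lebRn R n => cos (dotp w x)).
  by apply: measurable_cos_dotp => i; [exact: measurable_cst|exact: measurable_coord].
have msin w : measurable_fun setT (fun x : lebRn R n => sin (dotp w x)).
  by apply: measurable_sin_dotp => i; [exact: measurable_cst|exact: measurable_coord].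
have au : {ae mu, forall w, u w = cosint F w}.
  apply: (@L2_cvg_unique (fun k => cosint (trunc F k))).
  - by move=> k; apply: measurable_cosint; exact: L1_trunc.
  - exact: mu1.
  - by move=> w; apply: (trig_cvg iF (mcos w)) => x; exact: cos_norm_le1.
  - by move: cu; under eq_fun do rewrite fourier_re_cosint.
have av : {ae mu, forall w, v w = - sinint F w}.
  apply: (@L2_cvg_unique (fun k w => - sinint (trunc F k) w)).
  - move=> k; under eq_fun do rewrite -mulN1r.
    apply: measurable_funM; first exact: measurable_cst.
    by apply: measurable_sinint; exact: L1_trunc.
  - exact: mv1.
  - by move=> w; apply: cvgN; apply: (trig_cvg iF (msin w)) => x; exact: sin_norm_le1.
  - by move: cv; under eq_fun do rewrite fourier_im_sinint.
move: (leb_aeI au av); apply: leb_aeS => w [-> ->].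
by rewrite sqrrN.
Qed.

Lemma Hr_power r F : L1 F -> Hr r F ->
  L1 (fun w => power F w * (1 + enorm w ^+ 2) ^+ r).
Proof.
move=> iF [_ [u [v [Fuv Huv]]]].
have me : measurable_fun setT (fun w : lebRn R n => (1 + enorm w ^+ 2) ^+ r).
  apply: measurable_funX; apply: measurable_funD; first exact: measurable_cst.
  by apply: measurable_funX; apply: measurable_enorm_comp => i; exact: measurable_coord.
have mp := measurable_power iF.
have mu1 : measurable_fun setT (u : lebRn R n -> R).
  by have [/LpP[]] := Fuv; rewrite patch_setT.
have mv1 : measurable_fun setT (v : lebRn R n -> R).
  by have [_ /LpP[]] := Fuv; rewrite patch_setT.
have e0 w : 0 <= (1 + enorm w ^+ 2) ^+ r by rewrite exprn_ge0// addr_ge0// sqr_ge0.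
apply/integrableP; split.
  by apply/measurable_EFinP; apply: measurable_funM; [exact: mp|exact: me].
apply: le_lt_trans Huv; rewrite le_eqVlt; apply/orP; left; apply/eqP.
apply: ge0_ae_eq_integral.
- exact: measurableT.
- apply: measurableT_comp; first exact: abse_measurable.
  by apply/measurable_EFinP; apply: measurable_funM; [exact: mp|exact: me].
- apply/measurable_EFinP; apply: measurable_funM; last exact: me.
  by apply: measurable_funD; apply: measurable_funX; [exact: mu1|exact: mv1].
- by [].
- by move=> w _; rewrite lee_fin mulr_ge0// addr_ge0// sqr_ge0.
move: (fourier_L2_ae iF Fuv); apply: leb_aeS => w E _ /=.
by rewrite E ger0_norm// mulr_ge0// power_ge0.
Qed.

End fourier_transform.

(** * Smoothness of the averages *)

Section smooth_averages.
Context {R : realType} {n : nat}.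
Local Notation mu := (leb R n).
Local Notation L1 F := (mu.-integrable setT (EFin \o (F : lebRn R n -> R))).
Implicit Types (x y z u w : 'rV[R]_n) (f F G : 'rV[R]_n -> R).
Variables (Omega : set 'rV[R]_n) (h : 'rV[R]_n -> R).
Hypothesis oOmega : open Omega.
Hypothesis h_ge0 : forall x, 0 <= h x.
Hypothesis h_decr : forall x y, enorm x <= enorm y -> h y <= h x.
Hypothesis h_mass : (\int[mu]_x (h x)%:E = 1)%E.
Variables (C delta : R).
Hypothesis C0 : 0 < C.
Hypothesis delta0 : 0 < delta.
Hypothesis h_decay : forall x, `|h x| <= C * (1 + enorm x) `^ (- (n%:R + delta)).
Variable r : nat.
Hypothesis Hrh : Hr r h.

Let neq0 := leb_neq0_of_mass h_decr h_mass.

Let L1h : L1 h. Proof. exact: (L1_h h_ge0 h_decr h_mass). Qed.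

Let me2 : measurable_fun setT (fun w : lebRn R n => 1 + enorm w ^+ 2).
Proof.
apply: measurable_funD; first exact: measurable_cst.
by apply: measurable_funX; apply: measurable_enorm_comp => i; exact: measurable_coord.
Qed.

(** Dilating [h] dilates its transform, and the weights [1 + |w|^2] and
    [1 + |e w|^2] are comparable. *)
Lemma L1_power_hscale e : 0 < e ->
  L1 (fun w => power (hscale h e) w * (1 + enorm w ^+ 2) ^+ r).
Proof.
move=> e0; have i1 := integrable_affine 0 e0 (Hr_power L1h Hrh).
pose M : R := 1 + e ^- 2.
have e2 : 0 < e ^+ 2 by rewrite exprn_gt0.
have ei : 0 < e ^- 2 by rewrite invr_gt0.
have i2 := L1Z (M ^+ r) i1; apply: (L1_le _ i2).
  apply: measurable_funM; last by apply: measurable_funX; exact: me2.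
  by apply: measurable_power; exact: (L1_hscale h_ge0 h_decr h_mass).
move=> w; have q0 : 0 <= 1 + enorm w ^+ 2 by rewrite addr_ge0// sqr_ge0.
rewrite ger0_norm; last by rewrite mulr_ge0 ?power_ge0// exprn_ge0.
rewrite (power_hscale h_ge0 h_decr h_mass w e0).
have -> : affine e 0 w = e *: w by rewrite /affine addr0.
rewrite mulrCA ler_wpM2l ?power_ge0// -exprMn.
rewrite lerXn2r ?nnegrE ?mulr_ge0 ?addr_ge0 ?sqr_ge0 ?(ltW ei)//.
rewrite enormZ gtr0_norm// exprMn.
have E : e ^- 2 * e ^+ 2 = 1 by rewrite mulVf// gt_eqF.
have -> : M * (1 + e ^+ 2 * enorm w ^+ 2) =
  1 + e ^- 2 * e ^+ 2 * enorm w ^+ 2 + (e ^- 2 + e ^+ 2 * enorm w ^+ 2).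
  by rewrite /M; ring.
by rewrite E mul1r lerDl addr_ge0 ?(ltW ei)// mulr_ge0 ?sqr_ge0.
Qed.

(* [(1 + t)^2 <= 2 (1 + t^2)] compares the two weights, and the inequality between
   arithmetic and geometric means separates the factors. *)
Let weight_mul_le (a b c t : R) (k : nat) : 0 <= t ->
  `|(1 + t) ^+ k * (a * b)| <= 2^-1 * (2 ^+ k * (a ^+ 2 * (1 + t ^+ 2) ^+ k) + b ^+ 2).
Proof.
move=> t0; have t1 : 0 <= 1 + t by rewrite addr_ge0.
have s0 : 0 <= (1 + t) ^+ k by rewrite exprn_ge0.
have H : ((1 + t) ^+ k) ^+ 2 <= 2 ^+ k * (1 + t ^+ 2) ^+ k.
  rewrite -exprM mulnC exprM -exprMn lerXn2r ?nnegrE ?sqr_ge0 ?mulr_ge0 ?addr_ge0 ?sqr_ge0//.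
  by have := sqr_ge0 (1 - t); lra.
rewrite !normrM (ger0_norm s0).
set s := (1 + t) ^+ k in s0 H *.
have -> : a ^+ 2 = `|a| ^+ 2 by rewrite real_normK ?num_real.
have -> : b ^+ 2 = `|b| ^+ 2 by rewrite real_normK ?num_real.
have := sqr_ge0 (s * `|a| - `|b|).
have := ler_wpM2l (sqr_ge0 `|a|) H.
lra.
Qed.

Let weighted_transform_L1 e F (a b c d : 'rV[R]_n -> R) : 0 < e -> L1 F -> L1 (fun x => F x ^+ 2) ->
  measurable_fun setT ((fun w => a w * b w + c w * d w) : lebRn R n -> R) ->
  (forall w, a w ^+ 2 + c w ^+ 2 = power (hscale h e) w) ->
  (forall w, b w ^+ 2 + d w ^+ 2 = power F w) ->
  L1 (fun w => (1 + enorm w) ^+ r * (a w * b w + c w * d w)).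
Proof.
move=> e0 iF iF2 mab ac bd.
have iP : L1 (power F).
  apply/integrableP; split; first by apply/measurable_EFinP; exact: measurable_power.
  rewrite (eq_integral (fun w : lebRn R n => (power F w)%:E)); last first.
    by move=> w _; rewrite /= ger0_norm// power_ge0.
  by apply: le_lt_trans (plancherel_le neq0 iF iF2) _; rewrite ltry.
have iD := L1Z 2^-1 (L1D (L1Z (2 ^+ r) (L1_power_hscale e0)) iP).
apply: (L1_le _ iD).
  apply: measurable_funM; last exact: mab.
  apply: measurable_funX; apply: measurable_funD; first exact: measurable_cst.
  by apply: measurable_enorm_comp => i; exact: measurable_coord.
move=> w; rewrite mulrDr; apply: (le_trans (ler_normD _ _)).
have w1 := weight_mul_le (a w) (b w) 0 r (enorm_ge0 w).
have w2 := weight_mul_le (c w) (d w) 0 r (enorm_ge0 w).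
apply: (le_trans (lerD w1 w2)); rewrite -(ac w) -(bd w).
by rewrite le_eqVlt; apply/orP; left; apply/eqP; ring.
Qed.

(** The transform of [kconv h e F] is the product of one with finite energy for
    the weight [(1 + |w|)^(2 r)] and one of finite energy, hence is integrable
    for the weight [(1 + |w|)^r]; invert it. *)
Lemma kconv_Cr e F : 0 < e -> L1 F -> L1 (fun x => F x ^+ 2) -> Cr Omega r (kconv h e F).
Proof.
move=> e0 iF iF2.
have ik := L1_hscale h_ge0 h_decr h_mass e0.
have iG := L1_kconv h_ge0 h_decr h_mass C0 delta0 h_decay iF e0.
have cG := kconv_continuous h_ge0 h_decr h_mass C0 delta0 h_decay (L1_L1Linf iF) e0.
have mcG := measurable_cosint iG; have msG := measurable_sinint iG.
have cE : cosint (kconv h e F) = fun w =>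
    cosint (hscale h e) w * cosint F w + sinint (hscale h e) w * (- sinint F w).
  apply/funext => w.
  by rewrite (cosint_kconv h_ge0 h_decr h_mass C0 delta0 h_decay w iF e0) mulrN.
have sE : sinint (kconv h e F) = fun w =>
    sinint (hscale h e) w * cosint F w + cosint (hscale h e) w * sinint F w.
  by apply/funext => w; rewrite (sinint_kconv h_ge0 h_decr h_mass C0 delta0 h_decay w iF e0).
have jc : L1 (fun w => (1 + enorm w) ^+ r * cosint (kconv h e F) w).
  rewrite cE; apply: (@weighted_transform_L1 e F _ _ _ _ e0 iF iF2).
  - by rewrite -cE.
  - by [].
  - by move=> w; rewrite /power sqrrN.
have js : L1 (fun w => (1 + enorm w) ^+ r * sinint (kconv h e F) w).
  rewrite sE; apply: (@weighted_transform_L1 e F _ _ _ _ e0 iF iF2).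
  - by rewrite -sE.
  - by move=> w; rewrite /power addrC.
  - by [].
have low G : measurable_fun setT (G : lebRn R n -> R) ->
    L1 (fun w => (1 + enorm w) ^+ r * G w) -> L1 G.
  move=> mG jG; apply: (L1_le mG (L1_norm jG)) => w.
  by rewrite normrM ler_peMl// (le_trans _ (ler_norm _))// exprn_ege1// lerDl enorm_ge0.
have T := trigint_Cr Omega mcG msG jc js.
apply: (Cr_ext oOmega _ (CrM oOmega (Cr_cst Omega r (gmass R n ^- 2)) T)) => x Ox.
have inv := fourier_inversion neq0 x iG cG (low _ mcG jc) (low _ msG js).
rewrite !fctE -inv mulrA mulVf ?mul1r// gt_eqF// exprn_gt0//.
exact: (gmass_gt0 neq0).
Qed.

Hypothesis bOmega : bounded_set Omega.

Let mOmega : measurable (Omega : set (lebRn R n)).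
Proof. exact: open_leb_measurable. Qed.

Lemma L1_indic : L1 (\1_Omega : 'rV[R]_n -> R).
Proof.
have [M [_ HM]] := bOmega.
have M1 : M < `|M| + 1 by rewrite ltr_pwDr// ler_norm.
have Oc : Omega `<=` cube 0 (`|M| + 2).
  move=> x /(HM _ M1) /= xM; rewrite cube_ball; last by rewrite ltr_wpDl.
  by rewrite -ball_normE /= sub0r normrN (le_lt_trans xM)// ltrD2l ltr1n.
apply/integrableP; split; first by apply/measurable_EFinP; exact: measurable_indic.
rewrite (eq_integral (fun x : lebRn R n => (\1_Omega x)%:E)); last first.
  by move=> x _; rewrite /= ger0_norm// indicE.
rewrite integral_indic; [|exact: measurableT|exact: mOmega].
rewrite setIT; apply: le_lt_trans (leb_cube_lty 0 (`|M| + 2)); exact: le_leb_outer.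
Qed.

Lemma L1_indic_sqr : L1 (fun x => (\1_Omega x : R) ^+ 2).
Proof.
rewrite (_ : (fun x => _) = \1_Omega); first exact: L1_indic.
by apply/funext => x; rewrite indicE; case: (_ \in _); rewrite ?expr1n ?expr0n.
Qed.

Lemma Lp2_L1 f : Lp Omega 2%:E f -> L1 (f \_ Omega) /\ L1 (fun x => (f \_ Omega) x ^+ 2).
Proof.
move=> Lf; have L2 : Lp setT 2%:E (f \_ Omega) by move: Lf; rewrite /Lp /= patch_setT.
have i2 := Lp2_sqr L2; split; last exact: i2.
have [mf _] := (LpP _ _ _).1 Lf.
apply: (L1_le mf (L1D L1_indic i2)) => x.
rewrite indicE /restrict; case: ifPn => _; last by rewrite normr0 expr0n addr0.
have := sqr_ge0 (`|f x| - 1); have := normr_ge0 (f x).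
by rewrite -[X in _ -> _ -> _ <= _ + X]real_normK ?num_real//= ; lra.
Qed.

Variables (eps0 d0 : R).
Hypothesis d00 : 0 < d0.
Hypothesis d0_le : forall e x, 0 < e < eps0 -> Omega x -> d0 <= dens Omega h e x.

(** On [Omega] the operator is a quotient of two convolutions of [h] with
    functions in [L^1] and [L^2], whose denominator is bounded below. *)
Lemma markov_op_Cr f e : Lp Omega 2%:E f -> 0 < e < eps0 ->
  Cr Omega r (markov_op Omega h e f).
Proof.
move=> Lf e0e; have /andP[e0 _] := e0e; have [iF iF2] := Lp2_L1 Lf.
have c1 := kconv_Cr e0 iF iF2; have c2 := kconv_Cr e0 L1_indic L1_indic_sqr.
have D0 x : Omega x -> kconv h e \1_Omega x != 0.
  by move=> Ox; rewrite -dens_kconv gt_eqF// (lt_le_trans d00)// d0_le.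
apply: (Cr_ext oOmega _ (CrM oOmega c1 (CrV oOmega D0 c2))) => x Ox.
by rewrite (markov_op_kconv h_ge0 h_decr delta0 h_decay (L1_L1Linf iF) e0e Ox).
Qed.

End smooth_averages.

(** * The operators on a thick domain *)

Lemma mass_of_Lp_norm1 (R : realType) (n : nat) (h : 'rV[R]_n -> R) :
  (forall x, 0 <= h x) -> Lp_norm setT 1%:E h = 1%:E -> (\int[leb R n]_x (h x)%:E = 1)%E.
Proof.
move=> h0; rewrite /Lp_norm patch_setT Lnorm1 => <-.
by apply: eq_integral => x _; rewrite /= ger0_norm.
Qed.

Theorem theorem2p8 (R : realType) (n : nat)
    (Omega : set 'rV[R]_n) (h : 'rV[R]_n -> R)
    (Omega_open : open Omega)
    (Omega_thick : thick Omega)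
    (h_L1 : Lp setT 1%:E h)
    (h_ge0 : forall x : 'rV[R]_n, 0 <= h x)
    (h_orth : forall (O : 'M[R]_n) (x : 'rV[R]_n),
       O *m O^T = 1%:M -> h (x *m O^T) = h x)
    (h_norm1 : Lp_norm setT 1%:E h = 1%:E)
    (h_decr : forall x y : 'rV[R]_n, enorm x <= enorm y -> h y <= h x) :
  exists eps0 : R, 0 < eps0 /\
  (* P_eps is a uniformly bounded family of operators on every L^p *)
  (forall (eps : R) (x : 'rV[R]_n), 0 < eps < eps0 -> Omega x -> 0 < dens Omega h eps x) /\
  (forall p : \bar R, (1%:E <= p)%E ->
     (forall eps : R, 0 < eps < eps0 ->
        (forall f : 'rV[R]_n -> R, Lp Omega p f ->
           {ae leb R n, forall x, Omega x -> markov_defined Omega h eps f x}) /\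
        Lp_operator Omega p (markov_op Omega h eps)) /\
     exists M : R, forall (eps : R) (f : 'rV[R]_n -> R), 0 < eps < eps0 -> Lp Omega p f ->
       (Lp_norm Omega p (markov_op Omega h eps f) <= M%:E * Lp_norm Omega p f)%E)
  /\
  ((exists C delta : R, [/\ 0 < C, 0 < delta &
      forall x : 'rV[R]_n, `|h x| <= C * (1 + enorm x) `^ (- (n%:R + delta))]) ->
   [/\ (* 1 *)
       forall (p : \bar R) (f : 'rV[R]_n -> R), (1%:E < p)%E -> Lp Omega p f ->
         {ae leb R n, forall x, Omega x ->
            markov_op Omega h eps f x @[eps --> 0^'+] --> f x},
       (* 2 *)
       forall (p : \bar R) (f : 'rV[R]_n -> R), (1%:E < p < +oo)%E -> Lp Omega p f ->
         Lp_norm Omega p (fun x => markov_op Omega h eps f x - f x)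
           @[eps --> 0^'+] --> 0%E,
       (* 3 *)
       forall p q : \bar R, (1%:E < p)%E -> (p^-1 + q^-1 = 1)%E ->
         Lp setT 1%:E h -> Lp setT q h ->
         forall (f : 'rV[R]_n -> R) (eps : R), Lp Omega p f -> 0 < eps < eps0 ->
           (forall x : 'rV[R]_n, Omega x -> markov_defined Omega h eps f x) /\
           Cb Omega (markov_op Omega h eps f) &
       (* 4 *)
       forall r : nat, bounded_set Omega ->
         Lp setT 1%:E h -> Hr r h ->
         forall (f : 'rV[R]_n -> R) (eps : R), Lp Omega 2%:E f -> 0 < eps < eps0 ->
           (forall x : 'rV[R]_n, Omega x -> markov_defined Omega h eps f x) /\
           Cr Omega r (markov_op Omega h eps f)]).
Proof.
have h_mass := mass_of_Lp_norm1 h_ge0 h_norm1.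
have mOmega : measurable (Omega : set (lebRn R n)) by exact: open_leb_measurable.
have [eps0 [d0 [eps00 d00 d0_le]]] :=
  thick_dens_ge mOmega h_ge0 h_decr h_mass Omega_thick.
exists eps0; split; first exact: eps00.
split.
  by move=> eps x e0e Ox; exact: lt_le_trans d00 (d0_le _ _ e0e Ox).
split.
  move=> p p1; split.
    move=> eps e0e; have /andP[e0 _] := e0e.
    have dle x : Omega x -> d0 <= dens Omega h eps x by exact: d0_le.
    split; last exact: (markov_op_Lp mOmega h_ge0 h_decr h_mass e0 d00 dle p1).
    by move=> f Lf; exact: (ae_markov_defined mOmega h_ge0 h_decr h_mass e0 d00 dle p1 Lf).
  exists d0^-1 => eps f e0e Lf; have /andP[e0 _] := e0e.
  have dle x : Omega x -> d0 <= dens Omega h eps x by exact: d0_le.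
  exact: (Lp_norm_markov_op_le mOmega h_ge0 h_decr h_mass e0 d00 dle p1 Lf).
move=> [C [delta [C0 delta0 h_decay]]]; split.
- move=> p f p1 Lf.
  exact: (ae_markov_op_cvg mOmega h_ge0 h_decr h_mass C0 delta0 h_decay eps00 d00 d0_le
    (Lp_L1Linf (ltW p1) Lf)).
- move=> [p| |] f /andP[p1 poo] Lf; [|by rewrite ltxx in poo|by rewrite ltNge leNye in p1].
  rewrite lte_fin in p1.
  exact: (markov_op_Lp_cvg mOmega h_ge0 h_decr h_mass C0 delta0 h_decay eps00 d00 d0_le
    (ltW p1) Lf).
- move=> p q p1 _ _ _ f eps Lf e0e; have LF := Lp_L1Linf (ltW p1) Lf; split.
    by move=> x Ox; exact: (markov_defined_decay mOmega h_ge0 h_decr C0 delta0 h_decay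
      d00 d0_le LF e0e Ox).
  exact: (markov_op_Cb Omega_open h_ge0 h_decr h_mass C0 delta0 h_decay d00 d0_le LF e0e).
- move=> r bOmega _ Hrh f eps Lf e0e.
  have two1 : (1 <= 2%:E :> \bar R)%E by rewrite lee_fin ler1n.
  have LF := Lp_L1Linf two1 Lf; split.
    by move=> x Ox; exact: (markov_defined_decay mOmega h_ge0 h_decr C0 delta0 h_decay
      d00 d0_le LF e0e Ox).
  exact: (markov_op_Cr Omega_open h_ge0 h_decr h_mass C0 delta0 h_decay Hrh bOmega d00 d0_le
    Lf e0e).
Qed.
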